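(* Let $\mathcal O\subseteq\mathbb R^d$ be a Borel set, let $\zeta$ be a $\sigma$-finite Borel measure on $\mathscr B(\mathcal O)$ and $(U,\mathcal U,\nu)$ a $\sigma$-finite measure space. Assume that (a) $\rho:\mathscr B_b(\mathcal O)\to\mathbb R$ is a signed measure; (b) $W:\mathscr B_b(\mathbb R_+\times\mathcal O)\to L^2(\Omega,P)$ is a Gaussian random measure with characteristics $(0,\mathrm{leb}\otimes\zeta,0)$; (c) $N:\mathscr B_b(\mathbb R_+\times\mathcal O)\otimes\mathcal U\to L^0(\Omega,P)$ is a Poisson random measure with intensity $\mathrm{leb}\otimes\zeta\otimes\nu$, independent of $W$, and with compensated Poisson random measure $\widetilde N$. Then for any functions (1) $b\in L^2(\mathcal O,\zeta)$, (2) $c:\mathcal O\times U\to\mathbb R$ with $\int_{\mathcal O\times U}\big(|c(x,y)|^2\wedge|c(x,y)|\big)\,(\zeta\otimes\nu)(\mathrm dx,\mathrm dy)<\infty$, (3) $d:\mathcal O\times U\to\mathbb R$ with $\int_{\mathcal O\times U}\big(|d(x,y)|\wedge1\big)\,(\zeta\otimes\nu)(\mathrm dx,\mathrm dy)<\infty$, define a mapping $M':\mathscr B_b(\mathbb R_+\times\mathcal O)\to L^0(\Omega,P)$ by $$M'(B)=(\mathrm{leb}\otimes\rho)(B)+\int_B b(x)\,W(\mathrm ds,\mathrm dx)+\int_{B\times U}c(x,y)\,\widetilde N(\mathrm ds,\mathrm dx,\mathrm dy)+\int_{B\times U}d(x,y)\,N(\mathrm ds,\mathrm dx,\mathrm dy).$$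 Then one obtains a Lévy-valued random measure on $\mathscr B_b(\mathcal O)$ by the prescription $$M(t,A):=M'((0,t]\times A)\qquad\text{for all }A\in\mathscr B_b(\mathcal O),\ t\ge0.$$
   Context: Fix a probability space $(\Omega,\mathcal A,P)$; $L^0(\Omega,P)$ is the space of $P$-equivalence classes of real-valued random variables and $L^2(\Omega,P)$ the square-integrable ones. $\mathbb R_+=[0,\infty)$, $\mathrm{leb}$ is Lebesgue measure. For a Borel set $\mathcal O$ of a Euclidean space, $\mathscr B(\mathcal O)$ is its Borel $\sigma$-algebra and $\mathscr B_b(\mathcal O)=\{A\in\mathscr B(\mathcal O): A\text{ is relatively compact}\}$ (a $\delta$-ring). An independently scattered random measure on $\mathscr B_b(\mathcal O)$ is a map $M:\mathscr B_b(\mathcal O)\to L^0(\Omega,P)$ such that for each collection of disjoint sets $A_1,A_2,\ldots\in\mathscr B_b(\mathcal O)$: (a) $M(A_1),M(A_2),\ldots$ are independent; (b) if $\bigcup_k A_k\in\mathscr B_b(\mathcal O)$ then $M(\bigcup_k A_k)=\sum_k M(A_k)$ $P$-a.s. It is an infinitely divisible random measure (respectively a Gaussian or Poisson random measure) if moreover $M(A)$ is infinitely divisible (respectively Gaussian or Poisson distributed) for each $A\in\mathscr B_b(\mathcal O)$. An infinitely divisible random measure has characteristics $(\gamma,\Sigma,\nu)$ if, for each $A\in\mathscr B_b(\mathcal O)$, $M(A)$ has Lévy–Khintchine characteristics $(\gamma(A),\Sigma(A),\nu(A\times\cdot))$ (drift, variance, Lévy measure; truncation function $y\mathbf 1_{[-1,1]}(y)$).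 In particular $W(B)$ is centred Gaussian with variance $(\mathrm{leb}\otimes\zeta)(B)$. A Lévy-valued random measure on $\mathscr B_b(\mathcal O)$ is a family $(M(t):t\ge0)$ of infinitely divisible random measures on $\mathscr B_b(\mathcal O)$ such that for all $n\in\mathbb N$ and $A_1,\dots,A_n\in\mathscr B_b(\mathcal O)$ the process $((M(t)(A_1),\dots,M(t)(A_n)):t\ge0)$ is a Lévy process in $\mathbb R^n$; one writes $M(t,A)=M(t)(A)$. The functions $b,c,d$ are measurable. The integral with respect to $W$ is the usual $L^2$ (Wiener/Walsh) integral, and the integrals with respect to $N$ and $\widetilde N$ are the usual Poisson and compensated Poisson integrals. *)

(* Defs.v *)
From HB Require Import structures.
From mathcomp Require Import all_boot all_order all_algebra finmap.
From mathcomp Require Import all_classical all_reals all_analysis.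
From mathcomp Require Import measurable_realfun.
Set Implicit Arguments.
Unset Strict Implicit.
Unset Printing Implicit Defensive.
Import Order.TTheory GRing.Theory Num.Theory.
Import numFieldNormedType.Exports HBSimple HBNNSimple.
Local Open Scope classical_set_scope.
Local Open Scope ring_scope.

(* R^d is 'rV[R]_d with its Borel sigma-algebra, which matrices do not carry
   in the library. *)
HB.instance Definition _ (R : realType) (m n : nat) :=
  @isMeasurable.Build (sigma_display (@open 'M[R]_(m, n))) 'M[R]_(m, n)
    <<s @open 'M[R]_(m, n) >> (@sigma_algebra0 _ setT _)
    (@sigma_algebraC _ _) (@sigma_algebra_bigcup _ setT _).

(* lebesgue_measure lives on the alias measurableTypeR R of R; leb is the same
   measure on R itself, so that the time axis carries both the sigma-algebra and
   the topology of R. *)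
Definition leb {R : realType} : set R -> \bar R := @lebesgue_measure R.

Section leb_measure.
Context {R : realType}.

Let leb0 : @leb R set0 = 0%E. Proof. exact: measure0. Qed.

Let leb_ge0 A : (0 <= @leb R A)%E. Proof. exact: measure_ge0. Qed.

Let leb_sigma_additive : semi_sigma_additive (@leb R).
Proof. exact: (@measure_semi_sigma_additive _ _ _ (@lebesgue_measure R)). Qed.

HB.instance Definition _ := isMeasure.Build _ R R leb
  leb0 leb_ge0 leb_sigma_additive.

Let leb_sigma_finite : sigma_finite setT (@leb R).
Proof. exact: (@sigma_finiteT _ _ _ (@lebesgue_measure R)). Qed.

HB.instance Definition _ := Measure_isSigmaFinite.Build _ R R leb
  leb_sigma_finite.

End leb_measure.

Section delta_rings.
Context {R : realType} {d : nat}.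

(* Relatively compact means: with compact closure in the ambient Euclidean
   space, which is boundedness. *)
Definition Borel_b (O : set 'rV[R]_d) : set (set 'rV[R]_d) :=
  [set A | [/\ measurable A, A `<=` O & compact (closure A)]].

Definition Borel_b_time (O : set 'rV[R]_d) : set (set (R * 'rV[R]_d)) :=
  [set B | [/\ measurable B, B `<=` (`[0, +oo[ : set R) `*` O & compact (closure B)]].

(* The members of the delta-ring generated by the rectangles B `*` C on which
   the intensity mu is finite. A real-valued Poisson random measure can only be
   defined there, since it is a.s. infinite on sets of infinite intensity. *)
Definition Borel_b_time_mark {dU} {U : measurableType dU} (O : set 'rV[R]_d)
    (mu : set (R * 'rV[R]_d * U) -> \bar R) : set (set (R * 'rV[R]_d * U)) :=
  [set E | [/\ measurable E,
    exists2 B, Borel_b_time O B & E `<=` B `*` setT & (mu E < +oo)%E]].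

End delta_rings.

(* Real-valued sigma-additive set functions on a delta-ring; the library's
   charges live on sigma-algebras. *)
Definition signed_measure_on {X : Type} {R : realType} (D : set (set X))
    (rho : set X -> R) : Prop :=
  rho set0 = 0 /\
  forall A : nat -> set X, (forall k, D (A k)) -> trivIset setT A ->
    D (\bigcup_k A k) ->
    \sum_(k < n) rho (A k) @[n --> \oo] --> rho (\bigcup_k A k).

(* leb (x) rho. The library defines product measures by the same integral of
   the measures of the sections. *)
Definition leb_prod {R : realType} {d : nat} (rho : set 'rV[R]_d -> R)
    (B : set (R * 'rV[R]_d)) : R :=
  \int[leb]_(s in `[0, +oo[) rho (xsection B s).

Section laws.
Context {R : realType} {dT} {T : measurableType dT} (P : probability T R).

Definition mutually_independent {dE} {E : measurableType dE} {I : choiceType}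
    (X : I -> T -> E) : Prop :=
  forall (J : {fset I}) (S : I -> set E), (forall i, measurable (S i)) ->
    fine (P (\bigcap_(i in [set` J]) (X i @^-1` S i))) =
    \prod_(i <- J) fine (P (X i @^-1` S i)).

Definition same_law {dE} {E : measurableType dE}
    {dT'} {T' : measurableType dT'} (Q : probability T' R)
    (X : T -> E) (Y : T' -> E) : Prop :=
  forall S : set E, measurable S -> P (X @^-1` S) = Q (Y @^-1` S).

(* The law of X is N(0, v). The second argument of normal_prob is the standard
   deviation, and normal_prob is not degenerate when that is 0. *)
Definition centred_gaussian (v : R) (X : T -> R) : Prop :=
  0 <= v /\
  forall S : set R, measurable S ->
    P (X @^-1` S) = if v == 0 then \d_(0 : R) S
                    else normal_prob 0 (Num.sqrt v) S.

(* poisson_prob does not depend on its second argument. *)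
Definition poisson_law (lambda : R) (X : T -> R) : Prop :=
  0 <= lambda /\
  forall S : set R, measurable S ->
    P (X @^-1` S) = poisson_prob lambda 0%N [set k : nat | S k%:R].

End laws.

Definition infinitely_divisible {R : realType} {dT} {T : measurableType dT}
    (P : probability T R) (X : T -> R) : Prop :=
  forall n : nat, (0 < n)%N ->
  exists dT' (T' : measurableType dT') (Q : probability T' R)
    (Y : 'I_n -> {RV Q >-> R}),
    [/\ mutually_independent Q Y,
        forall i j, same_law Q Q (Y i) (Y j) &
        same_law P Q X (fun w => \sum_(i < n) Y i w)].

Section random_measures.
Context {R : realType} {dT} {T : measurableType dT} (P : probability T R).
Context {dX} {X : measurableType dX} (D : set (set X)).

(* Elements of L^0 are given by representatives, and random measures on the
   delta-ring D by functions on all sets, of which only the values on D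
   matter. *)
Definition independently_scattered (M : set X -> {RV P >-> R}) : Prop :=
  forall A : nat -> set X, (forall k, D (A k)) -> trivIset setT A ->
    mutually_independent P (fun k => M (A k)) /\
    (D (\bigcup_k A k) ->
     {ae P, forall w,
        \sum_(k < n) M (A k) w @[n --> \oo] --> M (\bigcup_k A k) w}).

Definition infinitely_divisible_random_measure (M : set X -> {RV P >-> R}) :=
  independently_scattered M /\ forall A, D A -> infinitely_divisible P (M A).

(* Characteristics (0, sigma, 0). *)
Definition gaussian_random_measure (sigma : set X -> \bar R)
    (M : set X -> {RV P >-> R}) : Prop :=
  independently_scattered M /\
  forall A, D A -> exists2 v : R, sigma A = v%:E & centred_gaussian P v (M A).

Definition poisson_random_measure (mu : set X -> \bar R)
    (M : set X -> {RV P >-> R}) : Prop :=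
  independently_scattered M /\
  forall A, D A -> exists2 l : R, mu A = l%:E & poisson_law P l (M A).

Definition generated_sigma_algebra (M : set X -> {RV P >-> R}) : set (set T) :=
  <<s [set F | exists A S, [/\ D A, measurable S & F = M A @^-1` S]] >>.

End random_measures.

Definition independent_random_measures {R : realType} {dT}
    {T : measurableType dT} (P : probability T R)
    {dX} {X : measurableType dX} (D : set (set X)) (M : set X -> {RV P >-> R})
    {dY} {Y : measurableType dY} (D' : set (set Y)) (M' : set Y -> {RV P >-> R}) :
    Prop :=
  forall F G, generated_sigma_algebra D M F -> generated_sigma_algebra D' M' G ->
    P (F `&` G) = (P F * P G)%E.

Section stochastic_integrals.
Context {R : realType} {dT} {T : measurableType dT} {P : probability T R}.
Context {dX} {X : measurableType dX} (D : set (set X)).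

Definition simple_over (f : {sfun X >-> R}) : Prop :=
  forall r : R, r != 0 -> D (f @^-1` [set r]).

Definition simple_integral (M : set X -> {RV P >-> R}) (f : {sfun X >-> R})
    (w : T) : R :=
  \sum_(r \in range f) r * M (f @^-1` [set r]) w.

(* I is the image of f under the continuous extension to L^2(mu) -> L^2(P) of
   the integral of simple functions. *)
Definition is_L2_integral (mu : {measure set X -> \bar R})
    (M : set X -> {RV P >-> R}) (f : X -> R) (I : {RV P >-> R}) : Prop :=
  exists fn : nat -> {sfun X >-> R},
    [/\ forall n, simple_over (fn n),
        (\int[mu]_x ((fn n x - f x) ^+ 2)%:E)%E @[n --> \oo] --> 0%E &
        (\int[P]_w ((simple_integral M (fn n) w - I w) ^+ 2)%:E)%E
          @[n --> \oo] --> 0%E].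

(* As for the Lebesgue integral: by monotone approximation for nonnegative
   integrands, and then by difference. *)
Definition is_poisson_integral_nonneg (N : set X -> {RV P >-> R}) (f : X -> R)
    (I : {RV P >-> R}) : Prop :=
  exists fn : nat -> {nnsfun X >-> R},
    [/\ forall n, simple_over (fn n),
        forall x, nondecreasing_seq (fun n => fn n x),
        forall x, fn n x @[n --> \oo] --> f x &
        {ae P, forall w, simple_integral N (fn n) w @[n --> \oo] --> I w}].

Definition is_poisson_integral (N : set X -> {RV P >-> R}) (f : X -> R)
    (I : {RV P >-> R}) : Prop :=
  exists Ip Im : {RV P >-> R},
    [/\ is_poisson_integral_nonneg N f^\+ Ip,
        is_poisson_integral_nonneg N f^\- Im &
        {ae P, forall w, I w = Ip w - Im w}].

Definition compensated (mu : set X -> \bar R) (N : set X -> {RV P >-> R})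
    (E : set X) : {RV P >-> R} :=
  N E \- cst (fine (mu E)).

(* For min(|f|^2, |f|) integrable: the small values of f are integrated in L^2,
   the large ones by integrating with respect to N and to the intensity. *)
Definition is_compensated_integral (mu : {measure set X -> \bar R})
    (N : set X -> {RV P >-> R}) (f : X -> R) (I : {RV P >-> R}) : Prop :=
  exists I1 I2 : {RV P >-> R},
    [/\ is_L2_integral mu (compensated mu N)
          (fun x => if `|f x| <= 1 then f x else 0) I1,
        is_poisson_integral N (fun x => if `|f x| <= 1 then 0 else f x) I2 &
        {ae P, forall w, I w =
          I1 w + I2 w - \int[mu]_(x in [set x | 1 < `|f x|]) f x}].

(* Each integral is unique P-a.s.; xget picks a representative (the default
   value cst 0 is returned only if the integral does not exist). *)
Definition wiener_integral mu M f : {RV P >-> R} :=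
  xget (cst 0 : {mfun T >-> R}) [set I | is_L2_integral mu M f I].

Definition poisson_integral N f : {RV P >-> R} :=
  xget (cst 0 : {mfun T >-> R}) [set I | is_poisson_integral N f I].

Definition compensated_integral mu N f : {RV P >-> R} :=
  xget (cst 0 : {mfun T >-> R}) [set I | is_compensated_integral mu N f I].

End stochastic_integrals.

Section levy.
Context {R : realType} {dT} {T : measurableType dT} (P : probability T R).

(* Paths are not required to be cadlag: here processes are determined only up
   to modification. *)
Definition levy_process {n : nat} (X : R -> T -> 'rV[R]_n) : Prop :=
  [/\ {ae P, forall w, X 0 w = 0},
      forall t : nat -> R, 0 <= t 0%N -> nondecreasing_seq t ->
        mutually_independent P (fun k w => X (t k.+1) w - X (t k) w),
      forall s t : R, 0 <= s -> s <= t ->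
        same_law P P (fun w => X t w - X s w) (X (t - s)) &
      forall t e : R, 0 <= t -> 0 < e ->
        P [set w | e <= `|X s w - X t w|]
          @[s --> within `[0, +oo[%classic (nbhs t)] --> 0%E].

Definition levy_valued_random_measure {d : nat} (O : set 'rV[R]_d)
    (M : R -> set 'rV[R]_d -> {RV P >-> R}) : Prop :=
  (forall t, 0 <= t ->
     infinitely_divisible_random_measure (Borel_b O) (M t)) /\
  forall (n : nat) (A : 'I_n -> set 'rV[R]_d), (forall i, Borel_b O (A i)) ->
    levy_process (fun t w => \row_i M t (A i) w).

End levy.

Section space_time_measure.
Context {R : realType} {dT} {T : measurableType dT} {P : probability T R}.
Context {d : nat} {dU} {U : measurableType dU}.
Variables (O : set 'rV[R]_d).
Variable zeta : {sigma_finite_measure set 'rV[R]_d -> \bar R}.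
Variable nu : {sigma_finite_measure set U -> \bar R}.

Definition intensity_time : {measure set (R * 'rV[R]_d) -> \bar R} :=
  (@leb R \x zeta)%E.

Definition intensity_time_mark : {measure set (R * 'rV[R]_d * U) -> \bar R} :=
  (intensity_time \x nu)%E.

Definition space_time_measure (rho : set 'rV[R]_d -> R)
    (W : set (R * 'rV[R]_d) -> {RV P >-> R})
    (N : set (R * 'rV[R]_d * U) -> {RV P >-> R})
    (b : 'rV[R]_d -> R) (c e : 'rV[R]_d * U -> R)
    (B : set (R * 'rV[R]_d)) : {RV P >-> R} :=
  let DW := Borel_b_time O in
  let DN := Borel_b_time_mark O intensity_time_mark in
  let IW := wiener_integral DW intensity_time W (fun z => \1_B z * b z.2) in
  let Ic := compensated_integral DN intensity_time_mark N
              (fun z => \1_B z.1 * c (z.1.2, z.2)) in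
  let Id := poisson_integral DN N (fun z => \1_B z.1 * e (z.1.2, z.2)) in
  cst (leb_prod rho B) \+ IW \+ Ic \+ Id.

End space_time_measure.

(* Main.v *)
(** Let Y(B) be the sum of the three stochastic integrals over B. Each of them
    is, up to constants, a limit in probability of linear combinations of the
    values of W and N on subsets of B and of B x U: the first two moments of
    the Gaussian, Poisson and compensated Poisson measures make the integrals
    continuous in probability for the functionals [\int b^2],
    [\int min(c^2, |c|)] and [\int min(|e|, 1)]. View W and N as one
    independently scattered family on the disjoint union of their spaces.
    Cutting the finitely many sets involved in simple integrands into atoms
    shows that Y(B_1), Y(B_2), ... are independent for disjoint B_i, and that
    the joint law of the Y(B_i) is unchanged when all B_i are shifted in time,
    since it depends on the intensities only.

    For B = ]s, t] x A this gives independent and stationary increments,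
    infinite divisibility (cut ]0, t] into n equal pieces) and, because the
    three functionals of ]s, t] x A are at most (t - s) times a constant,
    stochastic continuity. For disjoint A_k the remainders
    Y(]0, t] x \bigcup_(k >= n) A_k) tend to 0 in probability; as they are the
    tails of a series of independent variables, a maximal inequality of
    Ottaviani turns this into almost sure convergence. *)
Require Import Defs.
From HB Require Import structures.
From mathcomp Require Import all_boot all_order all_algebra finmap.
From mathcomp Require Import all_classical all_reals all_analysis.
From mathcomp Require Import measurable_realfun ring lra.
Set Implicit Arguments.
Unset Strict Implicit.
Unset Printing Implicit Defensive.
Import Order.TTheory GRing.Theory Num.Theory.
Import numFieldNormedType.Exports HBSimple HBNNSimple.
Local Open Scope classical_set_scope.
Local Open Scope ring_scope.

(** * Convergence in probability *)

(** Two obstacles shape the argument. The integrals are given by specifications of different kinds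
    (mean square limits, monotone almost sure limits, a mixture of both) with arbitrary
    approximating sequences; all are reduced to one notion, the limit in probability along a fixed
    quantization of the values of the integrand. It is unique almost surely, and it is compatible
    with time shifts because a quantizer acting on values commutes with composition. Moreover,
    limits in probability do not preserve the probabilities of arbitrary events, so independence and
    equality in law are carried through the limit by joint distribution functions, for which
    right-continuity is enough, and are then extended to all Borel sets. Both properties come from
    one factorization statement that compares a family [V] on two disjoint regions with a family
    [V2] of the same one-dimensional laws: [V2 = V] gives independence, and an empty second region
    gives equality of joint laws, with [V2] the noise shifted in time. The compensator is
    deterministic, so it only contributes the constants of affine combinations. *)

Section real_probability.
Context {R : realType} {dT} {T : measurableType dT} (P : probability T R).
Implicit Types A B C : set T.

Definition pr A : R := fine (P A).

Lemma prE A : measurable A -> P A = (pr A)%:E.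
Proof. by move=> mA; rewrite fineK// fin_num_measure. Qed.

Lemma pr_ge0 A : 0 <= pr A.
Proof. exact: fine_ge0. Qed.

Lemma pr_le1 A : measurable A -> pr A <= 1.
Proof. by move=> mA; rewrite -lee_fin -prE// probability_le1. Qed.

Lemma prT : pr setT = 1.
Proof. by rewrite /pr probability_setT. Qed.

Lemma pr0 : pr set0 = 0.
Proof. by rewrite /pr measure0. Qed.

Lemma pr_le A B : measurable A -> measurable B -> A `<=` B -> pr A <= pr B.
Proof. by move=> mA mB AB; rewrite -lee_fin -!prE// le_measure// inE. Qed.

Lemma pr_leU A B C : measurable A -> measurable B -> measurable C ->
  A `<=` B `|` C -> pr A <= pr B + pr C.
Proof.
move=> mA mB mC AB.
apply: (@le_trans _ _ (pr (B `|` C))); first by apply: pr_le => //; exact: measurableU.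
rewrite -lee_fin EFinD -!prE//; last exact: measurableU.
exact: measureU2.
Qed.

Lemma prU A B : measurable A -> measurable B -> A `&` B = set0 ->
  pr (A `|` B) = pr A + pr B.
Proof.
move=> mA mB AB; apply: EFin_inj; rewrite EFinD -!prE//; last exact: measurableU.
by rewrite measureU.
Qed.

Lemma pr_eq0 A : measurable A -> pr A = 0 -> P.-negligible A.
Proof. by move=> mA A0; exists A; split=> //; rewrite prE// A0. Qed.

Lemma ae_pr (Q : T -> Prop) (A B : set T) : measurable A -> measurable B ->
  {ae P, forall w, Q w} -> (forall w, Q w -> A w -> B w) -> pr A <= pr B.
Proof.
move=> mA mB [N [mN PN QN]] AB.
rewrite -[leRHS]addr0 -[X in _ <= _ + X](_ : pr N = 0); last by rewrite /pr PN.
apply: pr_leU => // w Aw; have [Qw|/QN] := pselect (Q w); first by left; exact: AB.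
by right.
Qed.

Lemma ae_pr_eq (Q : T -> Prop) (A B : set T) : measurable A -> measurable B ->
  {ae P, forall w, Q w} -> (forall w, Q w -> A w <-> B w) -> pr A = pr B.
Proof.
move=> mA mB hQ AB; apply/eqP; rewrite eq_le.
by apply/andP; split; apply: (ae_pr _ _ hQ) => // w /AB[].
Qed.

Lemma measurable_dist (X Y : T -> R) (e : R) : measurable_fun setT X ->
  measurable_fun setT Y -> measurable [set w | e <= `|X w - Y w|].
Proof.
move=> mX mY; rewrite -[X in measurable X]setTI.
have mf : measurable_fun setT (fun w => `|X w - Y w|).
  by apply: measurableT_comp => //; exact: measurable_funB.
have := mf measurableT `[e, +oo[%classic (measurable_itv _).
by congr (measurable _); apply/seteqP; split=> w /=; rewrite in_itv/= andbT.
Qed.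

Lemma measurable_abs_ge (X : T -> R) (e : R) : measurable_fun setT X ->
  measurable [set w | e <= `|X w|].
Proof.
move=> mX; have := measurable_dist e mX (measurable_cst (0 : R)).
by congr measurable; apply/seteqP; split => w /=; rewrite subr0.
Qed.

Lemma measurable_le_cst (X : T -> R) (e : R) : measurable_fun setT X ->
  measurable [set w | X w <= e].
Proof.
move=> mX; have := mX measurableT `]-oo, e]%classic (measurable_itv _).
by rewrite setTI; congr measurable; apply/seteqP; split => w /=; rewrite in_itv.
Qed.

(* Convergence in probability, with the two epsilons of the definition merged
   as in the Ky Fan metric. *)
Definition cvgP (X : nat -> T -> R) (Y : T -> R) : Prop :=
  forall e, 0 < e -> \forall n \near \oo, pr [set w | e <= `|X n w - Y w|] <= e.

(** Arbitrarily small levels in the hypothesis make each event [|Y - Z| >= 1/(k+1)] null, and these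
    events exhaust the set where [Y] and [Z] differ. *)
Lemma ae_eqP (Y Z : T -> R) : measurable_fun setT Y -> measurable_fun setT Z ->
  (forall e, 0 < e -> pr [set w | e <= `|Y w - Z w|] <= e) ->
  {ae P, forall w, Y w = Z w}.
Proof.
move=> mY mZ YZ.
have h (k : nat) : P.-negligible [set w | k.+1%:R^-1 <= `|Y w - Z w|].
  apply: pr_eq0; first exact: measurable_dist.
  apply/eqP; rewrite eq_le pr_ge0 andbT; apply/ler_addgt0Pr => e e0.
  (* The same number has to serve as threshold, at most 1/(k+1), and as bound, at most [e]. *)
  rewrite add0r; set m := Num.min e k.+1%:R^-1.
  have m0 : 0 < m by rewrite lt_min e0 invr_gt0 ltr0n.
  apply: (@le_trans _ _ (pr [set w | m <= `|Y w - Z w|])).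
    apply: pr_le; [exact: measurable_dist|exact: measurable_dist|].
    by move=> w /=; apply: le_trans; rewrite ge_min lexx orbT.
  by apply: (le_trans (YZ _ m0)); rewrite ge_min lexx.
apply: (negligibleS _ (negligible_bigcup h)) => w /= /eqP.
rewrite -subr_eq0 -normr_gt0 => yz.
have [k kyz] := ltr_add_invr (R := R) (y := 0) yz.
by exists k => //=; rewrite add0r in kyz; exact: ltW.
Qed.

Lemma cvgP_ext (X X' : nat -> T -> R) (Y Y' : T -> R) :
  (forall n, measurable_fun setT (X n)) -> (forall n, measurable_fun setT (X' n)) ->
  measurable_fun setT Y -> measurable_fun setT Y' ->
  (forall n, {ae P, forall w, X n w = X' n w}) -> {ae P, forall w, Y w = Y' w} ->
  cvgP X Y -> cvgP X' Y'.
Proof.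
move=> mX mX' mY mY' XX YY XY e e0; near=> n.
apply: (@le_trans _ _ (pr [set w | e <= `|X n w - Y w|])); last by near: n; exact: XY.
apply: (ae_pr (Q := fun w => X n w = X' n w /\ Y w = Y' w)).
- exact: measurable_dist.
- exact: measurable_dist.
- by apply: filterS2 (XX n) YY => w.
- by move=> w [/= -> ->].
Unshelve. all: by end_near. Qed.

Lemma cvgP_cst (X : T -> R) : cvgP (fun=> X) X.
Proof.
move=> e e0; near=> n; rewrite (_ : [set _ | _] = set0) ?pr0 ?ltW//.
by apply/seteqP; split => // w /=; rewrite subrr normr0 leNgt e0.
Unshelve. all: by end_near. Qed.

Lemma cvgPD (X X' : nat -> T -> R) (Y Y' : T -> R) :
  (forall n, measurable_fun setT (X n)) -> (forall n, measurable_fun setT (X' n)) ->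
  measurable_fun setT Y -> measurable_fun setT Y' ->
  cvgP X Y -> cvgP X' Y' -> cvgP (fun n w => X n w + X' n w) (fun w => Y w + Y' w).
Proof.
move=> mX mX' mY mY' XY XY' e e0; have e2 : 0 < e / 2 by rewrite divr_gt0.
near=> n; rewrite [leRHS]splitr.
have := (_ : pr [set w | e / 2 <= `|X n w - Y w|] <= e / 2) => /(_ _).
move=> h; apply: (le_trans _ (lerD (h _) (_ : pr [set w | e / 2 <= `|X' n w - Y' w|] <= e / 2))).
- apply: pr_leU.
  + by apply: measurable_dist; exact: measurable_funD.
  + exact: measurable_dist.
  + exact: measurable_dist.
  + move=> w /= le; apply/orP; rewrite leNgt [X in _ || X]leNgt -negb_and.
    apply/negP => /andP[h1 h2]; move: le; apply/negP; rewrite -ltNge [ltRHS]splitr.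
    rewrite opprD addrACA; apply: (le_lt_trans (ler_normD _ _)); exact: ltrD.
- by near: n; exact: XY.
- by near: n; exact: XY'.
Unshelve. all: by end_near. Qed.

Lemma cvgPZ (X : nat -> T -> R) (Y : T -> R) (k : R) :
  (forall n, measurable_fun setT (X n)) -> measurable_fun setT Y ->
  cvgP X Y -> cvgP (fun n w => k * X n w) (fun w => k * Y w).
Proof.
(* The [+ 1] covers [k = 0]. The level used below is [Num.min e f], because it is at once the
   threshold for [X n - Y] and the bound on the probability. *)
move=> mX mY XY e e0; set f := e / (`|k| + 1).
have k1 : 0 < `|k| + 1 by rewrite ltr_wpDl.
have f0 : 0 < f by rewrite divr_gt0.
near=> n; apply: (@le_trans _ _ (pr [set w | Num.min e f <= `|X n w - Y w|])).
  apply: pr_le.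
  - by apply: measurable_dist; apply: measurable_funM.
  - exact: measurable_dist.
  - move=> w /=; rewrite -mulrBr normrM => h; rewrite ge_min; apply/orP; right.
    rewrite /f ler_pdivrMr//; apply: (le_trans h).
    by rewrite mulrC ler_wpM2l// lerDl.
apply: (@le_trans _ _ (Num.min e f)); last by rewrite ge_min lexx.
by near: n; apply: XY; rewrite lt_min e0.
Unshelve. all: by end_near. Qed.

Lemma cvgP_unique (X : nat -> T -> R) (Y Z : T -> R) :
  (forall n, measurable_fun setT (X n)) ->
  measurable_fun setT Y -> measurable_fun setT Z ->
  cvgP X Y -> cvgP X Z -> {ae P, forall w, Y w = Z w}.
Proof.
move=> mX mY mZ XY XZ; apply: ae_eqP => // e e0.
(* The vanishing sequence [X n - X n] tends to [Y - Z] in probability. *)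
have := cvgPD mX (fun n => measurable_funM (measurable_cst (-1 : R)) (mX n)) mY
  (measurable_funM (measurable_cst (-1 : R)) mZ) XY (cvgPZ (-1) mX mZ XZ).
move=> /(_ _ e0)[n _ /(_ n (leqnn n))].
congr (pr _ <= _); apply/seteqP; split => w /=; rewrite !mulN1r subrr sub0r normrN//.
Qed.


End real_probability.

Lemma bigsetU_iotaP {T : Type} (F : nat -> set T) n m w :
  (\big[setU/set0]_(n <= k < m) F k) w <-> exists2 k, (n <= k < m)%N & F k w.
Proof.
rewrite -bigcup_seq; split => -[k /= nkm Fk]; exists k => //.
  by move: nkm; rewrite mem_index_iota.
by rewrite /= mem_index_iota.
Qed.

(** * Almost sure convergence: Borel-Cantelli and tails of random series *)

Section almost_sure_convergence.
Context {R : realType} {dT} {T : measurableType dT} (P : probability T R).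
Local Notation pr := (pr P).

(** Continuity from below carries the uniform bound on finite unions to the union of all [F k] with
    [k >= n], which contains the limit superior. *)
Lemma pr_lim_sup_le (F : nat -> set T) (e : R) (n : nat) :
  (forall k, measurable (F k)) ->
  (forall m, pr (\big[setU/set0]_(n <= k < m) F k) <= e) ->
  pr (lim_sup_set F) <= e.
Proof.
move=> mF Fe.
have mU m : measurable (\big[setU/set0]_(n <= k < m) F k).
  by apply: bigsetU_measurable => k _; exact: mF.
have eqU : \bigcup_m (\big[setU/set0]_(n <= k < m) F k) =
           \bigcup_(k in [set k | (n <= k)%N]) F k.
  apply/seteqP; split => w /=.
    by move=> [m _] /bigsetU_iotaP[k /andP[nk _] Fk]; exists k.
  by move=> [k nk Fk]; exists k.+1 => //; apply/bigsetU_iotaP; exists k => //; rewrite nk /=.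
have mUU : measurable (\bigcup_m (\big[setU/set0]_(n <= k < m) F k)).
  exact: bigcupT_measurable.
rewrite -lee_fin -prE; last first.
  by apply: bigcapT_measurable => k; apply: bigcup_measurable.
apply: (@le_trans _ _ (P (\bigcup_(k in [set k | (n <= k)%N]) F k))).
  apply: lim_sup_set_ub => //.
rewrite -eqU.
have nd : {homo (fun m => \big[setU/set0]_(n <= k < m) F k) :
    a b / (a <= b)%N >-> (a <= b)%O}.
  move=> a b ab; apply/subsetPset => w /bigsetU_iotaP[k /andP[nk ka] Fk].
  by apply/bigsetU_iotaP; exists k => //; rewrite nk (leq_trans ka ab).
have := nondecreasing_cvg_mu (mu := P) mU mUU nd.
move=> h; rewrite -(cvg_lim _ h)//; apply: lime_le; first by apply/cvg_ex; eexists; exact: h.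
by near=> m; rewrite /= prE// lee_fin.
Unshelve. all: by end_near. Qed.

(** The limit superior of the events [e <= |X n - Y|] is null, and continuity from above gives small
    probability to the union of all late ones. *)
Lemma ae_cvgP (X : nat -> T -> R) (Y : T -> R) :
  (forall n, measurable_fun setT (X n)) -> measurable_fun setT Y ->
  {ae P, forall w, X n w @[n --> \oo] --> Y w} -> cvgP P X Y.
Proof.
move=> mX mY XY e e0.
pose F n := [set w | e <= `|X n w - Y w|].
have mF n : measurable (F n) by exact: measurable_dist.
have mU n : measurable (\bigcup_(k in [set k | (n <= k)%N]) F k).
  exact: bigcup_measurable.
have PF : P (lim_sup_set F) = 0%E.
  apply: measure_negligible.
    by apply: bigcapT_measurable => n; exact: mU.
  apply: negligibleS XY => w Fw /= XYw.
  move/cvgrPdist_lt: XYw => /(_ e e0)[n _ nX].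
  have [k /= nk] := Fw n Logic.I; rewrite /F /= distrC leNgt.
  by move/negP; apply; exact: nX.
have : P (\bigcup_(k in [set k | (n <= k)%N]) F k) @[n --> \oo] --> 0%E.
  rewrite -PF; apply: (lim_sup_set_cvg P F mF).
  by rewrite -ge0_fin_numE ?measure_ge0// fin_num_measure//; exact: mU.
move=> /fine_cvgP[_] /cvgrPdist_le/(_ _ e0)[n _ h]; near=> k.
apply: (@le_trans _ _ (fine (P (\bigcup_(j in [set j | (k <= j)%N]) F j)))).
  by apply: pr_le; [exact: mF|exact: mU|move=> w ?; exists k => /=].
have := h k; rewrite /= sub0r normrN ger0_norm ?fine_ge0//; apply.
by near: k; exists n.
Unshelve. all: by end_near. Qed.

(** By Borel-Cantelli the steps are almost surely below a geometric sequence from some index on, so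
    the telescoping series converges absolutely. *)
Lemma ae_cauchy_cvg (X : nat -> T -> R) :
  (forall n, measurable_fun setT (X n)) ->
  (forall n, pr [set w | 2^-1 ^+ n <= `|X n.+1 w - X n w|] <= 2^-1 ^+ n) ->
  exists2 Y : T -> R, measurable_fun setT Y &
    {ae P, forall w, X n w @[n --> \oo] --> Y w}.
Proof.
(* The upper limit is measurable everywhere, including the null set where the sequence diverges;
   there [fine] supplies an irrelevant value. *)
move=> mX hX.
exists (fun w => fine (limn_esup (fun n => (X n w)%:E))).
  apply: measurableT_comp => //; apply: measurable_fun_limn_esup => n.
  exact/measurable_EFinP.
pose F n := [set w | 2^-1 ^+ n <= `|X n.+1 w - X n w|].
have mF n : measurable (F n) by exact: measurable_dist.
have half0 n : 0 <= (2^-1 : R) ^+ n by rewrite exprn_ge0// invr_ge0.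
have half1 : `|2^-1 : R| < 1 by rewrite ger0_norm ?invr_ge0// invf_lt1// ltr1n.
have cvg_half : cvgn (series (fun n => 2^-1 ^+ n : R)).
  have := is_cvg_geometric_series (a := 1) half1.
  by rewrite (_ : geometric _ _ = (fun n => 2^-1 ^+ n)) //; apply/funext => n; exact: mul1r.
have PF : P (lim_sup_set F) = 0%E.
  apply: lim_sup_set_cvg0; first exact: mF.
  apply: (@le_lt_trans _ _ (\sum_(0 <= n <oo) (2^-1 ^+ n)%:E)%E).
    apply: lee_nneseries => [n _ _|n _]; first exact: measure_ge0.
    by have := hX n; rewrite -lee_fin -prE; last exact: mF.
  have /EFin_lim h := cvg_half.
  rewrite (_ : (fun n => _) = EFin \o series (fun n => 2^-1 ^+ n : R)) ?h ?ltry//.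
  by apply/funext => n/=; rewrite /series/= -sumEFin.
exists (lim_sup_set F); split => //.
  by apply: bigcapT_measurable => n; apply: bigcup_measurable.
move=> w /= nX; apply: contrapT => nF; apply: nX.
suff : cvgn (X ^~ w).
  move=> Xw; rewrite (_ : fine _ = limn (X ^~ w)) //.
  have := @cvg_limn_einf_sup R (fun n => (X n w)%:E) (limn (X ^~ w))%:E.
  by move=> [|_ ->//]; apply: cvg_EFin => //; exact: nearW.
have [N hN] : exists N, forall k, (N <= k)%N -> `|X k.+1 w - X k w| < 2^-1 ^+ k.
  apply: contrapT => h; apply: nF => N _; apply: contrapT => h'; apply: h.
  exists N => k Nk; rewrite ltNge; apply/negP => h''; apply: h'.
  by exists k.
pose Z n := X (n + N)%N w.
suff : cvgn Z by move=> /cvg_ex[l hl]; apply/cvg_ex; exists l; rewrite -(cvg_shiftn N).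
rewrite (_ : Z = (fun n => Z 0%N + series (telescope Z) n)); last first.
  by apply/funext => n; exact: eq_sum_telescope.
apply: is_cvgD; first exact: is_cvg_cst.
apply: (@normed_cvg R R^o); apply: (@series_le_cvg R _ (fun n => 2^-1 ^+ n)) => //.
- by move=> n /=.
- move=> n; rewrite /telescope /Z /= addSn.
  apply: le_trans (ltW (hN _ (leq_addl n N))) _.
  by rewrite exprD ler_piMr ?half0// exprn_ile1 ?invr_ge0// invf_le1// ler1n.
Qed.

Section tails.
Variables (Y : nat -> T -> R) (mY : forall n, measurable_fun setT (Y n)).
(** [G m] stands for the events decided by the terms of index at least [m] of a series of
    independent variables, and [Y m] for its remainder from [m] on. Thus [Y i - Y m] with [i <= m]
    involves only earlier terms and is independent of [G m]: time runs backwards compared with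
    partial sums. *)
Variable G : nat -> set (set T).
Hypothesis G0 : forall m, G m set0.
Hypothesis GU : forall m A B, G m A -> G m B -> G m (A `|` B).
Hypothesis GD : forall m A B, G m A -> G m B -> G m (A `\` B).
Hypothesis GY : forall (m j : nat) (e : R), (m <= j)%N -> G m [set w | e <= `|Y j w|].
Hypothesis indep : forall (i m : nat) F (e : R), (i <= m)%N -> G m F ->
  pr (F `&` [set w | e <= `|Y i w - Y m w|]) =
  pr F * pr [set w | e <= `|Y i w - Y m w|].
Hypothesis Gm : forall m F, G m F -> measurable F.
Hypothesis Gle : forall i m, (i <= m)%N -> G m `<=` G i.

(* Ottaviani's inequality, run backwards: the events of the j-th step are
   those where the last exit from the ball of radius 3e before time n occurs
   at time j. *)
Let U n (e : R) k := \big[setU/set0]_(n - k <= j < n) [set w | 3 * e <= `|Y j w|].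

Lemma ottaviani n e k i : (i <= n - k)%N -> 0 < e ->
  (forall j, (i <= j < n)%N -> pr [set w | 2 * e <= `|Y i w - Y j w|] <= 2^-1) ->
  G (n - k)%N (U n e k) /\
  pr (U n e k) <= 2 * pr (U n e k `&` [set w | e <= `|Y i w|]).
Proof.
move=> + e0 hi; have mE := measurable_abs_ge e (mY i).
elim: k => [|k IH] ik.
  rewrite /U subn0 big_geq//; split; first exact: G0.
  by rewrite set0I pr0 mulr0.
(* Subtraction is truncated: once [n <= k], the index [n - k] stays at 0 and the union no longer
   grows. *)
have [nk|kn] := leqP n k.
  have -> : U n e k.+1 = U n e k.
    rewrite /U (_ : n - k.+1 = n - k)%N//.
    by apply/eqP; move: nk (leqW nk); rewrite -!subn_eq0 => /eqP -> /eqP ->.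
  have nkE : (n - k.+1 = n - k)%N.
    by apply/eqP; move: nk (leqW nk); rewrite -!subn_eq0 => /eqP -> /eqP ->.
  by rewrite nkE; apply: IH; rewrite -nkE.
have nkS : (n - k = (n - k.+1).+1)%N by rewrite subnSK.
have [GU1 prU1] := IH (leq_trans ik (leq_sub2l n (leqnSn k))).
set m := (n - k.+1)%N in ik *.
have GUm : G m (U n e k) by apply: Gle GU1; rewrite nkS.
have GE : G m [set w | 3 * e <= `|Y m w|] by exact: GY.
(* The new piece of the union: the threshold is passed at [m] and at no later index below [n]. It
   lies in [G m]. *)
pose F := [set w | 3 * e <= `|Y m w|] `\` U n e k.
have GF : G m F by exact: GD.
have UE : U n e k.+1 = U n e k `|` F.
  rewrite /U -/m big_ltn; last by rewrite /m ltn_subrL/= (leq_ltn_trans _ kn).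
  by rewrite /F /U nkS -/m setUDr setDv setD0 [LHS]setUC.
split; first by rewrite UE; exact: GU.
have mU1 := Gm GU1; have mF := Gm GF.
have mU1E : measurable (U n e k `&` [set w | e <= `|Y i w|]) by exact: measurableI.
have mFE : measurable (F `&` [set w | e <= `|Y i w|]) by exact: measurableI.
have disj : U n e k `&` F = set0 by rewrite /F; apply/seteqP; split => w // [? []].
rewrite UE setIUl !prU//; last by rewrite setIACA disj set0I.
rewrite mulrDr lerD//.
have mD : measurable [set w | 2 * e <= `|Y i w - Y m w|] by exact: measurable_dist.
(* On [F], where [|Y m| >= 3e], either [|Y i| >= e] or [|Y i - Y m|] is at least the remaining
   [2e]. *)
have h1 : pr F <= pr (F `&` [set w | e <= `|Y i w|]) +
                  pr (F `&` [set w | 2 * e <= `|Y i w - Y m w|]).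
  apply: pr_leU => //; first exact: measurableI.
  move=> w Fw; have [|eY] := leP e `|Y i w|; first by left.
  right; split => //=; case: Fw => /= h3 _.
  have := ler_distD (Y i w) (Y m w) 0; rewrite !subr0 distrC.
  move: h3 eY; lra.
(* By independence the second term is at most half of [pr F] and is absorbed on the left; hence the
   factor 2 of the inequality. *)
move: h1; rewrite indep// => h1.
have mn : (m < n)%N by rewrite /m ltn_subrL/= (leq_ltn_trans _ kn).
have := hi m; rewrite ik mn => /(_ isT) h2.
have := ler_wpM2l (pr_ge0 P F) h2; move: h1; lra.
Qed.

Lemma tail_ae_cvg0 : cvgP P Y (cst 0) -> {ae P, forall w, Y n w @[n --> \oo] --> (0 : R)}.
Proof.
move=> Y0.
have mF (e : R) k : measurable [set w | e <= `|Y k w|] by exact: measurable_abs_ge.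
have h (e : R) : 0 < e -> P.-negligible (lim_sup_set (fun k => [set w | 3 * e <= `|Y k w|])).
  move=> e0; apply: pr_eq0.
    by apply: bigcapT_measurable => n; exact: bigcup_measurable.
  apply/eqP; rewrite eq_le pr_ge0 andbT; apply/ler_addgt0Pr => f f0; rewrite add0r.
  (* Level of convergence in probability: [g <= e] makes it a bound at threshold [e], [g <= 1/4]
     bounds the probability of [|Y N - Y j| >= 2e] by 1/2 as Ottaviani requires, and [g <= f / 2]
     compensates the factor 2 of the conclusion. *)
  set g := Num.min e (Num.min (f / 2) (4^-1)).
  have g0 : 0 < g by rewrite !lt_min e0 divr_gt0//= invr_gt0.
  have [ge [gf g4]] : g <= e /\ g <= f / 2 /\ g <= 4^-1.
    by rewrite /g; split; [|split]; rewrite !ge_min lexx ?orbT.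
  have [N _ hN] := Y0 _ g0.
  have hN' j : (N <= j)%N -> pr [set w | e <= `|Y j w|] <= g.
    move=> Nj; move: (hN j Nj) => /=; apply: le_trans; apply: pr_le => //.
      by apply: measurable_dist.
    by move=> w /=; rewrite subr0; exact: le_trans.
  apply: (@pr_lim_sup_le _ _ N) => // m.
  have [mN|Nm] := leqP m N; first by rewrite big_geq// pr0 ltW.
  have NE : (m - (m - N) = N)%N by rewrite subKn// ltnW.
  have := @ottaviani m e (m - N) N; rewrite NE => /(_ (leqnn _) e0).
  have hd j : (N <= j < m)%N -> pr [set w | 2 * e <= `|Y N w - Y j w|] <= 2^-1.
    move=> /andP[Nj _]; apply: (@le_trans _ _ (g + g)); last by move: g4; lra.
    apply: (le_trans _ (lerD (hN' N (leqnn N)) (hN' j Nj))).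
    apply: pr_leU => //; first exact: measurable_dist.
    move=> w /=; have [|h1] := leP e `|Y N w|; first by left.
    have [|h2] := leP e `|Y j w|; first by right.
    by have := ler_normB (Y N w) (Y j w); move: h1 h2; lra.
  move=> /(_ hd)[GUm]; rewrite /U NE => /le_trans; apply.
  apply: (@le_trans _ _ (2 * g)); last by move: gf; lra.
  rewrite ler_pM2l//; apply: le_trans (hN' N (leqnn N)).
  apply: pr_le => //; apply: measurableI => //.
  by move: (Gm GUm); rewrite /U NE.
have hk (k : nat) : P.-negligible
    (lim_sup_set (fun j => [set w | 3 * k.+1%:R^-1 <= `|Y j w|])).
  by apply: h; rewrite invr_gt0.
apply: negligibleS (negligible_bigcup hk) => w /= nY.
apply: contrapT => nU; apply: nY; apply/cvgrPdist_lt => e e0.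
have e3 : 0 < e / 3 by rewrite divr_gt0.
have [k] := ltr_add_invr (R := R) (y := 0) e3; rewrite add0r => ke.
apply: contrapT => nc; apply: nU; exists k => // n _.
apply: contrapT => nk; apply: nc; exists n => // j /= nj.
rewrite sub0r normrN ltNge; apply/negP => eY; apply: nk; exists j => //=.
by apply: le_trans eY; move: (ltW ke); rewrite ler_pdivlMr// mulrC.
Qed.

End tails.

End almost_sure_convergence.

(** * Laws of random vectors *)

Section row_borel.
Context {R : realType} {n : nat}.
Implicit Types v : 'rV[R]_n.

Lemma open_measurable_row (U : set 'rV[R]_n) : open U -> measurable U.
Proof. by move=> oU; apply: sub_sigma_algebra. Qed.

Lemma measurable_coord (i : 'I_n) : measurable_fun setT (fun v => v 0 i).
Proof.
apply: (measurability (@RGenOInfty.G R)); first exact: RGenOInfty.measurableE.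
move=> _ [_ [x ->] <-]; rewrite setTI; apply: open_measurable_row.
apply: open_comp; last exact: interval_open.
by move=> v _; exact: coord_continuous.
Qed.

Definition lower_box (x : 'I_n -> R) : set 'rV[R]_n := [set v | forall i, v 0 i <= x i].

Lemma measurable_lower_box x : measurable (lower_box x).
Proof.
rewrite (_ : lower_box x = \bigcap_(i in setT) [set v | v 0 i <= x i]); last first.
  by apply/seteqP; split => [v vx i _|v vx i]; exact: vx.
apply: fin_bigcap_measurable; first exact: finite_finset.
by move=> i _; apply: measurable_le_cst; exact: measurable_coord.
Qed.

Definition lower_boxes : set (set 'rV[R]_n) := range lower_box.

Lemma lower_boxes_setI : setI_closed lower_boxes.
Proof.
move=> _ _ [x _ <-] [y _ <-]; exists (fun i => Num.min (x i) (y i)) => //.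
apply/seteqP; split => v /=.
  by move=> h; split=> i; have := h i; rewrite le_min => /andP[].
by move=> [h1 h2] i; rewrite le_min h1 h2.
Qed.

Lemma lower_boxes_cover : \bigcup_k lower_box (fun=> k%:R) = [set: 'rV[R]_n].
Proof.
apply/seteqP; split => // v _; exists (\max_(i < n) `|Num.ceil (v 0%R i)|)%N => // i.
rewrite pmulrn -ceil_le_int; apply: (le_trans (lez_abs _)); rewrite lez_nat.
exact: (leq_bigmax i).
Qed.

(** A closed half-space is a countable union of boxes whose other bounds grow, so the coordinates
    are measurable for the boxes; and an open set is the union of the countably many cubes with
    rational centre and radius 1/(k+1) that it contains. Since boxes are stable under intersection,
    distribution functions then determine laws. *)
Lemma measurable_rowE : measurable = <<s lower_boxes >>.
Proof.
apply/seteqP; split; last first.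
  apply: smallest_sub; first exact: sigma_algebra_measurable.
  by move=> _ [x _ <-]; exact: measurable_lower_box.
apply: smallest_sub; first exact: smallest_sigma_algebra.
pose Tb := g_sigma_algebraType lower_boxes.
have mcoord (i : 'I_n) : @measurable_fun _ _ Tb R setT (fun v => v 0 i).
  apply: (measurability (@RGenCInfty.G R)); first exact: RGenCInfty.measurableE.
  move=> _ [_ [x ->] <-]; rewrite setTI.
  suff h y : @measurable _ Tb [set v : 'rV[R]_n | v 0 i <= y].
    rewrite -[X in measurable X]setCK; apply: measurableC.
    rewrite (_ : ~` _ = \bigcup_k [set v : 'rV[R]_n | v 0 i <= x - k.+1%:R^-1]).
      by apply: bigcupT_measurable => k; exact: h.
    apply/seteqP; split => v /=.
      move=> /negP; rewrite in_itv/= andbT -ltNge => vx.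
      have [k] := ltr_add_invr vx => vk; exists k => //=.
      by rewrite lerBrDr ltW.
    move=> [k _ vk]; apply/negP; rewrite in_itv/= andbT -ltNge.
    by apply: (le_lt_trans vk); rewrite ltrBlDr ltrDl invr_gt0.
  rewrite (_ : [set v : 'rV[R]_n | v 0 i <= y] =
    \bigcup_k lower_box (fun j => if j == i then y else k%:R)).
    by apply: bigcupT_measurable => k; apply: sub_sigma_algebra; eexists.
  apply/seteqP; split => v /=.
    move=> vy; have : [set: 'rV[R]_n] v by [].
    rewrite -lower_boxes_cover => -[k _ vk]; exists k => //= j.
    by case: eqP => [->//|_]; exact: vk.
  by move=> [k _ /(_ i)]; rewrite eqxx.
move=> U oU; change (@measurable _ Tb U).
pose B (q : 'rV[rat]_n * nat) := [set v : 'rV[R]_n |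
  forall i, `|ratr (q.1 0 i) - v 0 i| < q.2.+1%:R^-1].
have mB q : @measurable _ Tb (B q).
  rewrite (_ : B q = \bigcap_(i in [set: 'I_n])
      [set v | `|ratr (q.1 0 i) - v 0 i| < q.2.+1%:R^-1]); last first.
    by apply/seteqP; split => [v vx i _|v vx i]; exact: vx.
  apply: fin_bigcap_measurable; first exact: finite_finset.
  move=> i _; rewrite -[X in measurable X]setTI.
  have mf : @measurable_fun _ _ Tb R setT (fun v => `|ratr (q.1 0 i) - v 0 i|).
    by apply: measurableT_comp => //; apply: measurable_funB => //; exact: mcoord.
  have := mf measurableT `]-oo, q.2.+1%:R^-1[%classic (measurable_itv _).
  by congr (measurable _); apply/seteqP; split=> w /=; rewrite in_itv.
rewrite (_ : U = \bigcup_(q in [set q | B q `<=` U]) B q); last first.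
  apply/seteqP; split => [v Uv|v [q qU /qU]//].
  have /nbhs_ballP[e/= e0 eU] : nbhs v U by exact: open_nbhs_nbhs.
  have e2 : 0 < e / 2 by rewrite divr_gt0.
  have [k] := ltr_add_invr (R := R) (y := 0) e2; rewrite add0r => ke.
  have hq i : exists q : rat, `|ratr q - v 0 i| < k.+1%:R^-1.
    have k0 : (0 : R) < k.+1%:R^-1 by rewrite invr_gt0.
    have vlt : v 0 i - k.+1%:R^-1 < v 0 i + k.+1%:R^-1 by rewrite ltrD2l gtrN.
    have [q] := rat_in_itvoo vlt; rewrite in_itv/= => qv; exists q.
    by rewrite ltr_distl.
  pose q : 'rV[rat]_n := \row_i projT1 (cid (hq i)).
  exists (q, k) => [u /= Bu|i /=]; last first.
    by rewrite mxE; case: cid.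
  apply: eU; split => // i j; rewrite ord1 {i}.
  rewrite /ball/= (@le_lt_trans _ _ (`|v 0 j - ratr (q 0 j)| + `|ratr (q 0 j) - u 0 j|))//.
    exact: ler_distD.
  rewrite [e]splitr ltrD//.
    by apply: lt_trans ke; rewrite distrC mxE; case: cid.
  by apply: lt_trans ke; exact: Bu.
rewrite bigcup_mkcond; apply: countable_bigcupT_measurable.
  exact: countableP.
by move=> q; case: ifPn => // _; exact: measurable0.
Qed.

Lemma row_measure_unique (m1 m2 : {measure set 'rV[R]_n -> \bar R}) :
  (m1 setT < +oo)%E ->
  (forall x, m1 (lower_box x) = m2 (lower_box x)) ->
  forall S, measurable S -> m1 S = m2 S.
Proof.
move=> m1oo m12; apply: (@measure_unique _ _ _ lower_boxes (fun k => lower_box (fun=> k%:R))).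
- exact: measurable_rowE.
- exact: lower_boxes_setI.
- by move=> k; eexists.
- exact: lower_boxes_cover.
- by move=> _ [x _ <-].
- move=> k; apply: le_lt_trans m1oo; apply: le_measure => //; rewrite inE//.
  exact: measurable_lower_box.
Qed.

End row_borel.

Section row_vectors.
Context {R : realType} {dT} {T : measurableType dT}.

Lemma measurable_row n (Y : 'I_n -> T -> R) : (forall i, measurable_fun setT (Y i)) ->
  measurable_fun setT (fun w => \row_i Y i w : 'rV[R]_n).
Proof.
move=> mY; apply: (measurability (@lower_boxes R n)); first exact: measurable_rowE.
move=> _ [_ [x _ <-] <-]; rewrite setTI.
rewrite (_ : _ @^-1` _ = \bigcap_(i in setT) [set w | Y i w <= x i]).
  apply: fin_bigcap_measurable; first exact: finite_finset.
  by move=> i _; exact: measurable_le_cst.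
by apply/seteqP; split => [w h i _|w h i] /=; [have := h i|have := h i Logic.I]; rewrite mxE.
Qed.

Definition row_rv n (Y : 'I_n -> T -> R) (mY : forall i, measurable_fun setT (Y i)) :
  {mfun T >-> 'rV[R]_n} := mfun_Sub (mem_set (measurable_row mY)).

End row_vectors.

(** * Joint distribution functions and their limits *)

Section box_events.
Context {R : realType} {dT} {T : measurableType dT} (P : probability T R).
Local Notation pr := (pr P).

Definition box_event {I : Type} (Y : I -> T -> R) (x : I -> R) : set T :=
  [set w | forall i, Y i w <= x i].

Lemma measurable_box_event (I : finType) (Y : I -> T -> R) x :
  (forall i, measurable_fun setT (Y i)) -> measurable (box_event Y x).
Proof.
move=> mY; rewrite (_ : box_event Y x = \bigcap_(i in setT) [set w | Y i w <= x i]).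
  apply: fin_bigcap_measurable; first exact: finite_finset.
  by move=> i _; exact: measurable_le_cst.
by apply/seteqP; split => [w h i _|w h i]; exact: h.
Qed.

Lemma row_rv_box n (Y : 'I_n -> T -> R) (mY : forall i, measurable_fun setT (Y i)) x :
  row_rv mY @^-1` lower_box x = box_event Y x.
Proof.
by apply/seteqP; split => w /= h i; have := h i; rewrite mxE.
Qed.

(** For fixed [E] and [q], both sides are finite measures in [S] that agree on lower boxes. With [E]
    an event of a second vector, one application per vector extends a product formula from boxes to
    all Borel sets; with [E = setT] and [q = 1] it identifies laws. *)
Lemma row_factor_aux n (Y Z : 'I_n -> T -> R) (mY : forall i, measurable_fun setT (Y i))
  (mZ : forall i, measurable_fun setT (Z i)) (E : set T) (q : R) : 0 <= q -> measurable E ->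
  (forall x, pr (box_event Y x `&` E) = pr (box_event Z x) * q) ->
  forall S, measurable S ->
  pr (row_rv mY @^-1` S `&` E) = pr (row_rv mZ @^-1` S) * q.
Proof.
move=> pos mE YZ.
have mpre (X : {mfun T >-> 'rV[R]_n}) (S : set 'rV[R]_n) : measurable S -> measurable (X @^-1` S).
  by move=> mS; rewrite -[X in measurable X]setTI; exact: measurable_funP.
pose m1' := pushforward (mrestr P mE) (row_rv mY) : {measure set 'rV[R]_n -> \bar R}.
pose m2' := pushforward P (row_rv mZ) : {measure set 'rV[R]_n -> \bar R}.
pose m1 := m1' (measurable_row mY).
pose m2 := mscale (NngNum pos) (m2' (measurable_row mZ)) : {measure set 'rV[R]_n -> \bar R}.
have m1E S : measurable S -> m1 S = (pr (row_rv mY @^-1` S `&` E))%:E.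
  by move=> mS; rewrite -prE//; apply: measurableI => //; exact: (mpre (row_rv mY)).
have m2E S : measurable S -> m2 S = (pr (row_rv mZ @^-1` S) * q)%:E.
  move=> mS; rewrite mulrC EFinM -prE//; exact: (mpre (row_rv mZ)).
move=> S mS; apply: EFin_inj; rewrite -m1E// -m2E//.
apply: row_measure_unique => //.
  by rewrite m1E// ltry.
by move=> x; rewrite m1E ?m2E//; [|exact: measurable_lower_box..]; rewrite !row_rv_box YZ.
Qed.

Lemma row_factor n n' (Y Z : 'I_n -> T -> R) (Y' Z' : 'I_n' -> T -> R)
  (mY : forall i, measurable_fun setT (Y i)) (mZ : forall i, measurable_fun setT (Z i))
  (mY' : forall i, measurable_fun setT (Y' i)) (mZ' : forall i, measurable_fun setT (Z' i)) :
  (forall x x', pr (box_event Y x `&` box_event Y' x') =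
                pr (box_event Z x) * pr (box_event Z' x')) ->
  forall S S', measurable S -> measurable S' ->
  pr (row_rv mY @^-1` S `&` row_rv mY' @^-1` S') =
  pr (row_rv mZ @^-1` S) * pr (row_rv mZ' @^-1` S').
Proof.
move=> h S S' mS mS'; rewrite setIC mulrC; apply: row_factor_aux => //.
  exact: pr_ge0.
  by rewrite -[X in measurable X]setTI; exact: measurable_funP.
move=> x'; rewrite setIC mulrC; apply: row_factor_aux => //.
  exact: pr_ge0.
  exact: measurable_box_event.
Qed.

Lemma pr_bigU_le (I : Type) (s : seq I) (A : I -> set T) :
  (forall i, measurable (A i)) ->
  pr (\big[setU/set0]_(i <- s) A i) <= \sum_(i <- s) pr (A i).
Proof.
move=> mA; suff [] : measurable (\big[setU/set0]_(i <- s) A i) /\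
  pr (\big[setU/set0]_(i <- s) A i) <= \sum_(i <- s) pr (A i) by [].
elim/big_rec2: _ => [|i y B _ [mB Bh]]; first by rewrite pr0.
have mU := measurableU _ _ (mA i) mB; split=> //.
by apply: le_trans (pr_leU P mU (mA i) mB (@subset_refl _ _)) _; rewrite lerD2l.
Qed.

Lemma pr_exists_le (I : finType) (A : I -> set T) :
  (forall i, measurable (A i)) -> pr [set w | exists i, A i w] <= \sum_i pr (A i).
Proof.
move=> mA; rewrite (_ : [set w | _] = \big[setU/set0]_(i <- index_enum I) A i).
  exact: pr_bigU_le.
rewrite -bigcup_seq; apply/seteqP; split => w /=; last by move=> [i _ Ai]; exists i.
by move=> [i Ai]; exists i => //=; rewrite mem_index_enum.
Qed.

(** Off the event where some coordinate errs by too much, moving the corner of the box by [e]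
    absorbs the error. The estimate is uniform in the corner, so it can be applied at shifted
    corners. *)
Lemma cvgP_box_event (I : finType) (Yn : nat -> I -> T -> R) (Y : I -> T -> R) :
  (forall n i, measurable_fun setT (Yn n i)) -> (forall i, measurable_fun setT (Y i)) ->
  (forall i, cvgP P (fun n => Yn n i) (Y i)) ->
  forall e, 0 < e -> \forall n \near \oo, forall x,
    pr (box_event (Yn n) x) <= pr (box_event Y (fun i => x i + e)) + e /\
    pr (box_event Y x) <= pr (box_event (Yn n) (fun i => x i + e)) + e.
Proof.
(* Each coordinate gets an equal share, so that the union bound costs at most [e]; the successor
   covers an empty [I]. *)
move=> mYn mY YnY e e0; pose f := e / (#|I|.+1)%:R.
have f0 : 0 < f by rewrite divr_gt0.
have fe : f <= e by rewrite ler_pdivrMr// ler_peMr ?ler1n// ltW.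
have : \forall n \near \oo, forall i, pr [set w | f <= `|Yn n i w - Y i w|] <= f.
  by apply: filter_forall => i; exact: YnY.
apply: filterS => n hn.
pose B := [set w | exists i, f <= `|Yn n i w - Y i w|].
have mD i : measurable [set w | f <= `|Yn n i w - Y i w|] by exact: measurable_dist.
have mB : measurable B.
  rewrite (_ : B = \bigcup_(i in setT) [set w | f <= `|Yn n i w - Y i w|]).
    by apply: fin_bigcup_measurable => //; exact: finite_finset.
  by apply/seteqP; split => w [i]; [move=> h; exists i|move=> _ h; exists i].
have prB : pr B <= e.
  apply: le_trans (pr_exists_le mD) _; apply: (@le_trans _ _ (\sum_(i : I) f)).
    exact: ler_sum.
  rewrite sumr_const -mulr_natr /f mulrAC ler_pdivrMr// ler_wpM2l ?ltW//.
  by rewrite ltr_nat.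
have mbox (X : I -> T -> R) y : (forall i, measurable_fun setT (X i)) -> measurable (box_event X y).
  exact: measurable_box_event.
have hB w i : ~ B w -> `|Yn n i w - Y i w| < e.
  move=> nB; apply: lt_le_trans fe; rewrite ltNge; apply/negP => h.
  by apply: nB; exists i.
move=> x; split; apply: le_trans (lerD (lexx _) prB); apply: pr_leU => //; try exact: mbox.
- move=> w Yx; have [|nB] := pselect (B w); first by right.
  left=> i; have := hB w i nB; rewrite ltr_distl => /andP[h _].
  by rewrite -lerBlDr ltW// (lt_le_trans _ (Yx i))// ltrBlDr -ltrBlDl -ltrN2 opprB; move: h; lra.
- move=> w Yx; have [|nB] := pselect (B w); first by right.
  left=> i; have := hB w i nB; rewrite ltr_distl => /andP[_ h].
  by have := Yx i; move: h; lra.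
Qed.

Lemma box_event_right_cont (I : finType) (Y : I -> T -> R) x d :
  (forall i, measurable_fun setT (Y i)) -> 0 < d ->
  exists2 e0, 0 < e0 & forall e, e <= e0 ->
    pr (box_event Y (fun i => x i + e)) <= pr (box_event Y x) + d.
Proof.
move=> mY d0.
pose F (k : nat) := box_event Y (fun i => x i + k.+1%:R^-1).
have mF k : measurable (F k) by exact: measurable_box_event.
have FE : \bigcap_k F k = box_event Y x.
  apply/seteqP; split => [w Fw i|w Fw k _ i]; last first.
    by apply: (le_trans (Fw i)); rewrite lerDl invr_ge0.
  apply/ler_addgt0Pr => e e0; have [k] := ltr_add_invr (R := R) (y := 0) e0.
  by rewrite add0r => ke; apply: (le_trans (Fw k Logic.I i)); rewrite lerD2l ltW.
have mcap : measurable (\bigcap_k F k) by rewrite FE; exact: measurable_box_event.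
have niF : {homo F : m n / (m <= n)%N >-> (n <= m)%O}.
  move=> m n mn; apply/subsetPset => w Fw i; apply: (le_trans (Fw i)).
  by rewrite lerD2l lef_pV2 ?posrE// ler_nat.
have F0 : (P (F 0%N) < +oo)%E by rewrite ltey_eq fin_num_measure.
have : (P \o F) n @[n --> \oo] --> (pr (box_event Y x))%:E.
  by rewrite -FE -prE//; exact: nonincreasing_cvg_mu.
move=> /fine_cvgP[_] /cvgrPdist_le/(_ _ d0)[k _ hk].
have /= := hk k (leqnn k); rewrite -/(pr (F k)) => h.
exists k.+1%:R^-1; first by rewrite invr_gt0.
move=> e ek; have le1 : pr (box_event Y (fun i => x i + e)) <= pr (F k).
  apply: pr_le => //; first exact: measurable_box_event.
  by move=> w h' i; apply: (le_trans (h' i)); rewrite lerD2l.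
by move: h; rewrite ler_norml => /andP[h _]; move: h le1; lra.
Qed.

Lemma box_event_sum (I J : Type) (Y : I -> T -> R) (Y' : J -> T -> R) x x' :
  box_event (fun k => match k with inl i => Y i | inr j => Y' j end)
            (fun k => match k with inl i => x i | inr j => x' j end) =
  box_event Y x `&` box_event Y' x'.
Proof.
apply/seteqP; split=> w /=; first by move=> h; split=> i; [exact: (h (inl i))|exact: (h (inr i))].
by move=> [h1 h2] [i|j]; [exact: h1|exact: h2].
Qed.

(** Each limiting distribution function is squeezed between values of the approximating one at
    slightly shifted corners; right-continuity removes the shifts. No continuity point of the limit
    has to be chosen. The pair is treated as one vector indexed by [I + J]. *)
Lemma box_factor_lim (I J : finType) (Yn Zn : nat -> I -> T -> R)
  (Y'n Z'n : nat -> J -> T -> R) (Y Z : I -> T -> R) (Y' Z' : J -> T -> R) :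
  (forall n i, measurable_fun setT (Yn n i)) -> (forall i, measurable_fun setT (Y i)) ->
  (forall n i, measurable_fun setT (Zn n i)) -> (forall i, measurable_fun setT (Z i)) ->
  (forall n i, measurable_fun setT (Y'n n i)) -> (forall i, measurable_fun setT (Y' i)) ->
  (forall n i, measurable_fun setT (Z'n n i)) -> (forall i, measurable_fun setT (Z' i)) ->
  (forall i, cvgP P (fun n => Yn n i) (Y i)) -> (forall i, cvgP P (fun n => Y'n n i) (Y' i)) ->
  (forall i, cvgP P (fun n => Zn n i) (Z i)) -> (forall i, cvgP P (fun n => Z'n n i) (Z' i)) ->
  (forall n x x', pr (box_event (Yn n) x `&` box_event (Y'n n) x') =
                  pr (box_event (Zn n) x) * pr (box_event (Z'n n) x')) ->
  forall x x', pr (box_event Y x `&` box_event Y' x') =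
               pr (box_event Z x) * pr (box_event Z' x').
Proof.
move=> mYn mY mZn mZ mY'n mY' mZ'n mZ' YnY Y'nY' ZnZ Z'nZ' h x x'.
pose V n (k : I + J) := match k with inl i => Yn n i | inr j => Y'n n j end.
pose V0 (k : I + J) := match k with inl i => Y i | inr j => Y' j end.
pose xx (k : I + J) := match k with inl i => x i | inr j => x' j end.
have mV n k : measurable_fun setT (V n k) by case: k => i; [exact: mYn|exact: mY'n].
have mV0 k : measurable_fun setT (V0 k) by case: k => i; [exact: mY|exact: mY'].
have VV k : cvgP P (fun n => V n k) (V0 k) by case: k => i; [exact: YnY|exact: Y'nY'].
have shift e : (fun k => xx k + e) = (fun k : I + J => match k with inl i => x i + e | inr j => x' j + e end).
  by apply/funext => -[].
have le1 (X : set T) : measurable X -> 0 <= pr X <= 1 by move=> mX; rewrite pr_ge0 pr_le1.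
have mb := measurable_box_event.
(* The constant: the joint value costs [d], each factor is off by at most [2d], and
   [(a + 2d)(b + 2d) <= a b + 8d] as [a], [b] and [d] are at most 1. *)
suff key d : 0 < d -> d <= 1 ->
    `|pr (box_event Y x `&` box_event Y' x') - pr (box_event Z x) * pr (box_event Z' x')| <= 9 * d.
  apply/eqP; rewrite -subr_eq0 -normr_le0; apply/ler_addgt0Pr => e e0; rewrite add0r.
  have d0 : 0 < Num.min 1 (e / 9) by rewrite lt_min ltr01 divr_gt0.
  have d1 : Num.min 1 (e / 9) <= 1 by rewrite ge_min lexx.
  apply: (le_trans (key _ d0 d1)).
  apply: (@le_trans _ _ (9 * (e / 9))); last by lra.
  by rewrite ler_pM2l// ge_min lexx orbT.
move=> d0 d1.
have [e1 e10 h1] := box_event_right_cont x mZ d0.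
have [e2 e20 h2] := box_event_right_cont x' mZ' d0.
have [e3 e30 h3] := box_event_right_cont xx mV0 d0.
pose m := Num.min d (Num.min e1 (Num.min e2 e3)).
have m0 : 0 < m by rewrite !lt_min d0 e10 e20.
have [md [me1 [me2 me3]]] : m <= d /\ m <= e1 /\ m <= e2 /\ m <= e3.
  by rewrite /m; do !split; rewrite !ge_min lexx ?orbT.
(* The corner is moved twice, from the limit to the approximation and back, by a total of [m]. *)
pose e := m / 2; have e0 : 0 < e by rewrite divr_gt0.
have eem : e + e = m by rewrite /e; lra.
have [n [[H1 H2] H3]] : exists n, ((forall x0, pr (box_event (V n) x0) <= pr (box_event V0 (fun i => x0 i + e)) + e /\
    pr (box_event V0 x0) <= pr (box_event (V n) (fun i => x0 i + e)) + e) /\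
    (forall x0, pr (box_event (Zn n) x0) <= pr (box_event Z (fun i => x0 i + e)) + e /\
    pr (box_event Z x0) <= pr (box_event (Zn n) (fun i => x0 i + e)) + e)) /\
    (forall x0, pr (box_event (Z'n n) x0) <= pr (box_event Z' (fun i => x0 i + e)) + e /\
    pr (box_event Z' x0) <= pr (box_event (Z'n n) (fun i => x0 i + e)) + e).
  have [N _ hN] := filterI (filterI (cvgP_box_event mV mV0 VV e0)
    (cvgP_box_event mZn mZ ZnZ e0)) (cvgP_box_event mZ'n mZ' Z'nZ' e0).
  by exists N; exact: (hN N (leqnn N)).
have shift2 (K : Type) (y : K -> R) : (fun i => y i + e + e) = (fun i => y i + m).
  by apply/funext => i; rewrite -addrA eem.
have A1 := (H1 xx).2; have A2 := (H1 (fun k => xx k + e)).1.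
have B1 := (H2 x).2; have B2 := (H2 (fun k => x k + e)).1.
have C1 := (H3 x').2; have C2 := (H3 (fun k => x' k + e)).1.
rewrite ?shift2 in A2 B2 C2.
have A3 := h3 _ me3; have B3 := h1 _ me1; have C3 := h2 _ me2.
rewrite !shift in A1 A2; rewrite shift in A3.
rewrite /V /V0 /xx !box_event_sum h in A1 A2 A3.
have := le1 _ (mb _ _ x mZ); have := le1 _ (mb _ _ x' mZ').
have := le1 _ (mb _ _ (fun i => x i + e) (mZn n)).
have := le1 _ (mb _ _ (fun i => x' i + e) (mZ'n n)).
move: A1 A2 A3 B1 B2 B3 C1 C2 C3.
set a := pr (box_event Z x); set b := pr (box_event Z' x').
set c := pr (box_event Y x `&` _).
set an := pr (box_event (Zn n) _); set bn := pr (box_event (Z'n n) _).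
move=> A1 A2 A3 B1 B2 B3 C1 C2 C3 /andP[bn0 bn1] /andP[an0 an1] /andP[b0 b1] /andP[a0 a1].
have ed : e <= d by move: md eem e0; lra.
have anle : an <= a + 2 * d by move: B2 B3; lra.
have bnle : bn <= b + 2 * d by move: C2 C3; lra.
have anb : an * bn <= c + 2 * d by move: A2 A3; lra.
have can : c <= an * bn + d by move: A1; lra.
have ale : a <= an + d by lra.
have ble : b <= bn + d by lra.
rewrite ler_norml; apply/andP; split; nra.
Qed.

End box_events.

(** * Random variables depending on a part of a scattered family *)

(** The atom of a nonempty set [s] of indices consists of the points lying in [A i] exactly for [i]
    in [s]. Starting from one [A i] with [i] in [s], it is reached by intersections and differences
    only; the empty [s] would describe the complement of all the sets, outside [D] in general, and
    gets [set0] instead. The last clause keeps atoms inside any region that contains the given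
    sets. *)
Lemma atoms_exist {X : Type} (D : set (set X)) (D0 : D set0) (DI : setI_closed D)
    (DD : forall A B, D A -> D B -> D (A `\` B)) (As : seq (set X)) :
  (forall A, A \in As -> D A) ->
  exists (n : nat) (C : 'I_n -> set X) (I : set X -> pred 'I_n),
  [/\ forall j, D (C j), trivIset setT C,
      forall A, A \in As -> A = \bigcup_j (if I A j then C j else set0) &
      forall j, C j = set0 \/ exists2 A, A \in As & C j `<=` A].
Proof.
move=> AD; pose m := size As; pose J := {set 'I_m}.
pose A (i : 'I_m) := nth set0 As i.
have inA i : A i \in As by apply: mem_nth.
pose C (s : J) : set X := if s == finset.set0 then set0
  else [set x | forall i, (i \in s) = `[< A i x >]].
have CA (s : J) i : i \in s -> C s `<=` A i.
  move=> is_ x; rewrite /C; case: ifP => // _ /(_ i); rewrite is_.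
  by move=> /esym/asboolP.
have DC s : D (C s).
  rewrite /C; case: ifPn => // /set0Pn[i0 i0s].
  rewrite (_ : [set x | _] = A i0 `&` [set x | forall i, i \in enum 'I_m -> (i \in s) = `[< A i x >]]).
    elim: (enum 'I_m) => [|i r IH].
      by rewrite (_ : [set x | _] = setT) ?setIT; [exact: AD|apply/seteqP; split].
    case: (boolP (i \in s)) => is_.
      rewrite (_ : _ `&` _ = (A i0 `&` [set x | forall i, i \in r -> (i \in s) = `[< A i x >]]) `&` A i).
        by apply: DI => //; exact: AD.
      apply/seteqP; split => x /=.
        move=> [A0 h]; split; first by split => // j jr; apply: h; rewrite inE jr orbT.
        by apply/asboolP; rewrite -h ?is_// inE eqxx.
      move=> [[A0 h] Ai]; split => // j; rewrite inE => /orP[/eqP ->|]; last exact: h.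
      by rewrite is_; apply/esym/asboolP.
    rewrite (_ : _ `&` _ = (A i0 `&` [set x | forall i, i \in r -> (i \in s) = `[< A i x >]]) `\` A i).
      by apply: DD => //; exact: AD.
    apply/seteqP; split => x /=.
      move=> [A0 h]; split; first by split => // j jr; apply: h; rewrite inE jr orbT.
      by apply/asboolPn; rewrite -h ?is_// inE eqxx.
    move=> [[A0 h] Ai]; split => // j; rewrite inE => /orP[/eqP ->|]; last exact: h.
    by rewrite (negbTE is_); apply/esym/asboolF.
  apply/seteqP; split => x /=.
    move=> h; split; last by move=> i _; exact: h.
    by apply/asboolP; rewrite -h.
  by move=> [_ h] i; apply: h; rewrite mem_enum.
have tC : trivIset setT C.
  apply/trivIsetP => s t _ _ st; apply/seteqP; split => // x; rewrite /C.
  case: ifPn => [_ []//|_]; case: ifPn => [_ []//|_ [/= h1 h2]].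
  by move/eqP: st; apply; apply/setP => i; rewrite h1 h2.
exists #|{: J}|, (fun j => C (enum_val j)),
  (fun B j => [exists i in (enum_val j : J), A i == B]); split => //.
- apply/trivIsetP => i j _ _ ij; move/trivIsetP: tC; apply => //.
  by apply: contra ij => /eqP/enum_val_inj ->.
- move=> B BAs; apply/seteqP; split => x /=.
    move=> Bx; have Bi : (index B As < m)%N by rewrite index_mem.
    pose i := Ordinal Bi; have AiB : A i = B by rewrite /A nth_index.
    pose s : J := [set i | `[< A i x >]]%SET.
    have is_ : i \in s by rewrite inE AiB; apply/asboolP.
    exists (enum_rank s) => //; rewrite enum_rankK.
    case: ifPn => [_|/negP]; last by case; apply/existsP; exists i; rewrite is_ AiB/=.
    rewrite /C; case: ifPn => [/eqP s0|_]; first by rewrite s0 inE in is_.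
    by move=> j; rewrite inE.
  move=> [j _]; case: ifP => // /existsP[i /andP[is_ /eqP <-]] /=; exact: CA.
- move=> j; rewrite /C; case: ifPn => [|/set0Pn[i is_]]; first by left.
  right; exists (A i) => //; have := @CA (enum_val j) i is_.
  by rewrite /C; case: ifPn => // /eqP s0; rewrite s0 inE in is_.
Qed.

Section scattered.
Context {R : realType} {dT} {T : measurableType dT} (P : probability T R).
Local Notation pr := (pr P).
Context {X : Type} (D : set (set X)).
Hypothesis D0 : D set0.
Hypothesis DI : setI_closed D.
Hypothesis DD : forall A B, D A -> D B -> D (A `\` B).

Definition fin_additive (V : set X -> T -> R) : Prop :=
  forall (J : finType) (C : J -> set X), (forall j, D (C j)) -> trivIset setT C ->
    D (\bigcup_j C j) -> {ae P, forall w, V (\bigcup_j C j) w = \sum_j V (C j) w}.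

Definition fin_independent (V : set X -> T -> R) : Prop :=
  forall (J : finType) (C : J -> set X), (forall j, D (C j)) -> trivIset setT C ->
    forall S : J -> set R, (forall j, measurable (S j)) ->
    pr [set w | forall j, S j (V (C j) w)] = \prod_j pr (V (C j) @^-1` S j).

Definition lin (V : set X -> T -> R) (l : seq (R * set X)) (w : T) : R :=
  \sum_(p <- l) p.1 * V p.2 w.

Lemma lin_cat V l l' w : lin V (l ++ l') w = lin V l w + lin V l' w.
Proof. by rewrite /lin big_cat. Qed.

Lemma measurable_lin V l : (forall A, measurable_fun setT (V A)) ->
  measurable_fun setT (lin V l).
Proof.
move=> mV; rewrite /lin; elim: l => [|p l IH].
  by under eq_fun do rewrite big_nil; exact: measurable_cst.
under eq_fun do rewrite big_cons.
by apply: measurable_funD => //; exact: measurable_funM.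
Qed.

(** This is additivity over the empty family. *)
Lemma fin_additive0 V : fin_additive V -> {ae P, forall w, V set0 w = 0}.
Proof.
move=> /(_ void (fun=> set0)) h.
have E : \bigcup_(j in [set: void]) (set0 : set X) = set0 by rewrite bigcup0.
have tr : trivIset setT (fun _ : void => set0 : set X) by apply/trivIsetP => -[].
move: h; rewrite E => /(_ (fun=> D0) tr D0); apply: filterS => w ->.
by rewrite big1 => [|[]].
Qed.

Lemma fin_additive_atoms V n (C : 'I_n -> set X) (I : set X -> pred 'I_n) A :
  fin_additive V -> (forall j, D (C j)) -> trivIset setT C -> D A ->
  A = \bigcup_j (if I A j then C j else set0) ->
  {ae P, forall w, V A w = \sum_j (I A j)%:R * V (C j) w}.
Proof.
move=> aV DC tC DA AE.
have := aV _ (fun j => if I A j then C j else set0).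
rewrite -AE => h; have h0 := fin_additive0 aV.
apply: filterS2 (h _ _ DA) h0.
- move=> w -> w0; apply: eq_bigr => j _; case: ifP => _; first by rewrite mul1r.
  by rewrite mul0r.
- by move=> j; case: ifP.
- apply/trivIsetP => i j _ _ ij; move/trivIsetP: tC => /(_ i j Logic.I Logic.I ij) e0.
  by case: ifP => _; case: ifP => _; rewrite ?setI0 ?set0I.
Qed.

Lemma ae_finite (I : finType) (Q : I -> T -> Prop) :
  (forall i, {ae P, forall w, Q i w}) -> {ae P, forall w, forall i, Q i w}.
Proof. by move=> h; apply: filter_forall. Qed.

Lemma lin_atoms V n (C : 'I_n -> set X) (I : set X -> pred 'I_n) (l : seq (R * set X)) :
  fin_additive V -> (forall j, D (C j)) -> trivIset setT C ->
  (forall p, p \in l -> D p.2) ->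
  (forall p, p \in l -> p.2 = \bigcup_j (if I p.2 j then C j else set0)) ->
  {ae P, forall w, lin V l w = \sum_j (\sum_(p <- l) p.1 * (I p.2 j)%:R) * V (C j) w}.
Proof.
move=> aV DC tC; rewrite /lin; elim: l => [|p l IH] Dl lE.
  by apply: aeW => w; rewrite big_nil big1// => j _; rewrite big_nil mul0r.
have h1 := fin_additive_atoms aV DC tC (Dl p (mem_head _ _)) (lE p (mem_head _ _)).
have inl q : q \in l -> q \in p :: l by move=> ql; rewrite inE ql orbT.
have h2 := IH (fun q ql => Dl q (inl q ql)) (fun q ql => lE q (inl q ql)).
apply: filterS2 h1 h2 => w e1 e2.
rewrite big_cons e2 e1 mulr_sumr -big_split; apply: eq_bigr => j _.
by rewrite big_cons mulrDl mulrA.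
Qed.

Section factor.
Variables V V2 : set X -> T -> R.
Hypothesis mV : forall A, measurable_fun setT (V A).
Hypothesis mV2 : forall A, measurable_fun setT (V2 A).
Hypothesis aV : fin_additive V.
Hypothesis aV2 : fin_additive V2.
Hypothesis iV : fin_independent V.
Hypothesis iV2 : fin_independent V2.
Hypothesis VV2 : forall A S, D A -> measurable S -> pr (V A @^-1` S) = pr (V2 A @^-1` S).

Definition supported (B : set X) (l : seq (R * set X)) : Prop :=
  forall p, p \in l -> D p.2 /\ p.2 `<=` B.

(** Atoms and coefficients depend on the lists alone, so one decomposition serves every additive
    family; this allows [V] and [V2] to be compared atom by atom. *)
Lemma lin_atoms_exist (B : set X) m (l : 'I_m -> seq (R * set X)) :
  (forall i, supported B (l i)) ->
  exists (n : nat) (C : 'I_n -> set X) (r : 'I_m -> 'I_n -> R),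
  [/\ forall j, D (C j), trivIset setT C, forall j, C j `<=` B &
      forall V', fin_additive V' ->
        {ae P, forall w, forall i, lin V' (l i) w = \sum_j r i j * V' (C j) w}].
Proof.
move=> sl; pose As := flatten [seq [seq p.2 | p <- l i] | i <- enum 'I_m].
have inAs i p : p \in l i -> p.2 \in As.
  move=> pl; apply/flattenP; exists [seq p.2 | p <- l i]; last exact: map_f.
  by apply/mapP; exists i => //; rewrite mem_enum.
have AsD A : A \in As -> D A /\ A `<=` B.
  by move=> /flattenP[s /mapP[i _ ->] /mapP[p pl ->]]; exact: sl pl.
have [n [C [I [DC tC CE Csub]]]] := atoms_exist D0 DI DD (fun A h => (AsD A h).1).
exists n, C, (fun i j => \sum_(p <- l i) p.1 * (I p.2 j)%:R); split => //.
  by move=> j; case: (Csub j) => [->//|[A /AsD[_ AB] /subset_trans]]; exact.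
move=> V' aV'; apply: ae_finite => i; apply: lin_atoms => //.
  by move=> p /inAs/AsD[].
by move=> p /inAs/CE.
Qed.

(** The atoms of the lists on [B] and on [B'] together form one disjoint family. The values of [V]
    there are independent with the one-dimensional laws of [V2], so the joint law of the two vectors
    of atomic values is a product; the affine combinations are Borel functions of these vectors. *)
Lemma lin_factor (B B' : set X) m m' (l : 'I_m -> seq (R * set X))
  (l' : 'I_m' -> seq (R * set X)) (a : 'I_m -> R) (a' : 'I_m' -> R) :
  B `&` B' = set0 -> (forall i, supported B (l i)) -> (forall i, supported B' (l' i)) ->
  forall x x',
  pr (box_event (fun i w => a i + lin V (l i) w) x `&`
      box_event (fun i w => a' i + lin V (l' i) w) x') =
  pr (box_event (fun i w => a i + lin V2 (l i) w) x) *
  pr (box_event (fun i w => a' i + lin V2 (l' i) w) x').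
Proof.
move=> BB' sl sl'.
have [n [C [r [DC tC CB hr]]]] := lin_atoms_exist sl.
have [n' [C' [r' [DC' tC' CB' hr']]]] := lin_atoms_exist sl'.
have mZ (V' : set X -> T -> R) : (forall A, measurable_fun setT (V' A)) ->
  forall j, measurable_fun setT (V' (C j)) by [].
have mZ' (V' : set X -> T -> R) : (forall A, measurable_fun setT (V' A)) ->
  forall j, measurable_fun setT (V' (C' j)) by [].
have msetle y : measurable [set z : R | z <= y].
  by rewrite (_ : [set z | _] = `]-oo, y]%classic)//; apply/seteqP; split => z /=; rewrite in_itv.
have key := row_factor (mZ V mV) (mZ V2 mV2) (mZ' V mV) (mZ' V2 mV2).
have {}key : forall S S', measurable S -> measurable S' ->
  pr (row_rv (mZ V mV) @^-1` S `&` row_rv (mZ' V mV) @^-1` S') =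
  pr (row_rv (mZ V2 mV2) @^-1` S) * pr (row_rv (mZ' V2 mV2) @^-1` S').
  apply: key => y y'; rewrite -box_event_sum.
  pose CC (k : 'I_n + 'I_n') := match k with inl i => C i | inr j => C' j end.
  pose yy (k : 'I_n + 'I_n') := match k with inl i => y i | inr j => y' j end.
  have DCC k : D (CC k) by case: k.
  have tCC : trivIset setT CC.
    move/trivIsetP : tC => tC; move/trivIsetP : tC' => tC'.
    apply/trivIsetP => -[i|i] [j|j] _ _ ij /=.
    - by apply: tC.
    - by apply/seteqP; split => // z [/CB h1 /CB' h2]; rewrite -BB'.
    - by apply/seteqP; split => // z [/CB' h1 /CB h2]; rewrite -BB'.
    - by apply: tC'.
  rewrite (_ : box_event _ _ = [set w | forall k, [set z | z <= yy k] (V (CC k) w)]); last first.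
    by apply/seteqP; split => w h [k|k]; [exact: (h (inl k))|exact: (h (inr k))|
      exact: (h (inl k))|exact: (h (inr k))].
  rewrite (iV DCC tCC (fun k => msetle (yy k))) big_sumType/=.
  have -> : box_event (fun j => V2 (C j)) y =
    [set w | forall j, [set z | z <= y j] (V2 (C j) w)] by [].
  have -> : box_event (fun j => V2 (C' j)) y' =
    [set w | forall j, [set z | z <= y' j] (V2 (C' j) w)] by [].
  rewrite (iV2 DC tC (fun k => msetle (y k))) (iV2 DC' tC' (fun k => msetle (y' k))).
  by congr (_ * _); apply: eq_bigr => j _; apply: VV2.
move=> x x'.
pose S : set 'rV[R]_n := box_event (fun i (v : 'rV[R]_n) => a i + \sum_j r i j * v 0 j) x.
pose S' : set 'rV[R]_n' := box_event (fun i (v : 'rV[R]_n') => a' i + \sum_j r' i j * v 0 j) x'.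
have msum p (k : 'I_p -> R) c : measurable_fun setT (fun v : 'rV[R]_p => c + \sum_j k j * v 0 j).
  apply: measurable_funD => //; apply: measurable_sum => j.
  by apply: measurable_funM => //; exact: measurable_coord.
have mS : measurable S by apply: measurable_box_event => i; exact: msum.
have mS' : measurable S' by apply: measurable_box_event => i; exact: msum.
have pre (V' : set X -> T -> R) (mV' : forall A, measurable_fun setT (V' A)) w :
    (forall i, lin V' (l i) w = \sum_j r i j * V' (C j) w) ->
    (box_event (fun i w => a i + lin V' (l i) w) x w <-> S (row_rv (mZ V' mV') w)).
  move=> h; split => h' i; have := h' i; rewrite h; under eq_bigr do rewrite ?mxE//.
    by under [in X in _ -> X]eq_bigr do rewrite mxE.
  by [].
have pre' (V' : set X -> T -> R) (mV' : forall A, measurable_fun setT (V' A)) w :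
    (forall i, lin V' (l' i) w = \sum_j r' i j * V' (C' j) w) ->
    (box_event (fun i w => a' i + lin V' (l' i) w) x' w <-> S' (row_rv (mZ' V' mV') w)).
  move=> h; split => h' i; have := h' i; rewrite h; under eq_bigr do rewrite ?mxE//.
    by under [in X in _ -> X]eq_bigr do rewrite mxE.
  by [].
have mpre p (Z : {mfun T >-> 'rV[R]_p}) (E : set 'rV[R]_p) : measurable E -> measurable (Z @^-1` E).
  by move=> mE; rewrite -[X in measurable X]setTI; exact: measurable_funP.
have mbx (V' : set X -> T -> R) q (k : 'I_q -> seq (R * set X)) c y :
    (forall A, measurable_fun setT (V' A)) ->
    measurable (box_event (fun i w => c i + lin V' (k i) w) y).
  move=> mV'; apply: measurable_box_event => i; apply: measurable_funD => //.
  exact: measurable_lin.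
rewrite (ae_pr_eq _ _ (filterI (hr _ aV) (hr' _ aV)) (B := row_rv (mZ V mV) @^-1` S `&` row_rv (mZ' V mV) @^-1` S')).
- rewrite key//; congr (_ * _); apply/esym.
  + apply: (ae_pr_eq _ _ (hr _ aV2)); [exact: mbx|exact: mpre|].
    by move=> w h; exact: pre.
  + apply: (ae_pr_eq _ _ (hr' _ aV2)); [exact: mbx|exact: mpre|].
    by move=> w h; exact: pre'.
- by apply: measurableI; exact: mbx.
- by apply: measurableI; exact: mpre.
- move=> w [/(pre _ mV) h1 /(pre' _ mV) h2]; split => -[h3 h4]; split; [exact/h1|exact/h2|exact/h1|exact/h2].
Qed.

(** [Y2] is built from [V2] exactly as [Y] is from [V]: the same sets inside [B], the same
    coefficients and the same constants. The constants make room for compensators, and a common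
    approximating sequence is what transfers laws from [Y] to [Y2]. *)
Definition local_pair (B : set X) (Y Y2 : T -> R) : Prop :=
  [/\ measurable_fun setT Y, measurable_fun setT Y2 &
  exists (a : nat -> R) (l : nat -> seq (R * set X)),
    [/\ forall n, supported B (l n), cvgP P (fun n w => a n + lin V (l n) w) Y &
        cvgP P (fun n w => a n + lin V2 (l n) w) Y2]].

Lemma local_factor (B B' : set X) m m' (Y Y2 : 'I_m -> T -> R) (Y' Y2' : 'I_m' -> T -> R) :
  B `&` B' = set0 ->
  (forall i, local_pair B (Y i) (Y2 i)) -> (forall i, local_pair B' (Y' i) (Y2' i)) ->
  forall x x', pr (box_event Y x `&` box_event Y' x') =
               pr (box_event Y2 x) * pr (box_event Y2' x').
Proof.
move=> BB' YY2 YY2'.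
have mY i : measurable_fun setT (Y i) by case: (YY2 i).
have mY2 i : measurable_fun setT (Y2 i) by case: (YY2 i).
have mY' i : measurable_fun setT (Y' i) by case: (YY2' i).
have mY2' i : measurable_fun setT (Y2' i) by case: (YY2' i).
have /choice[al hal] : forall i, exists al : (nat -> R) * (nat -> seq (R * set X)),
    [/\ forall n, supported B (al.2 n), cvgP P (fun n w => al.1 n + lin V (al.2 n) w) (Y i) &
        cvgP P (fun n w => al.1 n + lin V2 (al.2 n) w) (Y2 i)].
  by move=> i; have [_ _ [a [l h]]] := YY2 i; exists (a, l).
have /choice[al' hal'] : forall i, exists al : (nat -> R) * (nat -> seq (R * set X)),
    [/\ forall n, supported B' (al.2 n), cvgP P (fun n w => al.1 n + lin V (al.2 n) w) (Y' i) &
        cvgP P (fun n w => al.1 n + lin V2 (al.2 n) w) (Y2' i)].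
  by move=> i; have [_ _ [a [l h]]] := YY2' i; exists (a, l).
have ml V' a l : (forall A, measurable_fun setT (V' A)) ->
    measurable_fun setT (fun w => a + lin V' l w).
  by move=> mV'; apply: measurable_funD => //; exact: measurable_lin.
apply: (box_factor_lim
  (Yn := fun n i w => (al i).1 n + lin V ((al i).2 n) w)
  (Zn := fun n i w => (al i).1 n + lin V2 ((al i).2 n) w)
  (Y'n := fun n i w => (al' i).1 n + lin V ((al' i).2 n) w)
  (Z'n := fun n i w => (al' i).1 n + lin V2 ((al' i).2 n) w)) => //; try by move=> *; exact: ml.
- by move=> i; have [] := hal i.
- by move=> i; have [] := hal' i.
- by move=> i; have [] := hal i.
- by move=> i; have [] := hal' i.
- move=> n x x'.
  have s1 i : supported B ((al i).2 n) by have [] := hal i.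
  have s2 i : supported B' ((al' i).2 n) by have [] := hal' i.
  exact: (lin_factor (fun i => (al i).1 n) (fun i => (al' i).1 n) BB' s1 s2 x x').
Qed.

Lemma local_same_law (B : set X) m (Y Y2 : 'I_m -> T -> R) :
  (forall i, local_pair B (Y i) (Y2 i)) ->
  forall S : set 'rV[R]_m, measurable S ->
    pr ((fun w => \row_i Y i w) @^-1` S) = pr ((fun w => \row_i Y2 i w) @^-1` S).
Proof.
move=> YY2.
have mY i : measurable_fun setT (Y i) by case: (YY2 i).
have mY2 i : measurable_fun setT (Y2 i) by case: (YY2 i).
move=> S mS; have := @row_factor_aux _ _ _ P _ _ _ mY mY2 setT 1 ler01 measurableT.
move=> /(_ _ S mS); rewrite setIT mulr1; apply => x.
(* With no coordinates over the empty region, the second factor is the sure event and the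
   factorization becomes equality of distribution functions. *)
have := @local_factor B set0 m 0 Y Y2 (fun=> cst 0) (fun=> cst 0) (setI0 _) YY2.
have e0 : box_event (fun _ : 'I_0 => cst (0 : R) : T -> R) (fun=> 0) = setT.
  by apply/seteqP; split => // w _ [].
by move=> /(_ _ x (fun=> 0)); rewrite e0 setIT prT; apply => -[].
Qed.

Lemma local_pairD B Y Y2 Z Z2 : local_pair B Y Y2 -> local_pair B Z Z2 ->
  local_pair B (fun w => Y w + Z w) (fun w => Y2 w + Z2 w).
Proof.
move=> [mY mY2 [a [l [sl hY hY2]]]] [mZ mZ2 [b [k [sk hZ hZ2]]]].
have ml V' c h : (forall A, measurable_fun setT (V' A)) ->
    measurable_fun setT (fun w => c + lin V' h w).
  by move=> mV'; apply: measurable_funD => //; exact: measurable_lin.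
split; [exact: measurable_funD|exact: measurable_funD|].
exists (fun n => a n + b n), (fun n => l n ++ k n); split.
- by move=> n p; rewrite mem_cat => /orP[/sl|/sk].
- have := cvgPD (fun n => ml V _ _ mV) (fun n => ml V _ _ mV) mY mZ hY hZ.
  by apply: cvgP_ext => //= [n|n|||n|]; try exact: ml; try exact: measurable_funD;
    try (by apply: measurable_funD; exact: ml); apply: aeW => w //; rewrite lin_cat addrACA.
- have := cvgPD (fun n => ml V2 _ _ mV2) (fun n => ml V2 _ _ mV2) mY2 mZ2 hY2 hZ2.
  by apply: cvgP_ext => //= [n|n|||n|]; try exact: ml; try exact: measurable_funD;
    try (by apply: measurable_funD; exact: ml); apply: aeW => w //; rewrite lin_cat addrACA.
Qed.

Lemma local_pair_sub B B' Y Y2 : B `<=` B' -> local_pair B Y Y2 -> local_pair B' Y Y2.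
Proof.
move=> BB' [mY mY2 [a [l [sl hY hY2]]]]; split=> //; exists a, l; split=> // n p /sl[Dp pB].
by split=> //; exact: subset_trans BB'.
Qed.

End factor.

(** * Independence of the events decided in disjoint regions *)

Section independence.
Variables V : set X -> T -> R.
Hypothesis mV : forall A, measurable_fun setT (V A).
Hypothesis aV : fin_additive V.
Hypothesis iV : fin_independent V.

Definition local_rv (B : set X) (Y : T -> R) : Prop := local_pair V V B Y Y.

Definition local_boxes (B : set X) : set (set T) :=
  [set F | exists m (Y : 'I_m -> T -> R) x, (forall i, local_rv B (Y i)) /\ F = box_event Y x].

(** The generators use limits in probability and not only values of [V], so integrals over [B] and
    all their modifications are measurable for this sigma-algebra without a separate completion. *)
Definition local_events (B : set X) : set (set T) := <<s local_boxes B >>.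

Lemma local_boxes_measurable B : local_boxes B `<=` measurable.
Proof.
by move=> _ [m [Y [x [hY ->]]]]; apply: measurable_box_event => i; case: (hY i).
Qed.

Lemma local_events_measurable B : local_events B `<=` measurable.
Proof.
apply: smallest_sub; first exact: sigma_algebra_measurable.
exact: local_boxes_measurable.
Qed.

Lemma local_events_sub B B' : B `<=` B' -> local_events B `<=` local_events B'.
Proof.
move=> BB'; apply: sub_smallest2r.
  exact: smallest_sigma_algebra.
move=> _ [m [Y [x [hY ->]]]]; exists m, Y, x; split => // i.
exact: local_pair_sub BB' (hY i).
Qed.

Lemma local_boxes_setI B : setI_closed (local_boxes B).
Proof.
move=> _ _ [m [Y [x [hY ->]]]] [m' [Y' [x' [hY' ->]]]].
exists (m + m')%N, (fun k => match fintype.split k with inl i => Y i | inr j => Y' j end),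
  (fun k => match fintype.split k with inl i => x i | inr j => x' j end); split.
  by move=> k; case: fintype.split.
rewrite -box_event_sum; apply/seteqP; split => w h k.
  by case: (fintype.split k) => i; [exact: (h (inl i))|exact: (h (inr i))].
by have := h (unsplit k); rewrite unsplitK; case: k.
Qed.

Lemma local_boxesT B : local_boxes B setT.
Proof.
exists 0%N, (fun=> cst 0), (fun=> 0); split; first by case.
by apply/seteqP; split => // w _ [].
Qed.

(** Boxes are stable under intersection, so the two finite measures [F -> P(F & E)] and
    [F -> P F P E] agree on the generated sigma-algebra. Used once for each of the two events. *)
Lemma local_events_indep_aux B (E : set T) : measurable E ->
  (forall F, local_boxes B F -> pr (F `&` E) = pr F * pr E) ->
  forall F, local_events B F -> pr (F `&` E) = pr F * pr E.
Proof.
move=> mE BE F GF.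
pose m1 := mrestr P mE : {measure set T -> \bar R}.
pose m2 := mscale (NngNum (pr_ge0 P E)) P : {measure set T -> \bar R}.
have mm A : measurable A -> m1 A = (pr (A `&` E))%:E.
  by move=> mA; rewrite -prE; last exact: measurableI.
have mm2 A : measurable A -> m2 A = (pr A * pr E)%:E.
  move=> mA; rewrite mulrC EFinM -(prE P mA); by [].
have mF := local_events_measurable GF.
apply: EFin_inj; rewrite -mm// -mm2//.
apply: (@g_sigma_algebra_measure_unique _ _ _ (local_boxes B) _ (fun=> setT)) => //.
- exact: local_boxes_measurable.
- by move=> _; exact: local_boxesT.
- by rewrite bigcup_const//; exists 0%N.
- exact: local_boxes_setI.
- by move=> A GA; have mA := local_boxes_measurable GA; rewrite mm// mm2// BE.
- by move=> _; rewrite mm// ltry.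
Qed.

Lemma local_events_indep B B' : B `&` B' = set0 -> forall F F',
  local_events B F -> local_events B' F' -> pr (F `&` F') = pr F * pr F'.
Proof.
move=> BB' F F' GF GF'; have mF' := local_events_measurable GF'.
apply: (local_events_indep_aux (B := B)) => // {GF}F BF.
have mF := local_boxes_measurable BF.
rewrite setIC mulrC; apply: (local_events_indep_aux (B := B')) => // {mF' GF'}F' BF'.
rewrite setIC mulrC; move: BF => [m [Y [x [hY ->]]]]; move: BF' => [m' [Y' [x' [hY' ->]]]].
exact: (local_factor mV mV aV aV iV iV _ BB').
Qed.

Lemma local_events_row B n (Y : 'I_n -> T -> R) : (forall i, local_rv B (Y i)) ->
  forall S : set 'rV[R]_n, measurable S ->
    local_events B ((fun w => \row_i Y i w) @^-1` S).
Proof.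
move=> hY; pose TB := g_sigma_algebraType (local_boxes B).
have mY i : @measurable_fun _ _ TB R setT (Y i).
  apply: (measurability (@RGenCInfty.G R)); first exact: RGenCInfty.measurableE.
  move=> _ [_ [x ->] <-]; rewrite setTI.
  have h y : @measurable _ TB [set w : TB | Y i w <= y].
    apply: sub_sigma_algebra; exists 1%N, (fun=> Y i), (fun=> y); split => //.
    by apply/seteqP; split => w /= h; [move=> _|exact: (h ord0)].
  rewrite -[X in measurable X]setCK; apply: measurableC.
  rewrite (_ : ~` _ = \bigcup_k [set w : TB | Y i w <= x - k.+1%:R^-1]).
    by apply: bigcupT_measurable => k; exact: h.
  apply/seteqP; split => v /=.
    move=> /negP; rewrite in_itv/= andbT -ltNge => vx.
    have [k] := ltr_add_invr vx => vk; exists k => //=.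
    by rewrite lerBrDr ltW.
  move=> [k _ vk]; apply/negP; rewrite in_itv/= andbT -ltNge.
  by apply: (le_lt_trans vk); rewrite ltrBlDr ltrDl invr_gt0.
move=> S mS; have := @measurable_row R _ TB n Y mY measurableT S mS.
by rewrite setTI.
Qed.

Lemma local_events1 B (Y : T -> R) : local_rv B Y ->
  forall S : set R, measurable S -> local_events B (Y @^-1` S).
Proof.
move=> hY S mS; have := @local_events_row B 1 (fun=> Y) (fun=> hY) [set v | S (v 0 0)].
move=> /(_ _)/=; rewrite (_ : _ @^-1` _ = Y @^-1` S); last first.
  by apply/seteqP; split => w /=; rewrite mxE.
by apply; rewrite -[X in measurable X]setTI; exact: measurable_coord.
Qed.

Lemma local_eventsI B F F' : local_events B F -> local_events B F' ->
  local_events B (F `&` F').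
Proof. exact: (@measurableI _ (g_sigma_algebraType (local_boxes B))). Qed.

(** Induction on the indices: the intersection of the events already treated is local to the union
    of their regions, which is disjoint from the next region. That locality is therefore part of the
    induction hypothesis. *)
Lemma local_events_mutual (I : choiceType) (B : I -> set X) (F : I -> set T) (J : {fset I}) :
  trivIset setT B -> (forall i, local_events (B i) (F i)) ->
  pr (\bigcap_(i in [set` J]) F i) = \prod_(i <- J) pr (F i).
Proof.
move=> /trivIsetP tB GF; rewrite bigcap_fset.
have := fset_uniq J; move: (enum_fset J) => s us.
suff [] : local_events (\bigcup_(i in [set` s]) B i) (\big[setI/setT]_(i <- s) F i) /\
  pr (\big[setI/setT]_(i <- s) F i) = \prod_(i <- s) pr (F i) by [].
elim: s us => [|i s IH] /=.
  by rewrite !big_nil prT; split => //; exact: (@measurableT _ (g_sigma_algebraType _)).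
move=> /andP[si us]; have [GS prS] := IH us; rewrite !big_cons; split.
  apply: local_eventsI.
    by apply: local_events_sub (GF i) => x Bx; exists i => //=; rewrite mem_head.
  by apply: local_events_sub GS => x [j /= js Bx]; exists j => //=; rewrite inE js orbT.
rewrite (local_events_indep _ (GF i) GS) ?prS//.
apply/seteqP; split => // x [Bi [j /= js Bj]].
have ij : i != j by apply: contra si => /eqP ->.
by have /seteqP[/(_ x) + _] := tB i j Logic.I Logic.I ij; apply.
Qed.

End independence.

End scattered.

(** * Quantization by simple functions *)

Section quantizer.
Context {R : realType}.

Let mpos : measurable_fun [set: R] (fun x : R => (Num.max x 0)%:E).
Proof. by apply/measurable_EFinP; apply: measurable_maxr => //. Qed.

Let mneg : measurable_fun [set: R] (fun x : R => (Num.max (- x) 0)%:E).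
Proof. by apply/measurable_EFinP; apply: measurable_maxr => //; apply: measurableT_comp. Qed.

Definition pquant (n : nat) : {nnsfun R >-> R} := nnsfun_approx measurableT mpos n.
Definition nquant (n : nat) : {nnsfun R >-> R} := nnsfun_approx measurableT mneg n.
(** Quantizing the line once and for all, and not each integrand, makes the approximation of
    [f \o g] equal to that of [f] composed with [g]. Positive and negative parts are approximated
    from below separately, so the quantization fixes 0 and never increases absolute values. *)
Definition quant (n : nat) : {sfun R >-> R} := pquant n \- nquant n.

Lemma pquant_nd x : nondecreasing_seq (fun n => pquant n x).
Proof. by move=> m n mn; have /lefP := nd_nnsfun_approx measurableT mpos mn; apply. Qed.

Lemma nquant_nd x : nondecreasing_seq (fun n => nquant n x).
Proof. by move=> m n mn; have /lefP := nd_nnsfun_approx measurableT mneg mn; apply. Qed.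

Lemma pquant_cvg x : pquant n x @[n --> \oo] --> Num.max x 0.
Proof.
have /fine_cvgP[_] : (EFin \o (fun n => pquant n x)) n @[n --> \oo] --> (Num.max x 0)%:E.
  by apply: cvg_nnsfun_approx => // y _; rewrite lee_fin le_max lexx orbT.
exact.
Qed.

Lemma nquant_cvg x : nquant n x @[n --> \oo] --> Num.max (- x) 0.
Proof.
have /fine_cvgP[_] : (EFin \o (fun n => nquant n x)) n @[n --> \oo] --> (Num.max (- x) 0)%:E.
  by apply: cvg_nnsfun_approx => // y _; rewrite lee_fin le_max lexx orbT.
exact.
Qed.

Lemma pquant_le n x : 0 <= pquant n x <= Num.max x 0.
Proof.
rewrite fun_ge0/=; have h := @pquant_cvg x.
by rewrite -(cvg_lim _ h)//; apply: nondecreasing_cvgn_le; [exact: pquant_nd|apply/cvg_ex; eexists; exact: h].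
Qed.

Lemma nquant_le n x : 0 <= nquant n x <= Num.max (- x) 0.
Proof.
rewrite fun_ge0/=; have h := @nquant_cvg x.
by rewrite -(cvg_lim _ h)//; apply: nondecreasing_cvgn_le; [exact: nquant_nd|apply/cvg_ex; eexists; exact: h].
Qed.

Lemma quant_cvg x : quant n x @[n --> \oo] --> x.
Proof.
have E : x = Num.max x 0 - Num.max (- x) 0.
  by case: (leP x 0) => x0; case: (leP (- x) 0) => x1; lra.
rewrite [X in _ --> X]E; exact: cvgB (@pquant_cvg x) (@nquant_cvg x).
Qed.

Lemma pquantE n x : 0 <= x -> quant n x = pquant n x.
Proof.
move=> x0; rewrite /quant/=; have := nquant_le n x.
rewrite (@max_r _ _ (- x)) ?oppr_le0// => /andP[a b].
by rewrite (_ : nquant n x = 0) ?subr0//; apply/eqP; rewrite eq_le b.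
Qed.

Lemma quant_bound n x : `|quant n x| <= `|x| /\ `|quant n x - x| <= `|x|.
Proof.
rewrite /quant/=; have := pquant_le n x; have := nquant_le n x.
by case: (leP x 0) => x0; case: (leP (- x) 0) => x1 /andP[a b] /andP[c d];
  rewrite ?(ler0_norm x0) ?(gtr0_norm x0) !ler_norml; split; apply/andP; split; lra.
Qed.

Lemma quant0 n : quant n 0 = 0.
Proof. by have [h _] := quant_bound n 0; move: h; rewrite normr0 normr_le0 => /eqP. Qed.

End quantizer.

Section quantized_functions.
Context {R : realType} {dX} {X : measurableType dX}.

Definition quantized (f : {mfun X >-> R}) (n : nat) : X -> R := quant n \o f.

Let quantized_measurable f n : measurable_fun setT (quantized f n).
Proof. exact: measurableT_comp. Qed.

Let quantized_finite f n : finite_set (range (quantized f n)).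
Proof.
apply: sub_finite_set (fimfunP (quant n : {sfun R >-> R})).
by move=> _ [x _ <-]; exists (f x).
Qed.

HB.instance Definition _ f n := isMeasurableFun.Build _ _ _ _ (quantized f n) (quantized_measurable f n).
HB.instance Definition _ f n := FiniteImage.Build _ _ (quantized f n) (quantized_finite f n).

Definition pquantized (f : {mfun X >-> R}) (n : nat) : X -> R := pquant n \o f.

Let pquantized_measurable f n : measurable_fun setT (pquantized f n).
Proof. exact: measurableT_comp. Qed.

Let pquantized_finite f n : finite_set (range (pquantized f n)).
Proof.
apply: sub_finite_set (fimfunP (pquant n : {nnsfun R >-> R})).
by move=> _ [x _ <-]; exists (f x).
Qed.

Let pquantized_ge0 f n x : 0 <= pquantized f n x.
Proof. exact: fun_ge0. Qed.

HB.instance Definition _ f n := isMeasurableFun.Build _ _ _ _ (pquantized f n) (pquantized_measurable f n).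
HB.instance Definition _ f n := FiniteImage.Build _ _ (pquantized f n) (pquantized_finite f n).
HB.instance Definition _ f n := isNonNegFun.Build _ _ (pquantized f n) (pquantized_ge0 f n).

Definition step (l : seq (R * set X)) (x : X) : R := \sum_(p <- l) p.1 * \1_(p.2) x.

Lemma step_cat l l' x : step (l ++ l') x = step l x + step l' x.
Proof. by rewrite /step big_cat. Qed.

Definition opp_list (l : seq (R * set X)) := [seq (- p.1, p.2) | p <- l].

Lemma step_opp l x : step (opp_list l) x = - step l x.
Proof. by rewrite /step big_map -sumrN; apply: eq_bigr => p _; rewrite mulNr. Qed.

Lemma lin_opp {dT} {T : measurableType dT} (V : set X -> T -> R) l w :
  lin V (opp_list l) w = - lin V l w.
Proof. by rewrite /lin big_map -sumrN; apply: eq_bigr => p _; rewrite mulNr. Qed.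

(** The level 0 is left out: it contributes nothing, and its level set usually lies outside the
    ring. *)
Definition levels_on (s : seq R) (h : X -> R) : seq (R * set X) :=
  [seq (r, h @^-1` [set r]) | r <- s & r != 0].

Lemma step_levels_on s h : uniq s -> (forall x, h x \in s) ->
  forall x, step (levels_on s h) x = h x.
Proof.
move=> us hs x; rewrite /step /levels_on big_map big_filter.
have [h0|h0] := eqVneq (h x) 0.
  rewrite h0 big1_seq// => r /andP[r0 _]; rewrite /= indicE memNset ?mulr0//= h0 => /esym/eqP.
  by rewrite (negbTE r0).
rewrite -big_filter (bigD1_seq (h x))/= ?filter_uniq// ?mem_filter ?h0 ?hs//.
rewrite indicE mem_set//= mulr1 big1_seq ?addr0// => r /andP[rh _].
by rewrite /= indicE memNset ?mulr0//= => /esym/eqP; rewrite (negbTE rh).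
Qed.

Definition levels (g : {sfun X >-> R}) := levels_on (fset_set (range g)) g.

Lemma step_levels (g : {sfun X >-> R}) x : step (levels g) x = g x.
Proof.
apply: step_levels_on; first exact: fset_uniq.
by move=> y; rewrite in_fset_set ?inE; [exists y|exact: fimfunP].
Qed.

Lemma levels_over D (g : {sfun X >-> R}) : simple_over D g ->
  forall p, p \in levels g -> D p.2.
Proof.
by move=> Dg p /mapP[r]; rewrite mem_filter => /andP[r0 _] ->; exact: Dg.
Qed.

Lemma simple_integral_lin {dT} {T : measurableType dT} {P : probability T R}
  (M : set X -> {RV P >-> R}) (g : {sfun X >-> R}) w :
  simple_integral M g w = lin (fun A => M A : T -> R) (levels g) w.
Proof.
rewrite /simple_integral fsbig_finite; last exact: fimfunP.
rewrite /lin /levels /levels_on big_map big_filter [RHS]big_mkcond/=.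
by apply: eq_bigr => r _; case: eqP => [->|//]; rewrite mul0r.
Qed.

(** The heights run over the range of the quantizer and not over that of [quant n \o f]; hence
    composing [f] with a map only replaces the sets by their preimages. Some of these sets may be
    empty. *)
Definition qlevels (f : X -> R) (n : nat) : seq (R * set X) :=
  levels_on (fset_set (range (quant n : {sfun R >-> R}))) (quant n \o f).

Lemma step_qlevels f n x : step (qlevels f n) x = quant n (f x).
Proof.
apply: step_levels_on; first exact: fset_uniq.
by move=> y; rewrite in_fset_set ?inE; [exists (f y)|exact: fimfunP].
Qed.

Lemma measurable_step l : (forall p, p \in l -> measurable p.2) -> measurable_fun setT (step l).
Proof.
rewrite /step; elim: l => [|p l IH] ml.
  by under eq_fun do rewrite big_nil; exact: measurable_cst.
under eq_fun do rewrite big_cons.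
apply: measurable_funD; last by apply: IH => q ql; apply: ml; rewrite inE ql orbT.
apply: measurable_funM => //; apply: measurable_indic; apply: ml; exact: mem_head.
Qed.

End quantized_functions.

(** * Integrals as limits in probability *)

Section modulus.
Context {R : realType}.

(* The integrals are continuous for the functional [\int phi (f)] where phi is
   one of x^2, min(x^2, |x|) and min(|x|, 1). *)
Record is_modulus (phi : R -> R) : Prop := IsModulus {
  modulus0 : phi 0 = 0 ;
  modulus_le : forall x y, `|x| <= `|y| -> phi x <= phi y ;
  modulusD : forall x y, phi (x + y) <= 4 * (phi x + phi y) ;
  measurable_modulus : measurable_fun setT phi ;
  modulus_small : forall x, `|x| <= 1 -> phi x <= `|x| ;
  modulus_gt0 : forall x, x != 0 -> 0 < phi x }.

Context {dX} {X : measurableType dX} (mu : {measure set X -> \bar R}).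
Variables (phi : R -> R) (hphi : is_modulus phi).
Implicit Types f g : X -> R.

Lemma modulus_ge0 x : 0 <= phi x.
Proof. by rewrite -(modulus0 hphi); apply: modulus_le => //; rewrite normr0. Qed.

Definition modular (f : X -> R) : \bar R := (\int[mu]_x (phi (f x))%:E)%E.

Lemma modular_ge0 f : (0 <= modular f)%E.
Proof. by apply: integral_ge0 => x _; rewrite lee_fin modulus_ge0. Qed.

Lemma measurable_modulus_comp f : measurable_fun setT f ->
  measurable_fun setT (fun x => (phi (f x))%:E).
Proof.
move=> mf; apply/measurable_EFinP; apply: measurableT_comp => //.
exact: measurable_modulus.
Qed.

Lemma modular_le f g : measurable_fun setT f -> measurable_fun setT g ->
  (forall x, `|f x| <= `|g x|) -> (modular f <= modular g)%E.
Proof.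
move=> mf mg fg; apply: ge0_le_integral => //.
- by move=> x _; rewrite lee_fin modulus_ge0.
- exact: measurable_modulus_comp.
- exact: measurable_modulus_comp.
- by move=> x _; rewrite lee_fin; exact: modulus_le.
Qed.

Lemma modularD f g : measurable_fun setT f -> measurable_fun setT g ->
  (modular (fun x => (f x + g x)%R) <= 4%:E * (modular f + modular g))%E.
Proof.
move=> mf mg; rewrite /modular -ge0_integralD//=; last first.
- exact: measurable_modulus_comp.
- by move=> x _; rewrite lee_fin modulus_ge0.
- exact: measurable_modulus_comp.
- by move=> x _; rewrite lee_fin modulus_ge0.
have mS : measurable_fun setT (fun x => (phi (f x))%:E + (phi (g x))%:E)%E.
  by apply: emeasurable_funD; exact: measurable_modulus_comp.
rewrite -ge0_integralZl//; last first.
- by move=> x _; rewrite -EFinD lee_fin addr_ge0// modulus_ge0.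
apply: ge0_le_integral => //.
- by move=> x _; rewrite lee_fin modulus_ge0.
- by apply: measurable_modulus_comp; exact: measurable_funD.
- exact: measurable_funeM.
- by move=> x _; rewrite -EFinD -EFinM lee_fin; exact: modulusD.
Qed.

Lemma modular_eq0 f : (forall x, f x = 0) -> modular f = 0%E.
Proof.
by move=> f0; apply: integral0_eq => x _; rewrite f0 modulus0.
Qed.

(** Dominated convergence with bound [phi \o f]; the estimate [phi x <= |x|] near 0 gives the
    pointwise limit. *)
Lemma modular_cvg0 (fn : nat -> X -> R) (f : X -> R) :
  (forall n, measurable_fun setT (fn n)) -> measurable_fun setT f ->
  (modular f < +oo)%E -> (forall n x, `|fn n x| <= `|f x|) ->
  (forall x, fn n x @[n --> \oo] --> (0 : R)) ->
  modular (fn n) @[n --> \oo] --> 0%E.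
Proof.
move=> mfn mf foo fnf fn0.
have intf : mu.-integrable setT (fun x => (phi (f x))%:E).
  apply/integrableP; split; first exact: measurable_modulus_comp.
  rewrite (eq_integral (fun x => (phi (f x))%:E))// => x _.
  by rewrite gee0_abs// lee_fin modulus_ge0.
have [] := @dominated_convergence _ _ _ mu setT measurableT
  (fun n x => (phi (fn n x))%:E) (fun=> 0%E) (fun x => (phi (f x))%:E).
- by move=> n; exact: measurable_modulus_comp.
- exact: measurable_cst.
- apply: aeW => x _; apply: cvg_EFin; first by near=> n.
  apply/cvgrPdist_le => e e0 /=.
  have m0 : 0 < Num.min 1 e by rewrite lt_min ltr01.
  move/cvgrPdist_le: (fn0 x) => /(_ _ m0); apply: filterS => n.
  rewrite !sub0r !normrN le_min => /andP[h1 he].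
  by rewrite ger0_norm ?modulus_ge0//; apply: le_trans he; exact: modulus_small.
- exact: intf.
- apply: aeW => x n _; rewrite gee0_abs ?lee_fin ?modulus_ge0//.
  exact: modulus_le.
- by move=> _ _; rewrite integral0.
Unshelve. all: by end_near. Qed.

Lemma modular_quant (f : X -> R) : measurable_fun setT f -> (modular f < +oo)%E ->
  modular (fun x => quant n (f x) - f x) @[n --> \oo] --> 0%E.
Proof.
move=> mf foo; apply: (modular_cvg0 _ mf foo).
- by move=> n; apply: measurable_funB => //; exact: measurableT_comp.
- by move=> n x; have [] := quant_bound n (f x).
- move=> x; rewrite -[X in _ --> X](subrr (f x)).
  by apply: cvgB; [exact: quant_cvg|exact: cvg_cst].
Qed.

(** Markov's inequality for [phi]. It puts the level sets of nonzero height among the sets of finite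
    intensity, where the random measures are defined. *)
Lemma modular_level (f : X -> R) (A : set X) (r : R) : measurable_fun setT f ->
  (modular f < +oo)%E -> measurable A -> r != 0 -> (forall x, A x -> `|r| <= `|f x|) ->
  (mu A < +oo)%E.
Proof.
move=> mf foo mA r0 Ar; have pr0 := modulus_gt0 hphi r0.
have : ((phi r)%:E * mu A <= modular f)%E.
  rewrite -integral_cst// integral_mkcond; apply: ge0_le_integral => //.
  - by move=> x _; rewrite patchE; case: ifP => // _; rewrite lee_fin ltW.
  - exact/(measurable_restrictT _ mA).
  - exact: measurable_modulus_comp.
  - move=> x _; rewrite patchE; case: ifPn => [|_]; last by rewrite lee_fin modulus_ge0.
    by rewrite inE => Ax; rewrite lee_fin; apply: modulus_le => //; exact: Ar.
move=> /le_lt_trans/(_ foo); case: (mu A) => [r' _| |_].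
- by rewrite ltry.
- by rewrite gt0_muley ?lte_fin.
- by [].
Qed.

End modulus.

Section prob_integral.
Context {R : realType} {dT} {T : measurableType dT} (P : probability T R).
Local Notation pr := (pr P).
Context {dX} {X : measurableType dX} (mu : {measure set X -> \bar R}).
Variables (phi : R -> R) (hphi : is_modulus phi).
Variables (D : set (set X)) (M : set X -> T -> R).
Hypothesis Dm : D `<=` measurable.
Hypothesis mM : forall A, measurable_fun setT (M A).
Local Notation modular := (modular mu phi).
Implicit Types (f g : X -> R) (Y Z : T -> R) (l : seq (R * set X)).

(** The only quantitative input from the law of [M]. The constant may depend on the threshold [e]
    but not on the list, so the estimate yields continuity in probability and survives the passage
    to integrals. *)
Definition dominated_by : Prop :=
  forall e, 0 < e -> exists2 K : R, 0 <= K & forall l, (forall p, p \in l -> D p.2) ->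
    ((pr [set w | e <= `|lin M l w|])%:E <= K%:E * modular (step l))%E.

Hypothesis hM : dominated_by.

Definition in_D (l : seq (R * set X)) := forall p, p \in l -> D p.2.

Lemma in_D_cat l l' : in_D l -> in_D l' -> in_D (l ++ l').
Proof. by move=> h h' p; rewrite mem_cat => /orP[pl|pl]; [exact: h|exact: h']. Qed.

Lemma in_D_opp l : in_D l -> in_D (opp_list l).
Proof. by move=> h p /mapP[q ql ->]; exact: (h q ql). Qed.

Lemma measurable_step_in_D l : in_D l -> measurable_fun setT (step l).
Proof. by move=> h; apply: measurable_step => p pl; apply: Dm; exact: h. Qed.

Lemma lin_cvg0 (h : nat -> seq (R * set X)) : (forall n, in_D (h n)) ->
  modular (step (h n)) @[n --> \oo] --> 0%E -> cvgP P (fun n => lin M (h n)) (cst 0).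
Proof.
move=> Dh h0 e e0; have [K K0 hK] := hM e0.
have d0 : 0 < e / (K + 1) by rewrite divr_gt0// ltr_wpDl.
have : \forall n \near \oo, (modular (step (h n)) <= (e / (K + 1))%:E)%E.
  move/fine_cvgP : h0 => [hfin /cvgrPdist_le/(_ _ d0)].
  apply: filterS2 hfin => n /= fn; rewrite sub0r normrN => hn.
  by rewrite -(fineK fn) lee_fin; apply: le_trans hn; exact: ler_norm.
apply: filterS => n hn; rewrite (_ : [set w | _] = [set w | e <= `|lin M (h n) w|]); last first.
  by apply/seteqP; split => w /=; rewrite subr0.
rewrite -lee_fin; apply: (le_trans (hK _ (Dh n))).
apply: (@le_trans _ _ (K%:E * (e / (K + 1))%:E)%E); first by apply: lee_wpmul2l.
by rewrite -EFinM lee_fin mulrCA ger_pMr// ler_pdivrMr ?ltr_wpDl// mul1r lerDl.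
Qed.

(** The list representing the difference of the two approximations has modular tending to 0, so its
    random combination vanishes in probability: the limit depends on [f] only. *)
Lemma lin_cmp (h k : nat -> seq (R * set X)) (f : X -> R) Y :
  measurable_fun setT f -> measurable_fun setT Y ->
  (forall n, in_D (h n)) -> (forall n, in_D (k n)) ->
  modular (fun x => step (h n) x - f x) @[n --> \oo] --> 0%E ->
  modular (fun x => step (k n) x - f x) @[n --> \oo] --> 0%E ->
  cvgP P (fun n => lin M (h n)) Y -> cvgP P (fun n => lin M (k n)) Y.
Proof.
move=> mf mY Dh Dk h0 k0 hY.
pose g n := k n ++ opp_list (h n).
have Dg n : in_D (g n) by apply: in_D_cat => //; exact: in_D_opp.
have mh n := measurable_step_in_D (Dh n); have mk n := measurable_step_in_D (Dk n).
have g0 : modular (step (g n)) @[n --> \oo] --> 0%E.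
  have le n : (modular (step (g n)) <= 4%:E * (modular (fun x => (step (k n) x - f x)%R) + modular (fun x => (step (h n) x - f x)%R)))%E.
    have := @modularD _ _ _ mu _ hphi (fun x => step (k n) x - f x) (fun x => f x - step (h n) x).
    rewrite (_ : modular (fun x => f x - step (h n) x) = modular (fun x => step (h n) x - f x)); last first.
      apply: eq_integral => x _; congr EFin; apply/le_anti/andP; split.
        by apply: (modulus_le hphi); rewrite distrC.
      by apply: (modulus_le hphi); rewrite distrC.
    rewrite (_ : modular (fun x => _ + _) = modular (step (g n))); last first.
      apply: eq_integral => x _; congr (phi _)%:E; rewrite step_cat step_opp; ring.
    by apply; exact: measurable_funB.
  have lim0 : (4%:E * (modular (fun x => (step (k n) x - f x)%R) + modular (fun x => (step (h n) x - f x)%R)))%E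
      @[n --> \oo] --> 0%E.
    rewrite -(mule0 4%:E) -[X in (_ * X)%E](adde0 0%E).
    by apply: cvgeZl => //; apply: cvgeD.
  apply: (@squeeze_cvge _ _ _ _ (fun=> 0%E) _ _ _ _ _ lim0) => //; last exact: cvg_cst.
  by near=> n; rewrite modular_ge0//=; exact: le.
have := cvgPD (fun n => measurable_lin (h n) mM) (fun n => measurable_lin (g n) mM) mY
  (@measurable_cst _ _ _ _ setT (0 : R)) hY (lin_cvg0 Dg g0).
apply: cvgP_ext => //.
- by move=> n; apply: measurable_funD; exact: measurable_lin.
- by move=> n; exact: measurable_lin.
- by apply: measurable_funD.
- by move=> n; apply: aeW => w; rewrite lin_cat lin_opp; ring.
- by apply: aeW => w; rewrite addr0.
Unshelve. all: by end_near. Qed.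

Record prob_integrable (f : X -> R) : Prop := ProbIntegrable {
  pi_measurable : measurable_fun setT f ;
  pi_modular : (modular f < +oo)%E ;
  pi_levels : forall n, in_D (qlevels f n) }.
Arguments pi_levels {f} _ n.

(** A fixed approximating sequence makes uniqueness immediate; [prob_integral_approx] admits any
    other sequence converging in modular. *)
Definition prob_integral (f : X -> R) (Y : T -> R) : Prop :=
  measurable_fun setT Y /\ cvgP P (fun n => lin M (qlevels f n)) Y.

Lemma qlevels_cvg f : prob_integrable f ->
  modular (fun x => step (qlevels f n) x - f x) @[n --> \oo] --> 0%E.
Proof.
move=> [mf foo _]; under eq_fun do under eq_fun do rewrite step_qlevels.
exact: modular_quant.
Qed.

Lemma prob_integral_approx f (h : nat -> seq (R * set X)) Y : prob_integrable f ->
  (forall n, in_D (h n)) -> modular (fun x => step (h n) x - f x) @[n --> \oo] --> 0%E ->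
  measurable_fun setT Y -> cvgP P (fun n => lin M (h n)) Y -> prob_integral f Y.
Proof.
move=> If Dh h0 mY hY; split => //.
by apply: (lin_cmp (pi_measurable If) mY Dh (pi_levels If) h0 (qlevels_cvg If) hY).
Qed.

Lemma prob_integral_unique f Y Z : prob_integral f Y -> prob_integral f Z ->
  {ae P, forall w, Y w = Z w}.
Proof.
move=> [mY hY] [mZ hZ]; apply: cvgP_unique hY hZ => // n.
exact: measurable_lin.
Qed.

Lemma prob_integral_ae f Y Z : measurable_fun setT Z -> {ae P, forall w, Y w = Z w} ->
  prob_integral f Y -> prob_integral f Z.
Proof.
move=> mZ YZ [mY hY]; split => //; apply: cvgP_ext hY => //; try by move=> n; exact: measurable_lin.
by move=> n; apply: aeW.
Qed.

Lemma prob_integralD f g h Y Z : prob_integrable f -> prob_integrable g -> prob_integrable h ->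
  (forall x, h x = f x + g x) ->
  prob_integral f Y -> prob_integral g Z -> prob_integral h (fun w => Y w + Z w).
Proof.
move=> If Ig Ih hE [mY hY] [mZ hZ].
apply: (prob_integral_approx (h := fun n => qlevels f n ++ qlevels g n)) => //.
- by move=> n; apply: in_D_cat; [exact: pi_levels|exact: pi_levels].
- have le n : (modular (fun x => (step (qlevels f n ++ qlevels g n) x - h x)%R) <=
      4%:E * (modular (fun x => (step (qlevels f n) x - f x)%R) + modular (fun x => (step (qlevels g n) x - g x)%R)))%E.
    have := @modularD _ _ _ mu _ hphi (fun x => step (qlevels f n) x - f x) (fun x => step (qlevels g n) x - g x).
    rewrite (_ : modular (fun x => _ + _) = modular (fun x => step (qlevels f n ++ qlevels g n) x - h x)); last first.
      apply: eq_integral => x _; congr (phi _)%:E; rewrite step_cat hE; ring.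
    apply; apply: measurable_funB; rewrite ?(pi_measurable If) ?(pi_measurable Ig)//.
      by apply: measurable_step_in_D; exact: (pi_levels If).
      exact: (pi_measurable If).
      by apply: measurable_step_in_D; exact: (pi_levels Ig).
      exact: (pi_measurable Ig).
  have lim0 : (4%:E * (modular (fun x => (step (qlevels f n) x - f x)%R) + modular (fun x => (step (qlevels g n) x - g x)%R)))%E
      @[n --> \oo] --> 0%E.
    rewrite -(mule0 4%:E) -[X in (_ * X)%E](adde0 0%E).
    by apply: cvgeZl => //; apply: cvgeD => //; exact: qlevels_cvg.
  apply: (@squeeze_cvge _ _ _ _ (fun=> 0%E) _ _ _ _ _ lim0) => //; last exact: cvg_cst.
  by near=> n; rewrite modular_ge0//=; exact: le.
- exact: measurable_funD.
- have := cvgPD (fun n => measurable_lin (qlevels f n) mM) (fun n => measurable_lin (qlevels g n) mM) mY mZ hY hZ.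
  apply: cvgP_ext => //; try (by apply: measurable_funD); try by move=> n; exact: measurable_lin.
  + by move=> n; apply: measurable_funD; exact: measurable_lin.
  + by move=> n; apply: aeW => w; rewrite lin_cat.
  + by apply: aeW.
Unshelve. all: by end_near. Qed.

(** The estimate for lists is used at threshold [e / 2], the other half being spent on the
    approximation error, whose probability is at most an arbitrary [d]. The modular of a
    quantization is at most that of [f]. *)
Lemma prob_integral_bound e : 0 < e -> exists2 K : R, 0 <= K &
  forall f Y, prob_integrable f -> prob_integral f Y ->
    ((pr [set w | e <= `|Y w|])%:E <= K%:E * modular f)%E.
Proof.
move=> e0; have e2 : 0 < e / 2 by rewrite divr_gt0.
have [K K0 hK] := hM e2; exists K => // f Y If [mY hY].
apply/lee_addgt0Pr => d d0.
pose m := Num.min (e / 2) d; have m0 : 0 < m by rewrite lt_min e2.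
have [n _ /(_ n (leqnn n)) /= hn] := hY _ m0.
have mlin := measurable_lin (qlevels f n) mM.
apply: (@le_trans _ _ (pr [set w | e / 2 <= `|lin M (qlevels f n) w|] +
   pr [set w | m <= `|lin M (qlevels f n) w - Y w|])%:E).
  rewrite lee_fin; apply: pr_leU.
  - exact: measurable_abs_ge.
  - exact: measurable_abs_ge.
  - exact: measurable_dist.
  - move=> w /= eY; have [|h] := leP (e / 2) `|lin M (qlevels f n) w|; first by left.
    right; apply: (@le_trans _ _ (e / 2)); first by rewrite ge_min lexx.
    rewrite distrC; have := ler_dist_dist (Y w) (lin M (qlevels f n) w).
    by move: h eY => h eY; apply: le_trans; rewrite ger0_norm; lra.
rewrite EFinD; apply: leeD.
  apply: (le_trans (hK _ (pi_levels If n))); apply: lee_wpmul2l => //.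
  apply: modular_le => //.
  - by apply: measurable_step_in_D; exact: (pi_levels If).
  - exact: (pi_measurable If).
  - by move=> x; rewrite step_qlevels; have [] := quant_bound n (f x).
by rewrite lee_fin; apply: (le_trans hn); rewrite /m ge_min lexx orbT.
Qed.

(** Otherwise there are pairs of indices beyond every [N] with a large difference; along these pairs
    the differences form a sequence of lists with modular tending to 0, contrary to [lin_cvg0]. *)
Lemma qlevels_cauchy f : prob_integrable f -> forall e, 0 < e -> exists N, forall m n,
  (N <= m)%N -> (N <= n)%N ->
  pr [set w | e <= `|lin M (qlevels f m) w - lin M (qlevels f n) w|] <= e.
Proof.
move=> If e e0; apply: contrapT => nh.
have /choice[s hs] : forall N, exists mn : nat * nat, [/\ (N <= mn.1)%N, (N <= mn.2)%N &
    e < pr [set w | e <= `|lin M (qlevels f mn.1) w - lin M (qlevels f mn.2) w|]].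
  move=> N; apply: contrapT => h; apply: nh; exists N => m n Nm Nn.
  by rewrite leNgt; apply/negP => h'; apply: h; exists (m, n).
pose g n := qlevels f (s n).1 ++ opp_list (qlevels f (s n).2).
have Dg n : in_D (g n) by apply: in_D_cat; [|apply: in_D_opp]; exact: pi_levels.
have sub (t : nat -> nat) : (forall n, (n <= t n)%N) ->
    modular (fun x => step (qlevels f (t n)) x - f x) @[n --> \oo] --> 0%E.
  move=> ht; apply: (cvg_comp t (fun n => modular (fun x => step (qlevels f n) x - f x)) _ (qlevels_cvg If)).
  move=> A [N _ NA]; exists N => // n /= Nn; apply: NA; exact: leq_trans Nn (ht n).
have h1 := sub (fun n => (s n).1) (fun n => let: And3 h _ _ := hs n in h).
have h2 := sub (fun n => (s n).2) (fun n => let: And3 _ h _ := hs n in h).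
have mq n := measurable_step_in_D (pi_levels If n).
have g0 : modular (step (g n)) @[n --> \oo] --> 0%E.
  have le n : (modular (step (g n)) <= 4%:E * (modular (fun x => (step (qlevels f (s n).1) x - f x)%R) + modular (fun x => (step (qlevels f (s n).2) x - f x)%R)))%E.
    have := @modularD _ _ _ mu _ hphi (fun x => step (qlevels f (s n).1) x - f x) (fun x => f x - step (qlevels f (s n).2) x).
    rewrite (_ : modular (fun x => f x - _ x) = modular (fun x => step (qlevels f (s n).2) x - f x)); last first.
      apply: eq_integral => x _; congr EFin; apply/le_anti/andP; split.
        by apply: (modulus_le hphi); rewrite distrC.
      by apply: (modulus_le hphi); rewrite distrC.
    rewrite (_ : modular (fun x => _ + _) = modular (step (g n))); last first.
      apply: eq_integral => x _; congr (phi _)%:E; rewrite step_cat step_opp; ring.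
    by apply; apply: measurable_funB => //; exact: (pi_measurable If).
  have lim0 : (4%:E * (modular (fun x => (step (qlevels f (s n).1) x - f x)%R) + modular (fun x => (step (qlevels f (s n).2) x - f x)%R)))%E
      @[n --> \oo] --> 0%E.
    rewrite -(mule0 4%:E) -[X in (_ * X)%E](adde0 0%E).
    by apply: cvgeZl => //; apply: cvgeD.
  apply: (@squeeze_cvge _ _ _ _ (fun=> 0%E) _ _ _ _ _ lim0) => //; last exact: cvg_cst.
  by near=> n; rewrite modular_ge0//=; exact: le.
have [n _ /(_ n (leqnn n))] := lin_cvg0 Dg g0 e0.
have [_ _] := hs n; rewrite ltNge => /negP + h; apply.
apply: le_trans h; rewrite le_eqVlt; apply/orP; left; apply/eqP; congr pr.
by apply/seteqP; split => w /=; rewrite subr0 lin_cat lin_opp.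
Unshelve. all: by end_near. Qed.

(** The almost sure limit along a fast subsequence. The subsequence is exported with its
    monotonicity, because Poisson integrals ask for almost sure convergence along increasing simple
    functions, and because Fatou's lemma needs it for the mean square limits. *)
Lemma prob_integral_exists f : prob_integrable f -> exists Y (s : nat -> nat),
  [/\ prob_integral f Y, forall n, (n <= s n)%N, {homo s : m n / (m <= n)%N} &
      {ae P, forall w, lin M (qlevels f (s n)) w @[n --> \oo] --> Y w}].
Proof.
move=> If; have half0 n : 0 < (2^-1 : R) ^+ n by rewrite exprn_gt0// invr_gt0.
have /choice[N hN] : forall k, exists N, forall m n, (N <= m)%N -> (N <= n)%N ->
    pr [set w | 2^-1 ^+ k <= `|lin M (qlevels f m) w - lin M (qlevels f n) w|] <= 2^-1 ^+ k.
  by move=> k; exact: qlevels_cauchy.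
(* The running maximum makes [s] nondecreasing and at least [N k]; the summand [k] makes it tend to
   infinity. *)
pose s k := (k + \max_(j < k.+1) N j)%N.
have sge k : (k <= s k)%N by exact: leq_addr.
have sN k : (N k <= s k)%N.
  by apply: leq_trans (leq_addl _ _); exact: (leq_bigmax (Ordinal (ltnSn k))).
have smono : {homo s : m n / (m <= n)%N}.
  move=> m n mn; apply: leq_add => //; apply/bigmax_leqP => j _.
  have jn : (j < n.+1)%N by exact: leq_trans (ltn_ord j) _.
  exact: (leq_bigmax (F := fun j : 'I_n.+1 => N j) (Ordinal jn)).
have ml n : measurable_fun setT (lin M (qlevels f n)) by exact: measurable_lin.
have [Y mY hY] := @ae_cauchy_cvg R _ T P (fun n => lin M (qlevels f (s n))) (fun n => ml _)
  (fun n => hN n _ _ (leq_trans (sN n) (smono _ _ (leqnSn n))) (sN n)).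
exists Y, s; split => //.
apply: (prob_integral_approx (h := fun n => qlevels f (s n))) => //.
- by move=> n; exact: pi_levels.
- apply: (cvg_comp s (fun n => modular (fun x => step (qlevels f n) x - f x)) _ (qlevels_cvg If)).
  by move=> A [K _ KA]; exists K => // n /= Kn; apply: KA; exact: leq_trans Kn (sge n).
- exact: ae_cvgP.
Qed.

End prob_integral.

(** * Moments of Gaussian and Poisson laws *)

Section density.
Context {R : realType} {d} {T : measurableType d}.
Variables (mu nu : {measure set T -> \bar R}) (p : T -> R).
Hypothesis p0 : forall x, 0 <= p x.
Hypothesis mp : measurable_fun setT p.
Hypothesis nuE : forall A, measurable A -> nu A = (\int[mu]_(x in A) (p x)%:E)%E.
Local Open Scope ereal_scope.

Lemma ge0_integral_density (f : T -> \bar R) : measurable_fun setT f -> (forall x, 0 <= f x) ->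
  \int[nu]_x f x = \int[mu]_x (f x * (p x)%:E).
Proof.
move=> mf f0; pose h := nnsfun_approx measurableT mf.
have mpE : measurable_fun setT (fun x => (p x)%:E) by exact/measurable_EFinP.
have fE x : f x = limn (fun n => (h n x)%:E).
  by apply/esym/cvg_lim => //; apply: cvg_nnsfun_approx.
have -> : \int[nu]_x f x = limn (fun n => \int[nu]_x (h n x)%:E).
  under eq_integral do rewrite fE.
  apply: monotone_convergence => //.
  - by move=> n; apply/measurable_EFinP.
  - by move=> n x _; rewrite lee_fin.
  - by move=> x _ a b ab; rewrite lee_fin; exact/lefP/nd_nnsfun_approx.
have -> : \int[mu]_x (f x * (p x)%:E) = limn (fun n => \int[mu]_x ((h n x)%:E * (p x)%:E)).
  have fpE x : f x * (p x)%:E = limn (fun n => (h n x)%:E * (p x)%:E).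
    by apply/esym/cvg_lim => //; apply: cvgeZr => //; apply: cvg_nnsfun_approx.
  under eq_integral do rewrite fpE.
  apply: monotone_convergence => //.
  - by move=> n; apply: emeasurable_funM => //; apply/measurable_EFinP.
  - by move=> n x _; rewrite -EFinM lee_fin mulr_ge0.
  - move=> x _ a b ab; apply: lee_wpmul2r; first by rewrite lee_fin.
    by rewrite lee_fin; exact/lefP/nd_nnsfun_approx.
congr (limn _); apply/funext => n.
have mh r : measurable (h n @^-1` [set r]) by exact: measurable_sfunP.
have hE x : h n x = (\sum_(r <- fset_set (range (h n))) r * \1_(h n @^-1` [set r]) x)%R.
  by rewrite [LHS]fimfunE fsbig_finite//; exact: fimfunP.
have ind0 r x : (0 <= r * \1_(h n @^-1` [set r]) x)%R.
  by rewrite -lee_fin; exact: nnfun_muleindic_ge0.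
have mind r : measurable_fun setT (fun x => (r * \1_(h n @^-1` [set r]) x)%R).
  by apply: measurable_funM => //; exact: measurable_indic.
transitivity (\sum_(r <- fset_set (range (h n))) (r%:E * nu (h n @^-1` [set r]))).
  under eq_integral do rewrite hE -sumEFin.
  rewrite ge0_integral_sum//; last 2 first.
  - by move=> r; exact/measurable_EFinP.
  - by move=> r x _; rewrite lee_fin.
  rewrite big_seq [RHS]big_seq; apply: eq_bigr => r.
  rewrite in_fset_set; last exact: fimfunP.
  rewrite inE => -[y _ hy]; have r0 : (0 <= r)%R by rewrite -hy.
  under eq_integral do rewrite EFinM.
  rewrite ge0_integralZl//; first by rewrite integral_indic// setIT.
  exact/measurable_EFinP/measurable_indic.
under [RHS]eq_integral do rewrite hE -EFinM mulr_suml -sumEFin.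
rewrite ge0_integral_sum//; last 2 first.
- by move=> r; apply/measurable_EFinP; exact: measurable_funM.
- by move=> r x _; rewrite lee_fin mulr_ge0.
rewrite big_seq [RHS]big_seq; apply: eq_bigr => r.
rewrite in_fset_set; last exact: fimfunP.
rewrite inE => -[y _ hy]; have r0 : (0 <= r)%R by rewrite -hy.
rewrite nuE// integral_mkcond -ge0_integralZl//.
- apply: eq_integral => x _; rewrite patchE/= -mulrA EFinM; congr (_ * _).
  by rewrite indicE; case: ifPn => _; rewrite ?mul1r ?mul0r.
- exact/(measurable_restrictT _ (mh r))/measurable_funTS.
- by move=> x _; rewrite patchE; case: ifP => // _; rewrite lee_fin.
Qed.

End density.

Section gaussian_moment.
Context {R : realType}.
Local Notation leb := (@lebesgue_measure R).

(** The second moment of the standard normal law. Its value 1 is not computed: finiteness, the sign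
    and scaling suffice for a bound up to a constant. *)
Definition gauss_moment2 : R := fine (\int[leb]_x ((x ^+ 2) * normal_pdf 0 1 x)%:E)%E.

Let measurable_sq_pdf (s : R) : measurable_fun setT (fun x : R => x ^+ 2 * normal_pdf 0 s x).
Proof. by apply: measurable_funM; [exact: measurable_funX|exact: measurable_normal_pdf]. Qed.

Lemma gauss_moment2E :
  (\int[leb]_x ((x ^+ 2) * normal_pdf 0 1 x)%:E)%E = gauss_moment2%:E.
Proof.
rewrite fineK// ge0_fin_numE; last first.
  by apply: integral_ge0 => x _; rewrite lee_fin mulr_ge0 ?sqr_ge0 ?normal_pdf_ge0.
(* With variance 2 the exponent is [- x^2 / 4], half of the standard one. Since
   [x^2 / 4 <= expR (x^2 / 4)], the factor [x^2] is absorbed by the other half at the cost of a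
   factor 4; the quotient of the peaks in [k] adjusts the normalizations. *)
pose s : R := Num.sqrt 2; have s0 : s != 0 by rewrite gt_eqF// sqrtr_gt0.
have ss : s ^+ 2 = 2 by rewrite sqr_sqrtr.
pose k : R := 4 * (normal_peak 1 / normal_peak s).
have k0 : 0 <= k by rewrite mulr_ge0// divr_ge0// normal_peak_ge0.
apply: (@le_lt_trans _ _ (\int[leb]_x (k%:E * (normal_pdf 0 s x)%:E))%E).
  apply: ge0_le_integral => //.
  - by move=> x _; rewrite lee_fin mulr_ge0 ?sqr_ge0 ?normal_pdf_ge0.
  - by apply/measurable_EFinP; exact: measurable_sq_pdf.
  - apply: measurable_funeM; apply/measurable_EFinP; exact: measurable_normal_pdf.
  - move=> x _; rewrite -EFinM lee_fin !normal_pdfE ?oner_eq0// /k.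
    have b0 : normal_peak s != 0 by rewrite gt_eqF ?normal_peak_gt0.
    rewrite mulrCA (_ : 4 * _ * _ = normal_peak 1 * (4 * normal_fun 0 s x)); last by field.
    rewrite ler_wpM2l ?normal_peak_ge0//.
    rewrite /normal_fun subr0 ss expr1n.
    have -> : expR (- x ^+ 2 / (1 *+ 2)) = expR (- x ^+ 2 / (2 *+ 2)) * expR (- x ^+ 2 / (2 *+ 2)).
      by rewrite -expRD; congr expR; field.
    rewrite mulrA ler_wpM2r ?expR_ge0//.
    have /(ler_wpM2r (expR_ge0 (- x ^+ 2 / (2 *+ 2)))) := expR_ge1Dx (x ^+ 2 / 4).
    rewrite -expRD (_ : _ + _ / (2 *+ 2) = 0); last by field.
    rewrite expR0; have := expR_ge0 (- x ^+ 2 / (2 *+ 2)).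
    set y := expR _; nra.
rewrite ge0_integralZl//; last 2 first.
- by apply/measurable_EFinP; exact: measurable_normal_pdf.
- by move=> x _; rewrite lee_fin normal_pdf_ge0.
by rewrite integral_normal_pdf mule1 ltry.
Qed.

(** The substitution [x -> s * x] reduces the deviation to 1. *)
Lemma normal_moment2 (s : R) : 0 < s ->
  (\int[leb]_x ((x ^+ 2) * normal_pdf 0 s x)%:E)%E = (gauss_moment2 * s ^+ 2)%:E.
Proof.
move=> s0; have sn0 : s != 0 by rewrite gt_eqF.
pose F (x : R) : R := s * x.
have F'E : F^`()%classic = cst s.
  apply/funext => x; rewrite /F derive1E deriveM// derive_cst derive_id.
  by rewrite scaler0 addr0; exact: mulr1.
rewrite (@increasing_ge0_integration_by_substitutionT _ F (fun x => x ^+ 2 * normal_pdf 0 s x)).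
- rewrite F'E [RHS]EFinM -gauss_moment2E muleC -ge0_integralZl//.
  + apply: eq_integral => x _; rewrite -EFinM; congr EFin.
    change ((s * x) ^+ 2 * normal_pdf 0 s (s * x) * s = s ^+ 2 * (x ^+ 2 * normal_pdf 0 1 x)).
    rewrite !normal_pdfE ?oner_eq0// /normal_peak /normal_fun !subr0 expr1n mul1r.
    have -> : - (s * x) ^+ 2 / (s ^+ 2 *+ 2) = - x ^+ 2 / (1 *+ 2) by field.
    have -> : Num.sqrt (s ^+ 2 * pi *+ 2) = s * Num.sqrt (pi *+ 2).
      by rewrite -mulrnAr sqrtrM ?sqr_ge0// sqrtr_sqr gtr0_norm.
    have p0 : Num.sqrt (pi *+ 2 : R) != 0.
      by rewrite gt_eqF// sqrtr_gt0 mulrn_wgt0// pi_gt0.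
    by rewrite exprMn; field; apply/andP; split.
  + by apply/measurable_EFinP; exact: measurable_sq_pdf.
  + by move=> x _; rewrite lee_fin mulr_ge0 ?sqr_ge0 ?normal_pdf_ge0.
  + by rewrite lee_fin sqr_ge0.
- by move=> x y xy; rewrite /F ltr_pM2l.
- by rewrite F'E => x; exact: cvg_cst.
- by rewrite F'E; exact: is_cvg_cst.
- by rewrite F'E; exact: is_cvg_cst.
- by move=> x; apply: derivableM.
- rewrite /F; under eq_fun do rewrite mulrC; exact/gt0_cvgMlNy.
- rewrite /F; under eq_fun do rewrite mulrC; exact/gt0_cvgMly.
- move=> x; apply: cvgM; first exact: sqr_continuous.
  exact: continuous_normal_pdf.
- by move=> x; rewrite mulr_ge0 ?sqr_ge0 ?normal_pdf_ge0.
Qed.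

Context {dT} {T : measurableType dT} (P : probability T R).

Lemma integral_same_law {dE} {E : measurableType dE} (X : T -> E)
    (m : {measure set E -> \bar R}) (g : E -> \bar R) :
  measurable_fun setT X -> (forall S, measurable S -> P (X @^-1` S) = m S) ->
  measurable_fun setT g -> (forall x, 0 <= g x)%E ->
  (\int[P]_w g (X w) = \int[m]_x g x)%E.
Proof.
move=> mX Xm mg g0.
have := @ge0_integral_pushforward _ _ _ _ _ X mX P setT g measurableT mg.
rewrite preimage_setT => <-; last by move=> y _.
by apply: eq_measure_integral => S mS _; exact: Xm.
Qed.

Lemma gaussian_second_moment (X : T -> R) v : measurable_fun setT X ->
  centred_gaussian P v X -> (\int[P]_w ((X w) ^+ 2)%:E = (gauss_moment2 * v)%:E)%E.
Proof.
move=> mX [v0 hX].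
have msq : measurable_fun [set: R] (fun x : R => (x ^+ 2)%:E).
  by apply/measurable_EFinP; exact: measurable_funX.
have [v_eq0|vn0] := eqVneq v 0.
  rewrite (@integral_same_law _ R X (@dirac _ R 0 R) (fun x : R => (x ^+ 2)%:E)) //.
  - by rewrite integral_dirac// diracT mul1e v_eq0 mulr0 expr0n.
  - by move=> S mS; rewrite hX// v_eq0 eqxx.
  - by move=> x; rewrite lee_fin sqr_ge0.
have s0 : 0 < Num.sqrt v by rewrite sqrtr_gt0 lt_neqAle eq_sym vn0.
rewrite (@integral_same_law _ (measurableTypeR R) X (normal_prob 0 (Num.sqrt v)) (fun x : R => (x ^+ 2)%:E)) //.
- rewrite (@ge0_integral_density _ _ _ leb _ (normal_pdf 0 (Num.sqrt v))) //.
  + under eq_integral do rewrite -EFinM.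
    by rewrite normal_moment2// sqr_sqrtr.
  + by move=> x; exact: normal_pdf_ge0.
  + exact: measurable_normal_pdf.
  + by move=> x; rewrite lee_fin sqr_ge0.
- by move=> S mS; rewrite hX// (negbTE vn0).
- by move=> x; rewrite lee_fin sqr_ge0.
Qed.

End gaussian_moment.

(** * Moments of Poisson laws *)

Section poisson_moments.
Context {R : realType}.
Local Open Scope ereal_scope.

Lemma ge0_integral_nat (m : {measure set nat -> \bar R}) (f : nat -> \bar R) :
  (forall k, 0 <= f k) -> \int[m]_k f k = \sum_(0 <= k <oo) f k * m [set k].
Proof.
move=> f0; have E : [set: nat] = \bigcup_k [set k].
  by apply/seteqP; split => // k _; exists k.
rewrite E ge0_integral_bigcup//.
- apply: eq_eseriesr => k _; rewrite (eq_integral (cst (f k))) ?integral_cst//.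
  by move=> j; rewrite inE => ->.
- by apply/trivIsetP => i j _ _ ij; apply/seteqP; split => // k [-> /= ji]; move/eqP: ij.
Qed.

Lemma poisson_prob_set1 (rate : R) n k : (0 < rate)%R ->
  poisson_prob rate n [set k] = (poisson_pmf rate k)%:E.
Proof. by move=> r0; rewrite /poisson_prob r0 esum_set1// lee_fin poisson_pmf_ge0. Qed.

Lemma sum_poisson_pmf (rate : R) : (0 < rate)%R ->
  \sum_(0 <= k <oo) (poisson_pmf rate k)%:E = 1.
Proof.
move=> r0; have := ge0_integral_nat (poisson_prob rate 0) (fun=> lee01).
rewrite integral_cst// mul1e [X in X = _](_ : _ = 1); last exact: probability_setT.
move=> ->.
by apply: eq_eseriesr => k _; rewrite mul1e -(@poisson_prob_set1 _ 0%N).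
Qed.

Lemma poisson_pmfS (rate : R) k : (0 < rate)%R ->
  (k.+1%:R * poisson_pmf rate k.+1 = rate * poisson_pmf rate k)%R.
Proof.
move=> r0; rewrite /poisson_pmf r0 factS natrM invfM exprS.
have k0 : (k.+1%:R : R) != 0%R by rewrite pnatr_eq0.
have f0 : (k`!%:R : R) != 0%R by rewrite pnatr_eq0 -lt0n fact_gt0.
by field; apply/andP; split.
Qed.

Lemma nneseriesS (f : nat -> \bar R) : (forall k, 0 <= f k) ->
  \sum_(0 <= k <oo) f k = f 0%N + \sum_(0 <= k <oo) f k.+1.
Proof.
move=> f0; rewrite nneseries_recl//; congr (_ + _).
rewrite -(@nneseries_addn _ f 1%N)//; apply: eq_eseriesr => k _; by rewrite addn1.
Qed.

Lemma poisson_mean (rate : R) : (0 < rate)%R ->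
  \sum_(0 <= k <oo) (k%:R * poisson_pmf rate k)%:E = rate%:E.
Proof.
move=> r0; rewrite nneseriesS; last first.
  by move=> k; rewrite lee_fin mulr_ge0// poisson_pmf_ge0.
rewrite mul0r add0e; under eq_eseriesr do rewrite poisson_pmfS// EFinM.
rewrite nneseriesZl; last by move=> k _; rewrite lee_fin poisson_pmf_ge0.
by rewrite sum_poisson_pmf// mule1.
Qed.

(** The recursion [(k+1) p(k+1) = rate p(k)] removes one factor and shifts the index, so the second
    moment is [rate] times the mean of [k + 1]. *)
Lemma poisson_moment2 (rate : R) : (0 < rate)%R ->
  \sum_(0 <= k <oo) (k%:R ^+ 2 * poisson_pmf rate k)%:E = (rate * (rate + 1))%:E.
Proof.
move=> r0; rewrite nneseriesS; last first.
  by move=> k; rewrite lee_fin mulr_ge0 ?sqr_ge0// poisson_pmf_ge0.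
rewrite expr0n mul0r add0e.
under eq_eseriesr do rewrite expr2 -mulrA poisson_pmfS// mulrCA EFinM -natr1 mulrDl mul1r EFinD.
rewrite nneseriesZl; last first.
  by move=> k _; rewrite -EFinD lee_fin addr_ge0 ?mulr_ge0 ?poisson_pmf_ge0.
rewrite nneseriesD; first by rewrite poisson_mean// sum_poisson_pmf// EFinM EFinD.
- by move=> k _ _; rewrite lee_fin mulr_ge0 ?poisson_pmf_ge0.
- by move=> k _ _; rewrite lee_fin poisson_pmf_ge0.
Qed.

Context {dT} {T : measurableType dT} (P : probability T R).

Lemma poisson_law_integral (X : T -> R) l (g : R -> \bar R) : measurable_fun setT X ->
  poisson_law P l X -> measurable_fun setT g -> (forall x, 0 <= g x) ->
  \int[P]_w g (X w) = \int[poisson_prob l 0]_k g k%:R.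
Proof.
move=> mX [l0 hX] mg g0.
have mn : measurable_fun [set: nat] (fun k : nat => k%:R : R) by [].
pose m' := pushforward (poisson_prob l 0) (fun k : nat => k%:R : R) : {measure set R -> \bar R}.
rewrite (@integral_same_law _ _ _ P _ _ _ (m' mn))//.
by rewrite ge0_integral_pushforward.
Qed.

Lemma poisson_law_integral0 (X : T -> R) (g : R -> \bar R) : measurable_fun setT X ->
  poisson_law P 0%R X -> measurable_fun setT g -> (forall x, 0 <= g x) ->
  \int[P]_w g (X w) = g 0%R.
Proof.
move=> mX hX mg g0; rewrite (poisson_law_integral mX hX)//.
rewrite (@eq_measure_integral _ _ _ setT (@dirac _ nat 0%N R)).
  by rewrite integral_dirac// diracT mul1e.
by move=> A _ _; change (poisson_prob (0 : R)%R 0%N A = \d_0%N A); rewrite /poisson_prob ltxx.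
Qed.

Lemma poisson_law_integralE (X : T -> R) l (g : R -> \bar R) : measurable_fun setT X ->
  (0 < l)%R -> poisson_law P l X -> measurable_fun setT g -> (forall x, 0 <= g x) ->
  \int[P]_w g (X w) = \sum_(0 <= k <oo) g k%:R * (poisson_pmf l k)%:E.
Proof.
move=> mX l0 hX mg g0; rewrite (poisson_law_integral mX hX)// ge0_integral_nat//.
by apply: eq_eseriesr => k _; congr (_ * _); exact: poisson_prob_set1.
Qed.

Lemma poisson_law_mean (X : T -> R) l : measurable_fun setT X ->
  poisson_law P l X -> \int[P]_w `|X w|%:E = l%:E.
Proof.
move=> mX hX; have l0 := hX.1.
have mg : measurable_fun [set: R] (fun x : R => `|x|%:E).
  exact/measurable_EFinP.
have [l_eq0|ln0] := eqVneq l 0%R.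
  rewrite l_eq0 in hX *.
  by rewrite (@poisson_law_integral0 X (fun x => `|x|%:E)) ?normr0// => x; rewrite lee_fin.
have {ln0}l0' : (0 < l)%R by rewrite lt_neqAle eq_sym ln0.
rewrite (@poisson_law_integralE X l (fun x => `|x|%:E))//.
rewrite -[RHS]poisson_mean//; apply: eq_eseriesr => k _.
by rewrite ger0_norm// EFinM.
Qed.

(** The variable takes values in the natural numbers, so the indicator of being nonzero is at most
    its value. This controls integrands of large height, for which only the presence of points
    matters. *)
Lemma poisson_law_neq0 (X : T -> R) l : measurable_fun setT X ->
  poisson_law P l X -> P (X @^-1` ~` [set 0%R]) <= l%:E.
Proof.
move=> mX hX; have l0 := hX.1.
have ms : measurable (~` [set 0%R : R]) by exact: measurableC.
have mg : measurable_fun [set: R] (fun x : R => (\1_(~` [set 0%R]) x : R)%:E).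
  by apply/measurable_EFinP; exact: measurable_indic.
have g0 x : 0 <= (\1_(~` [set 0%R]) x : R)%:E by rewrite lee_fin.
have mpre : measurable (X @^-1` ~` [set 0%R]) by rewrite -[X in measurable X]setTI; exact: mX.
have -> : P (X @^-1` ~` [set 0%R]) = \int[P]_w (\1_(~` [set 0%R]) (X w) : R)%:E.
  transitivity (\int[P]_w (\1_(X @^-1` ~` [set 0%R]) w : R)%:E); last by [].
  by rewrite integral_indic// setIT.
have [l_eq0|ln0] := eqVneq l 0%R.
  rewrite l_eq0 in hX *.
  rewrite (@poisson_law_integral0 X (fun x => (\1_(~` [set 0%R]) x : R)%:E))//.
  by rewrite indicE memNset//=; apply.
have {ln0}l0' : (0 < l)%R by rewrite lt_neqAle eq_sym ln0.
rewrite (@poisson_law_integralE X l (fun x => (\1_(~` [set 0%R]) x : R)%:E))//.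
rewrite -[leRHS]poisson_mean//; apply: lee_nneseries => [k _ _|k _].
  by rewrite -EFinM lee_fin mulr_ge0// poisson_pmf_ge0.
rewrite -EFinM lee_fin ler_wpM2r ?poisson_pmf_ge0// indicE.
case: k => [|k]; first by rewrite memNset//=; apply.
by rewrite (@le_trans _ _ 1%R)// ?ler1n//; case: (_ \in _).
Qed.

Lemma poisson_law_variance (X : T -> R) l : measurable_fun setT X ->
  poisson_law P l X -> \int[P]_w ((X w - l) ^+ 2)%:E = l%:E.
Proof.
move=> mX hX; have l0 := hX.1.
have mg : measurable_fun [set: R] (fun x : R => ((x - l) ^+ 2)%:E).
  by apply/measurable_EFinP; apply: measurable_funX; exact: measurable_funB.
have g0 (x : R) : 0 <= ((x - l) ^+ 2)%:E by rewrite lee_fin sqr_ge0.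
have [l_eq0|ln0] := eqVneq l 0%R.
  rewrite l_eq0 in hX *.
  rewrite l_eq0 in mg g0.
  by rewrite (@poisson_law_integral0 X (fun x => ((x - 0) ^+ 2)%:E))// subrr expr0n.
have {ln0}l0' : (0 < l)%R by rewrite lt_neqAle eq_sym ln0.
rewrite (@poisson_law_integralE X l (fun x => ((x - l) ^+ 2)%:E))//.
under eq_eseriesr do rewrite -EFinM.
set S := (\sum_(0 <= k <oo) _)%E.
(* The cross term of the square is moved to the left, so that only series with nonnegative terms are
   added and no infinite values are subtracted. *)
have h1 : S + \sum_(0 <= k <oo) ((2 * l)%:E * (k%:R * poisson_pmf l k)%:E) =
    \sum_(0 <= k <oo) ((k%:R ^+ 2 * poisson_pmf l k)%:E + ((l ^+ 2)%:E * (poisson_pmf l k)%:E)).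
  rewrite -nneseriesD.
  - by apply: eq_eseriesr => k _; rewrite -!EFinM -!EFinD; congr EFin; ring.
  - by move=> k _ _; rewrite lee_fin mulr_ge0 ?sqr_ge0 ?poisson_pmf_ge0.
  - by move=> k _ _; rewrite -EFinM lee_fin !mulr_ge0 ?poisson_pmf_ge0.
move: h1; rewrite nneseriesZl; last by move=> k _; rewrite lee_fin mulr_ge0 ?poisson_pmf_ge0.
rewrite nneseriesD; last 2 first.
- by move=> k _ _; rewrite lee_fin mulr_ge0 ?sqr_ge0 ?poisson_pmf_ge0.
- by move=> k _ _; rewrite -EFinM lee_fin mulr_ge0 ?sqr_ge0 ?poisson_pmf_ge0.
rewrite nneseriesZl; last by move=> k _; rewrite lee_fin poisson_pmf_ge0.
rewrite poisson_mean// poisson_moment2// sum_poisson_pmf// mule1 -EFinM -EFinD.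
by case: S => [s [] h|//|//]; congr EFin; move: h; lra.
Qed.

End poisson_moments.

Lemma sqr_le_abs {R : realDomainType} (e x : R) : 0 <= e -> e <= `|x| -> e ^+ 2 <= x ^+ 2.
Proof. by move=> e0 ex; rewrite -(real_normK (num_real x)) lerXn2r. Qed.

(** * Square-integrable variables *)

Section second_moments.
Context {R : realType} {dT} {T : measurableType dT} (P : probability T R).
Implicit Types f g h : T -> R.

Lemma integral_ge_level (h : T -> R) (A : set T) (k : R) : measurable_fun setT h ->
  measurable A -> (forall w, 0 <= h w) -> 0 <= k -> (forall w, A w -> k <= h w) ->
  (k%:E * P A <= \int[P]_w (h w)%:E)%E.
Proof.
move=> mh mA h0 k0 Ak; rewrite -integral_cst// integral_mkcond; apply: ge0_le_integral => //.
- by move=> w _; rewrite patchE; case: ifP => // _; rewrite lee_fin.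
- exact/(measurable_restrictT _ mA).
- exact/measurable_EFinP.
- move=> w _; rewrite patchE; case: ifPn => [|_]; last by rewrite lee_fin.
  by rewrite inE => Aw; rewrite lee_fin Ak.
Qed.

Definition sq_integrable f : Prop :=
  measurable_fun setT f /\ (\int[P]_w ((f w) ^+ 2)%:E < +oo)%E.

Definition inner f g : R := \int[P]_w (f w * g w).

Lemma sq_integrable_prod f g : sq_integrable f -> sq_integrable g ->
  P.-integrable setT (fun w => (f w * g w)%:E).
Proof.
move=> [mf foo] [mg goo]; apply/integrableP; split.
  by apply/measurable_EFinP; exact: measurable_funM.
apply: (@le_lt_trans _ _ (\int[P]_w (((f w) ^+ 2)%:E + ((g w) ^+ 2)%:E))%E).
  apply: ge0_le_integral => //.
  - by apply: measurableT_comp => //; apply/measurable_EFinP; exact: measurable_funM.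
  - by apply: emeasurable_funD; apply/measurable_EFinP; exact: measurable_funX.
  - move=> w _ /=; rewrite -EFinD lee_fin normrM.
    have := sqr_ge0 (`|f w| - `|g w|); rewrite -(real_normK (num_real (f w))) -(real_normK (num_real (g w))).
    have := mulr_ge0 (normr_ge0 (f w)) (normr_ge0 (g w)).
    by rewrite sqrrB; lra.
rewrite ge0_integralD//.
- by rewrite lte_add_pinfty.
- by move=> w _; rewrite lee_fin sqr_ge0.
- by apply/measurable_EFinP; exact: measurable_funX.
- by move=> w _; rewrite lee_fin sqr_ge0.
- by apply/measurable_EFinP; exact: measurable_funX.
Qed.

Lemma innerC f g : inner f g = inner g f.
Proof. by congr Rintegral; apply/funext => w; rewrite mulrC. Qed.

Lemma inner_self f : sq_integrable f -> (\int[P]_w ((f w) ^+ 2)%:E = (inner f f)%:E)%E.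
Proof.
move=> hf; rewrite /inner /Rintegral fineK; last first.
  by apply: integrable_fin_num => //; exact: sq_integrable_prod.
by apply: eq_integral => w _; rewrite expr2.
Qed.

Lemma innerDZl f g h (c : R) : sq_integrable f -> sq_integrable g -> sq_integrable h ->
  inner (fun w => f w + c * g w) h = inner f h + c * inner g h.
Proof.
move=> hf hg hh; rewrite /inner -RintegralZl//; last exact: sq_integrable_prod.
rewrite -RintegralD//.
- by congr Rintegral; apply/funext => w; rewrite mulrDl mulrA.
- exact: sq_integrable_prod.
- have := integrableZl measurableT c (sq_integrable_prod hg hh).
  by apply: eq_integrable => // w _.
Qed.

Lemma sq_integrableDZ f g (c : R) : sq_integrable f -> sq_integrable g ->
  sq_integrable (fun w => f w + c * g w).
Proof.
move=> [mf foo] [mg goo]; have mfg : measurable_fun setT (fun w => f w + c * g w).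
  by apply: measurable_funD => //; exact: measurable_funM.
split => //.
have mf2 : measurable_fun setT (fun w => ((f w) ^+ 2)%:E).
  by apply/measurable_EFinP; exact: measurable_funX.
have mg2 : measurable_fun setT (fun w => ((g w) ^+ 2)%:E).
  by apply/measurable_EFinP; exact: measurable_funX.
apply: (@le_lt_trans _ _ (\int[P]_w (2%:E * ((f w) ^+ 2)%:E + (2 * c ^+ 2)%:E * ((g w) ^+ 2)%:E))%E).
  apply: ge0_le_integral => //.
  - by move=> w _; rewrite lee_fin sqr_ge0.
  - by apply/measurable_EFinP; exact: measurable_funX.
  - by apply: emeasurable_funD; exact: measurable_funeM.
  - move=> w _; rewrite -!EFinM -EFinD lee_fin.
    have := sqr_ge0 (f w - c * g w); nra.
have c0 : 0 <= 2 * c ^+ 2 by rewrite mulr_ge0 ?sqr_ge0.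
rewrite ge0_integralD//; try exact: measurable_funeM;
  try (by move=> w _; rewrite -EFinM lee_fin mulr_ge0 ?sqr_ge0).
rewrite !ge0_integralZl//; 
  try (by move=> w _; rewrite lee_fin sqr_ge0).
by rewrite lte_add_pinfty// lte_mul_pinfty.
Qed.

End second_moments.

(** * Tail bounds for linear combinations *)

Section atoms_moments.
Context {R : realType} {dT} {T : measurableType dT} (P : probability T R).
Local Notation pr := (pr P).
Context {dX} {X : measurableType dX} (mu : {measure set X -> \bar R}).
Variables (D : set (set X)) (M : set X -> T -> R).
Hypothesis Dm : D `<=` measurable.
Hypothesis Dfin : forall A, D A -> (mu A < +oo)%E.
Hypothesis D0 : D set0.
Hypothesis DI : setI_closed D.
Hypothesis DD : forall A B, D A -> D B -> D (A `\` B).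
Hypothesis DU : forall A B, D A -> D B -> D (A `|` B).
Hypothesis mM : forall A, measurable_fun setT (M A).
Hypothesis aM : fin_additive P D M.

Lemma step_disjoint n (C : 'I_n -> set X) (c : 'I_n -> R) (psi : R -> R) x :
  trivIset setT C -> psi 0 = 0 ->
  psi (\sum_j c j * \1_(C j) x) = \sum_j psi (c j) * \1_(C j) x.
Proof.
move=> tC psi0; have [[j Cj]|nC] := pselect (exists j, C j x).
  have hk k : k != j -> \1_(C k) x = 0 :> R.
    move=> kj; rewrite indicE memNset// => Ck.
    have /seteqP[/(_ x) h _] := (iffLR trivIsetP tC) k j Logic.I Logic.I kj.
    by apply: h.
  have hz (d : 'I_n -> R) : \sum_(k | k != j) d k * \1_(C k) x = 0.
    by rewrite big1// => k kj; rewrite hk// mulr0.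
  rewrite (bigD1 j)//= [in RHS](bigD1 j)//= !hz.
  by rewrite indicE mem_set// !mulr1 !addr0.
have h k : \1_(C k) x = 0 :> R by rewrite indicE memNset// => Ck; apply: nC; exists k.
by rewrite !big1// => k _; rewrite h mulr0.
Qed.

(** The random combination and the step function get the same coefficients on the same disjoint
    sets, so both sides of a moment bound become sums over these sets. *)
Lemma lin_step_atoms (l : seq (R * set X)) : in_D D l ->
  exists n (C : 'I_n -> set X) (c : 'I_n -> R),
  [/\ forall j, D (C j), trivIset setT C,
      {ae P, forall w, lin M l w = \sum_j c j * M (C j) w} &
      forall x, step l x = \sum_j c j * \1_(C j) x].
Proof.
move=> Dl; pose As := [seq p.2 | p <- l].
have AsD A : A \in As -> D A by move=> /mapP[p pl ->]; exact: Dl.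
have [n [C [I [DC tC CE _]]]] := atoms_exist D0 DI DD AsD.
have lE p : p \in l -> p.2 = \bigcup_j (if I p.2 j then C j else set0).
  by move=> pl; apply: CE; exact: map_f.
exists n, C, (fun j => \sum_(p <- l) p.1 * (I p.2 j)%:R); split => //.
  exact: (lin_atoms D0 aM DC tC Dl lE).
move=> x; rewrite /step; under [RHS]eq_bigr do rewrite mulr_suml.
rewrite exchange_big/= big_seq [RHS]big_seq; apply: eq_bigr => p pl.
under eq_bigr do rewrite -mulrA; rewrite -mulr_sumr; congr (_ * _).
rewrite [in LHS](lE _ pl) indicE.
have [Cx|nC] := pselect ((\bigcup_j (if I p.2 j then C j else set0)) x).
  rewrite mem_set//; case: Cx => j _; case: ifPn => // Ij Cj.
  rewrite (bigD1 j)//= Ij indicE mem_set// mulr1 big1 ?addr0// => k kj.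
  rewrite indicE memNset ?mulr0// => Ck.
  by have /seteqP[/(_ x) h _] := (iffLR trivIsetP tC) k j Logic.I Logic.I kj; apply: h.
rewrite memNset// big1// => j _; have [Ij|] := boolP (I p.2 j); rewrite ?mul0r//.
by rewrite mul1r indicE memNset// => Cj; apply: nC; exists j => //; rewrite Ij.
Qed.

Definition weight (A : set X) : R := fine (mu A).

Lemma weightE A : D A -> mu A = (weight A)%:E.
Proof. by move=> DA; rewrite fineK// ge0_fin_numE ?Dfin// measure_ge0. Qed.

Lemma weight_ge0 A : 0 <= weight A.
Proof. by apply: fine_ge0; exact: measure_ge0. Qed.

Lemma modular_disjoint n (C : 'I_n -> set X) (c : 'I_n -> R) (phi : R -> R) (f : X -> R) :
  (forall j, D (C j)) -> trivIset setT C -> phi 0 = 0 -> (forall x, 0 <= phi x) ->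
  (forall x, f x = \sum_j c j * \1_(C j) x) ->
  modular mu phi f = (\sum_j phi (c j) * weight (C j))%:E.
Proof.
move=> DC tC phi0 phi_ge0 fE; rewrite /modular.
under eq_integral do rewrite fE (step_disjoint _ _ tC phi0) -sumEFin.
rewrite ge0_integral_sum//; last 2 first.
- by move=> j; apply/measurable_EFinP; apply: measurable_funM => //; apply: measurable_indic; exact: Dm.
- by move=> j x _; rewrite lee_fin mulr_ge0.
rewrite -sumEFin; apply: eq_bigr => j _; under eq_integral do rewrite EFinM.
have mi : measurable_fun setT (fun x => (\1_(C j) x : R)%:E).
  by apply/measurable_EFinP; apply: measurable_indic; exact: Dm.
rewrite ge0_integralZl ?lee_fin//.
rewrite integral_indic//; last exact: Dm.
by rewrite setIT weightE// -EFinM.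
Qed.

Section second_moment.
Variable kappa : R.
Hypothesis kappa0 : 0 <= kappa.
Hypothesis M2 : forall A, D A -> (\int[P]_w ((M A w) ^+ 2)%:E = kappa%:E * mu A)%E.

Lemma sq_integrable_M A : D A -> sq_integrable P (M A).
Proof.
by move=> DA; split=> //; rewrite M2// weightE// -EFinM ltry.
Qed.

Lemma inner_M_self A : D A -> inner P (M A) (M A) = kappa * weight A.
Proof.
by move=> DA; apply: EFin_inj; rewrite -inner_self ?M2 ?weightE//; exact: sq_integrable_M.
Qed.

(* Additivity of the second moment alone forces orthogonality. *)
Lemma inner_M_disjoint A B : D A -> D B -> A `&` B = set0 -> inner P (M A) (M B) = 0.
Proof.
move=> DA DB AB; have DAB := DU DA DB.
have hA := sq_integrable_M DA; have hB := sq_integrable_M DB.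
pose C (b : bool) := if b then A else B.
have DC b : D (C b) by case: b.
have tC : trivIset setT C.
  by apply/trivIsetP => -[] [] //= _ _ _; rewrite // setIC.
have CE : \bigcup_b C b = A `|` B.
  apply/seteqP; split => x; first by move=> [[] _ h]; [left|right].
  by move=> [h|h]; [exists true|exists false].
have := aM DC tC; rewrite CE => /(_ DAB) hM.
have : (\int[P]_w ((M (A `|` B) w) ^+ 2)%:E = \int[P]_w ((M A w + 1 * M B w) ^+ 2)%:E)%E.
  apply: ae_eq_integral => //.
  - by apply/measurable_EFinP; exact: measurable_funX.
  - apply/measurable_EFinP; apply: measurable_funX; apply: measurable_funD => //.
    exact: measurable_funM.
  - apply: filterS hM => w -> _; congr (_ ^+ 2)%:E.
    by rewrite big_bool/= mul1r.
rewrite M2// inner_self; last exact: sq_integrableDZ.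
have hAB := sq_integrableDZ 1 hA hB.
rewrite innerDZl// (innerC _ (M A)) (innerC _ (M B)) !innerDZl// !inner_M_self//.
have -> : mu (A `|` B) = (weight A + weight B)%:E.
  by rewrite EFinD -!weightE//; apply: measureU => //; exact: Dm.
rewrite -EFinM => h; have {h} := EFin_inj h.
by rewrite (innerC _ (M B) (M A)); lra.
Qed.

Lemma second_moment_disjoint n (C : 'I_n -> set X) (c : 'I_n -> R) (Q : pred 'I_n) :
  (forall j, D (C j)) -> trivIset setT C ->
  sq_integrable P (fun w => \sum_(j | Q j) c j * M (C j) w) /\
  (\int[P]_w ((\sum_(j | Q j) c j * M (C j) w) ^+ 2)%:E =
   (kappa * \sum_(j | Q j) c j ^+ 2 * weight (C j))%:E)%E.
Proof.
move=> DC tC.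
(* Pythagoras by induction; orthogonality of the partial sum to every term still to come is carried
   along to remove the cross terms. *)
have key (s : seq 'I_n) : uniq s ->
  [/\ sq_integrable P (fun w => \sum_(j <- s) c j * M (C j) w),
    forall i, i \notin s -> inner P (fun w => \sum_(j <- s) c j * M (C j) w) (M (C i)) = 0 &
    inner P (fun w => \sum_(j <- s) c j * M (C j) w) (fun w => \sum_(j <- s) c j * M (C j) w)
      = kappa * \sum_(j <- s) c j ^+ 2 * weight (C j)].
  elim: s => [_|i s IH /= /andP[is_ us]].
    split.
    - split; first by under eq_fun do rewrite big_nil; exact: measurable_cst.
      by under eq_integral do rewrite big_nil expr0n; rewrite integral0 ltry.
    - move=> i _; rewrite /inner (_ : (fun w => _) = cst 0) ?Rintegral_cst ?mul0r//.
      by apply/funext => w; rewrite big_nil mul0r.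
    - rewrite /inner (_ : (fun w => _) = cst 0) ?Rintegral_cst ?mul0r ?big_nil ?mulr0//.
      by apply/funext => w; rewrite big_nil mul0r.
  have [hs os es] := IH us.
  have hi := sq_integrable_M (DC i).
  have E : (fun w => \sum_(j <- i :: s) c j * M (C j) w) =
           (fun w => (\sum_(j <- s) c j * M (C j) w) + c i * M (C i) w).
    by apply/funext => w; rewrite big_cons addrC.
  have hsi := sq_integrableDZ (c i) hs hi.
  rewrite E; split => //.
    move=> k; rewrite inE negb_or => /andP[ki ks]; have hk := sq_integrable_M (DC k).
    rewrite innerDZl// os// inner_M_disjoint ?mulr0 ?addr0//.
    by apply: (iffLR trivIsetP tC) => //; rewrite eq_sym.
  set S := (fun w => \sum_(j <- s) c j * M (C j) w) in hs hsi os es *.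
  rewrite innerDZl// (innerC _ S) (innerC _ (M (C i))) !innerDZl//.
  by rewrite es (innerC _ (M (C i)) S) os// inner_M_self// big_cons; ring.
have [h1 _ h3] := key [seq j <- enum 'I_n | Q j] (filter_uniq _ (enum_uniq _)).
have sumE (F : 'I_n -> R) : \sum_(j | Q j) F j = \sum_(j <- [seq j <- enum 'I_n | Q j]) F j.
  by rewrite big_filter big_enum_cond.
have fE : (fun w => \sum_(j | Q j) c j * M (C j) w) =
          (fun w => \sum_(j <- [seq j <- enum 'I_n | Q j]) c j * M (C j) w).
  by apply/funext => w; rewrite sumE.
split; first by rewrite fE.
by under eq_integral do rewrite sumE; rewrite inner_self// h3 sumE.
Qed.

Lemma second_moment_lin l : in_D D l ->
  (\int[P]_w ((lin M l w) ^+ 2)%:E = kappa%:E * modular mu (fun x => (x ^+ 2)%R) (step l))%E.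
Proof.
move=> Dl; have [n [C [c [DC tC lE sE]]]] := lin_step_atoms Dl.
rewrite (modular_disjoint DC tC _ _ sE)//; last 2 first.
- by rewrite expr0n.
- by move=> x; exact: sqr_ge0.
have [[mS _] h] := second_moment_disjoint c xpredT DC tC.
rewrite -EFinM -h; apply: ae_eq_integral => //.
- by apply/measurable_EFinP; apply: measurable_funX; exact: measurable_lin.
- by apply/measurable_EFinP; exact: measurable_funX.
- by apply: filterS lE => w -> _.
Qed.

(** Chebyshev's inequality, hence the constant [kappa / e ^+ 2]. *)
Lemma dominated_by_second_moment : dominated_by P mu (fun x => x ^+ 2) D M.
Proof.
move=> e e0; have e2 : 0 < e ^+ 2 by rewrite exprn_gt0.
exists (kappa / e ^+ 2); first by rewrite divr_ge0// ltW.
move=> l Dl; have ml : measurable_fun setT (lin M l) by exact: measurable_lin.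
have := @integral_ge_level _ _ _ P (fun w => (lin M l w) ^+ 2) [set w | e <= `|lin M l w|] (e ^+ 2).
move=> /(_ (measurable_funX _ ml) (measurable_abs_ge e ml) (fun w => sqr_ge0 _) (ltW e2)).
rewrite second_moment_lin// prE; last exact: measurable_abs_ge.
have [n [C [c [DC tC _ sE]]]] := lin_step_atoms Dl.
rewrite (modular_disjoint DC tC _ _ sE) ?expr0n//; last by move=> x; exact: sqr_ge0.
rewrite -!EFinM !lee_fin => h; rewrite mulrAC ler_pdivlMr// mulrC; apply: h => w /= ew.
by apply: sqr_le_abs => //; exact: ltW.
Qed.

End second_moment.

Lemma first_moment_sum n (C : 'I_n -> set X) (c : 'I_n -> R) (Q : pred 'I_n) (k : R) e :
  (forall A, D A -> (\int[P]_w `|M A w|%:E <= (k * weight A)%:E)%E) ->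
  (forall j, D (C j)) -> 0 < e ->
  pr [set w | e <= `|\sum_(j | Q j) c j * M (C j) w|] <=
    k / e * \sum_(j | Q j) `|c j| * weight (C j).
Proof.
move=> M1 DC e0.
have mS : measurable_fun setT (fun w => \sum_(j | Q j) c j * M (C j) w).
  rewrite (_ : (fun w => _) = (fun w => \sum_(j <- [seq j <- enum 'I_n | Q j]) c j * M (C j) w)).
    by apply: measurable_sum => j; exact: measurable_funM.
  by apply/funext => w; rewrite big_filter big_enum_cond.
have mA : measurable_fun setT (fun w => `|\sum_(j | Q j) c j * M (C j) w|).
  exact: measurableT_comp.
have mcM j : measurable_fun setT (fun w => (`|c j| * `|M (C j) w|)%:E).
  by apply/measurable_EFinP; apply: measurable_funM => //; exact: measurableT_comp.
have := @integral_ge_level _ _ _ P (fun w => `|\sum_(j | Q j) c j * M (C j) w|)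
  [set w | e <= `|\sum_(j | Q j) c j * M (C j) w|] e mA (measurable_abs_ge e mS) (fun=> normr_ge0 _) (ltW e0).
move=> /(_ (fun w h => h)); rewrite prE; last exact: measurable_abs_ge.
rewrite -EFinM => h; rewrite mulrAC ler_pdivlMr// mulrC -lee_fin; apply: (le_trans h).
have sumE (F : 'I_n -> R) : \sum_(j | Q j) F j = \sum_(j <- [seq j <- enum 'I_n | Q j]) F j.
  by rewrite big_filter big_enum_cond.
apply: (@le_trans _ _ (\int[P]_w (\sum_(j <- [seq j <- enum 'I_n | Q j]) (`|c j| * `|M (C j) w|)%:E))%E).
  apply: ge0_le_integral => //.
  - exact/measurable_EFinP.
  - by apply: emeasurable_sum => j.
  - move=> w _; rewrite sumEFin lee_fin sumE; apply: (le_trans (ler_norm_sum _ _ _)).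
    by apply: ler_sum => j _; rewrite normrM.
rewrite ge0_integral_sum//.
rewrite sumE mulr_sumr -sumEFin; apply: lee_sum => j _.
under eq_integral do rewrite EFinM.
have mMj : measurable_fun setT (fun w => `|M (C j) w|%:E).
  by apply/measurable_EFinP; exact: measurableT_comp.
rewrite ge0_integralZl ?lee_fin//.
rewrite mulrCA EFinM; apply: lee_wpmul2l; first by rewrite lee_fin.
exact: M1.
Qed.

(** Atoms with coefficient at most 1 in absolute value are handled by Markov's inequality, which
    gives [e^-1]. The others contribute only if [M] is nonzero on one of them, which by the union
    bound costs at most the total weight, whatever the coefficients; this gives the [+ 1]. *)
Lemma dominated_by_first_moment :
  (forall A, D A -> (\int[P]_w `|M A w|%:E <= (weight A)%:E)%E) ->
  (forall A, D A -> pr [set w | M A w != 0] <= weight A) ->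
  dominated_by P mu (fun x => Num.min `|x| 1) D M.
Proof.
move=> M1 M0 e e0; exists (e^-1 + 1); first by rewrite addr_ge0// invr_ge0 ltW.
move=> l Dl; have [n [C [c [DC tC lE sE]]]] := lin_step_atoms Dl.
rewrite (modular_disjoint DC tC _ _ sE)//; last by rewrite normr0 min_l.
have ml : measurable_fun setT (lin M l) by exact: measurable_lin.
pose Q j := `|c j| <= 1.
have mS : measurable_fun setT (fun w => \sum_(j | Q j) c j * M (C j) w).
  rewrite (_ : (fun w => _) = (fun w => \sum_(j <- [seq j <- enum 'I_n | Q j]) c j * M (C j) w)).
    by apply: measurable_sum => j; exact: measurable_funM.
  by apply/funext => w; rewrite big_filter big_enum_cond.
have mneq A : measurable [set w | M A w != 0].
  rewrite (_ : [set w | _] = M A @^-1` (~` [set 0])).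
    by rewrite -[X in measurable X]setTI; apply: mM => //; exact: measurableC.
  by apply/seteqP; split => w /= /eqP.
pose E j := if Q j then set0 else [set w | M (C j) w != 0].
have mE j : measurable (E j) by rewrite /E; case: ifP.
have mexE : measurable [set w | exists j, E j w].
  rewrite (_ : [set w | _] = \bigcup_(j in setT) E j).
    by apply: fin_bigcup_measurable => //; exact: finite_finset.
  by apply/seteqP; split => w [j]; [move=> h; exists j|move=> _ h; exists j].
rewrite -EFinM lee_fin.
apply: (@le_trans _ _ (pr [set w | e <= `|\sum_(j | Q j) c j * M (C j) w|] + pr [set w | exists j, E j w])).
  rewrite -[leRHS]addr0 -[X in _ + _ + X](_ : pr set0 = 0); last by rewrite pr0.
  have [N [mN N0 hN]] := lE.
  rewrite [X in _ <= _ + X](_ : _ = pr N); last by rewrite pr0 /pr N0.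
  apply: (@le_trans _ _ (pr ([set w | e <= `|\sum_(j | Q j) c j * M (C j) w|] `|` [set w | exists j, E j w]) + pr N)).
    apply: pr_leU => //.
    - exact: measurable_abs_ge.
    - by apply: measurableU => //; exact: measurable_abs_ge.
    - move=> w /= ew; have [lw|/hN] := pselect (lin M l w = \sum_j c j * M (C j) w); last by right.
      left; have [|nE] := pselect (exists j, E j w); first by right.
      left; rewrite lw (bigID Q)/= in ew; rewrite [X in _ + X]big1 ?addr0// in ew.
      move=> j nQ; apply/eqP; rewrite mulf_eq0; apply/orP; right.
      by apply/negPn/negP => M0'; apply: nE; exists j; rewrite /E (negbTE nQ).
  rewrite lerD2r; apply: pr_leU => //; first by apply: measurableU => //; exact: measurable_abs_ge.
  exact: measurable_abs_ge.
have h1 : pr [set w | e <= `|\sum_(j | Q j) c j * M (C j) w|] <=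
    e^-1 * \sum_(j | Q j) `|c j| * weight (C j).
  rewrite -(div1r e); apply: first_moment_sum => // A DA; rewrite mul1r; exact: M1.
have phi_ge0 (Q' : pred 'I_n) : 0 <= \sum_(j | Q' j) Num.min `|c j| 1 * weight (C j).
  by rewrite sumr_ge0// => j _; rewrite mulr_ge0 ?weight_ge0// le_min normr_ge0 ler01.
have einv0 : 0 <= e^-1 by rewrite invr_ge0 ltW.
rewrite [X in _ * X](bigID Q)/= mulrDr; apply: lerD.
  apply: (le_trans h1); rewrite mulrDl [X in _ + X]mul1r -[leLHS]addr0 lerD//.
  rewrite ler_wpM2l//; apply: ler_sum => j Qj; by rewrite min_l.
apply: (le_trans (pr_exists_le P mE)); rewrite (bigID Q)/= big1 ?add0r; last first.
  by move=> j Qj; rewrite /E Qj pr0.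
rewrite mulrDl [X in _ + X]mul1r -[leLHS]add0r lerD//; first by rewrite mulr_ge0.
apply: ler_sum => j nQ; rewrite /E (negbTE nQ) min_r ?mul1r; first exact: M0.
by rewrite ltW// ltNge.
Qed.

(** Small coefficients are handled by Chebyshev's inequality and large ones by Markov's, each at
    threshold [e / 2]; the two terms of the constant come from these. The minimum in the modulus
    selects the power that fits. *)
Lemma dominated_by_mixed_moment (k : R) : 0 <= k ->
  (forall A, D A -> (\int[P]_w ((M A w) ^+ 2)%:E = 1%:E * mu A)%E) ->
  (forall A, D A -> (\int[P]_w `|M A w|%:E <= (k * weight A)%:E)%E) ->
  dominated_by P mu (fun x => Num.min (x ^+ 2) `|x|) D M.
Proof.
move=> k0 M2 M1 e e0; have e2 : 0 < e / 2 by rewrite divr_gt0.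
exists ((e / 2) ^- 2 + k / (e / 2)).
  by apply: addr_ge0; [rewrite invr_ge0 sqr_ge0|rewrite divr_ge0// ltW].
move=> l Dl; have [n [C [c [DC tC lE sE]]]] := lin_step_atoms Dl.
have min0 x : 0 <= Num.min (x ^+ 2) `|x| :> R by rewrite le_min sqr_ge0 normr_ge0.
rewrite (modular_disjoint DC tC _ _ sE)//; last by rewrite /= normr0 expr0n min_l.
have ml : measurable_fun setT (lin M l) by exact: measurable_lin.
pose Q j := `|c j| <= 1.
have mS (Q' : pred 'I_n) : measurable_fun setT (fun w => \sum_(j | Q' j) c j * M (C j) w).
  rewrite (_ : (fun w => _) = (fun w => \sum_(j <- [seq j <- enum 'I_n | Q' j]) c j * M (C j) w)).
    by apply: measurable_sum => j; exact: measurable_funM.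
  by apply/funext => w; rewrite big_filter big_enum_cond.
pose S1 := [set w | e / 2 <= `|\sum_(j | Q j) c j * M (C j) w|].
pose S2 := [set w | e / 2 <= `|\sum_(j | ~~ Q j) c j * M (C j) w|].
have mS1 : measurable S1 by exact: measurable_abs_ge.
have mS2 : measurable S2 by exact: measurable_abs_ge.
rewrite -EFinM lee_fin.
apply: (@le_trans _ _ (pr S1 + pr S2)).
  apply: (@le_trans _ _ (pr (S1 `|` S2))); last by apply: pr_leU => //; exact: measurableU.
  apply: (ae_pr (Q := fun w => lin M l w = \sum_j c j * M (C j) w)) => //.
  - exact: measurable_abs_ge.
  - exact: measurableU.
  - move=> w lw /= ew; apply/orP; rewrite /S1 /S2/= leNgt [X in _ || X]leNgt -negb_and.
    apply/negP => /andP[h1 h2]; move: ew; rewrite lw (bigID Q)/= leNgt => /negP; apply.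
    by apply: (le_lt_trans (ler_normD _ _)); rewrite [ltRHS]splitr ltrD.
rewrite mulrDl; apply: lerD.
  have [_ h] := second_moment_disjoint M2 c Q DC tC.
  have e22 : 0 < (e / 2) ^+ 2 by rewrite exprn_gt0.
  have := @integral_ge_level _ _ _ P (fun w => (\sum_(j | Q j) c j * M (C j) w) ^+ 2) S1 ((e / 2) ^+ 2).
  move=> /(_ (measurable_funX _ (mS Q)) mS1 (fun w => sqr_ge0 _) (ltW e22)).
  rewrite h prE// -EFinM lee_fin mul1r => h'; rewrite mulrC ler_pdivlMr// mulrC.
  apply: (le_trans (h' _)).
    move=> w; rewrite /S1/= => ew.
    by apply: sqr_le_abs => //; exact: ltW.
  rewrite [leRHS](bigID Q)/= -[leLHS]addr0 lerD ?sumr_ge0//; last first.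
    by move=> j _; rewrite mulr_ge0 ?weight_ge0.
  apply: ler_sum => j Qj; rewrite min_l// -(real_normK (num_real (c j))).
  by rewrite expr2 ler_piMr.
apply: (le_trans (first_moment_sum c (fun j => ~~ Q j) M1 DC e2)).
apply: ler_wpM2l; first by rewrite divr_ge0// ltW.
rewrite [leRHS](bigID Q)/= -[leLHS]add0r lerD ?sumr_ge0//.
  by move=> j _; rewrite mulr_ge0 ?weight_ge0.
apply: ler_sum => j nQ; rewrite min_r// -(real_normK (num_real (c j))).
by rewrite expr2 ler_peMr// ltW// ltNge.
Qed.

End atoms_moments.

(** * Wiener, Poisson and compensated Poisson integrals *)

Section integral_tools.
Context {R : realType}.

Lemma limn_einf_le_cvg (u h : nat -> \bar R) (a : \bar R) :
  (forall n, (u n <= h n)%E) -> h n @[n --> \oo] --> a -> (limn_einf u <= a)%E.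
Proof.
move=> uh ha; rewrite limn_einf_lim -(cvg_lim _ ha)//; apply: lee_lim.
- exact: is_cvg_einfs.
- by apply/cvg_ex; exists a.
- near=> n; apply: le_trans (uh n); apply: ereal_inf_lbound.
  by exists n => //=.
Unshelve. all: by end_near. Qed.

Context {dX} {X : measurableType dX} (mu : {measure set X -> \bar R}).

Lemma integral_step (D : set (set X)) (l : seq (R * set X)) :
  D `<=` measurable -> (forall A, D A -> (mu A < +oo)%E) -> in_D D l ->
  mu.-integrable setT (fun x => (step l x)%:E) /\
  \int[mu]_x step l x = \sum_(p <- l) p.1 * fine (mu p.2).
Proof.
move=> Dm Dfin; rewrite /step; elim: l => [|p l IH] Dl.
  split; first by under eq_fun do rewrite big_nil; exact: integrable0.
  by rewrite big_nil; under eq_Rintegral do rewrite big_nil; rewrite Rintegral_cst// mul0r.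
have Dp : D p.2 by apply: Dl; exact: mem_head.
have Dl' : in_D D l by move=> q ql; apply: Dl; rewrite inE ql orbT.
have [il el] := IH Dl'.
have mp := Dm _ Dp.
have ip : mu.-integrable setT (fun x => (\1_(p.2) x : R)%:E).
  apply/integrableP; split; first by apply/measurable_EFinP; exact: measurable_indic.
  rewrite (eq_integral (fun x => (\1_(p.2) x : R)%:E)); last by move=> x _; rewrite gee0_abs// lee_fin.
  by rewrite integral_indic// setIT; exact: Dfin.
have ipZ : mu.-integrable setT (fun x => (p.1 * \1_(p.2) x)%:E).
  have := integrableZl measurableT p.1 ip.
  by apply: eq_integrable => // x _.
split.
  have := integrableD measurableT ipZ il; apply: eq_integrable => // x _.
  by rewrite big_cons.
rewrite big_cons -el; under eq_Rintegral do rewrite big_cons.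
rewrite RintegralD// RintegralZl//; congr (_ * _ + _).
by rewrite /Rintegral integral_indic// setIT.
Qed.

End integral_tools.

(** * The integrals as limits in probability: existence and uniqueness *)

Section defs_integrals.
Context {R : realType} {dT} {T : measurableType dT} {P : probability T R}.
Context {dX} {X : measurableType dX} (mu : {measure set X -> \bar R}).
Variable D : set (set X).
Hypothesis Dm : D `<=` measurable.
Hypothesis Dfin : forall A, D A -> (mu A < +oo)%E.
Hypothesis D0 : D set0.
Hypothesis DI : setI_closed D.
Hypothesis DD : forall A B, D A -> D B -> D (A `\` B).
Hypothesis DU : forall A B, D A -> D B -> D (A `|` B).
(** A set carrying the integrands, such as a bounded space-time set or the cylinder over it. Finite
    intensity alone does not put a level set in the ring; inside [S] it does. *)
Variable S : set X.
Hypothesis hS : forall A, measurable A -> A `<=` S -> (mu A < +oo)%E -> D A.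
Implicit Types (f g : X -> R).

Definition sq : R -> R := fun x => x ^+ 2.
Definition cut : R -> R := fun x => Num.min `|x| 1.
Definition mix : R -> R := fun x => Num.min (x ^+ 2) `|x|.

Lemma sq_modulus : is_modulus sq.
Proof.
split; rewrite /sq.
- by rewrite expr0n.
- by move=> x y xy; rewrite -(real_normK (num_real x)); exact: sqr_le_abs.
- move=> x y; have := sqr_ge0 (x - y); nra.
- exact: measurable_funX.
- move=> x x1; rewrite -(real_normK (num_real x)) expr2 ler_piMr//.
- by move=> x x0; rewrite exprn_even_gt0.
Qed.

Lemma cut_modulus : is_modulus cut.
Proof.
split; rewrite /cut.
- by rewrite normr0 min_l.
- by move=> x y xy; rewrite le_min !ge_min xy lexx orbT.
- move=> x y; have := ler_normD x y; have := normr_ge0 x; have := normr_ge0 y.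
  by case: (leP `|x| 1) => hx; case: (leP `|y| 1) => hy; case: (leP `|x + y| 1) => hxy; lra.
- exact: measurable_minr.
- by move=> x _; rewrite ge_min lexx.
- by move=> x x0; rewrite lt_min normr_gt0 x0 ltr01.
Qed.

Lemma mix_modulus : is_modulus mix.
Proof.
have sqn (x : R) : x ^+ 2 = `|x| ^+ 2 by rewrite real_normK ?num_real.
split; rewrite /mix.
- by rewrite normr0 expr0n min_l.
- move=> x y xy; rewrite le_min !ge_min xy orbT andbT.
  by rewrite (sqn x) sqr_le_abs.
- move=> x y; rewrite (sqn x) (sqn y) (sqn (x + y)).
  have := ler_normD x y; have := normr_ge0 x; have := normr_ge0 y; have := normr_ge0 (x + y).
  set a := `|x|; set b := `|y|; set c := `|x + y| => c0 b0 a0 cab.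
  have [ab|ba] := leP a b.
    (* Here [c <= 2 * b], so each argument of the minimum grows by a factor of at most 4, the square
       being the worse one. *)
    have h : Num.min (c ^+ 2) c <= 4 * Num.min (b ^+ 2) b.
      by case: (leP (c ^+ 2) c) => h1; case: (leP (b ^+ 2) b) => h2; nra.
    apply: (le_trans h); rewrite ler_pM2l// lerDr le_min sqr_ge0//.
  have h : Num.min (c ^+ 2) c <= 4 * Num.min (a ^+ 2) a.
    by case: (leP (c ^+ 2) c) => h1; case: (leP (a ^+ 2) a) => h2; nra.
  by apply: (le_trans h); rewrite ler_pM2l// lerDl le_min sqr_ge0.
- exact: measurable_minr.
- by move=> x _; rewrite ge_min lexx orbT.
- by move=> x x0; rewrite lt_min normr_gt0 x0 andbT exprn_even_gt0.
Qed.

Record modular_on (phi : R -> R) f : Prop := ModularOn {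
  mo_measurable : measurable_fun setT f ;
  mo_finite : (modular mu phi f < +oo)%E ;
  mo_support : forall x, ~ S x -> f x = 0 }.

Lemma modular_on_level phi (hphi : is_modulus phi) f (r : R) (A : set X) : modular_on phi f ->
  measurable A -> r != 0 -> (forall x, A x -> `|r| <= `|f x|) -> D A.
Proof.
move=> [mf foo fS] mA r0 Ar; apply: hS => //.
  move=> x Ax; apply: contrapT => nS; have := Ar x Ax.
  by rewrite fS// normr0 normr_le0 (negbTE r0).
exact: modular_level hphi _ _ _ mf foo mA r0 Ar.
Qed.

Lemma modular_on_integrable phi (hphi : is_modulus phi) f : modular_on phi f ->
  prob_integrable mu phi D f.
Proof.
move=> hf; have [mf foo fS] := hf; split => // n p /mapP[r].
rewrite mem_filter => /andP[r0 _] ->.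
apply: (modular_on_level hphi hf _ r0) => /=.
  rewrite -[X in measurable X]setTI; apply: measurableT_comp => //.
  by move=> x /= <-; have [] := quant_bound n (f x).
Qed.

Lemma modular_on_le phi (hphi : is_modulus phi) f g : modular_on phi f ->
  measurable_fun setT g -> (forall x, `|g x| <= `|f x|) -> modular_on phi g.
Proof.
move=> [mf foo fS] mg gf; split => //.
  by apply: le_lt_trans foo; exact: modular_le.
by move=> x /fS fx; have := gf x; rewrite fx normr0 normr_le0 => /eqP.
Qed.

Lemma prob_integralN (M : set X -> T -> R) phi (hphi : is_modulus phi) f Y :
  (forall A, measurable_fun setT (M A)) -> dominated_by P mu phi D M ->
  modular_on phi f -> prob_integral P M f Y ->
  prob_integral P M (fun x => - f x) (fun w => - Y w).
Proof.
move=> mM dM hf [mY hY]; have [mf foo fS] := hf.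
have hNf : modular_on phi (fun x => - f x).
  by apply: (modular_on_le hphi hf) => [|x]; [exact: measurableT_comp|rewrite normrN].
have If := modular_on_integrable hphi hf.
apply: (prob_integral_approx hphi Dm mM dM (modular_on_integrable hphi hNf)
  (h := fun n => opp_list (qlevels f n))).
- by move=> n; apply: in_D_opp; exact: (pi_levels If).
- rewrite (_ : (fun n => _) = (fun n => modular mu phi (fun x => step (qlevels f n) x - f x))).
    exact: (qlevels_cvg hphi If).
  apply/funext => n; apply: eq_integral => x _; congr EFin.
  have e1 : `|step (opp_list (qlevels f n)) x - - f x| = `|step (qlevels f n) x - f x|.
    by rewrite step_opp opprK addrC distrC.
  by apply/le_anti/andP; split; apply: (modulus_le hphi); rewrite e1.
- exact: measurableT_comp.
- have ml n : measurable_fun setT (lin M (qlevels f n)) by exact: measurable_lin.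
  have := cvgPZ (-1) ml mY hY; apply: cvgP_ext => //.
  + by move=> n; apply: measurable_funM.
  + by move=> n; exact: measurable_lin.
  + exact: measurable_funM.
  + exact: measurableT_comp.
  + by move=> n; apply: aeW => w; rewrite lin_opp mulN1r.
  + by apply: aeW => w; rewrite mulN1r.
Qed.

Definition as_mfun f (mf : measurable_fun setT f) : {mfun X >-> R} := mfun_Sub (mem_set mf).

Lemma quantized_over phi (hphi : is_modulus phi) f (hf : modular_on phi f) n :
  simple_over D (quantized (as_mfun (mo_measurable hf)) n).
Proof.
move=> r r0; apply: (modular_on_level hphi hf (r := r)) => //.
by move=> x <-; have [] := quant_bound n (f x).
Qed.

Lemma pquantized_over phi (hphi : is_modulus phi) f (hf : modular_on phi f) n :
  (forall x, 0 <= f x) -> simple_over D (pquantized (as_mfun (mo_measurable hf)) n).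
Proof.
move=> f0 r r0; apply: (modular_on_level hphi hf (r := r)) => //.
by move=> x <-; have [] := quant_bound n (f x); rewrite pquantE.
Qed.

Section second_order.
Variables (M : set X -> {RV P >-> R}) (kappa : R).
Hypothesis kappa0 : 0 <= kappa.
Let M' : set X -> T -> R := fun A => M A.
Hypothesis aM : fin_additive P D M'.
Hypothesis M2 : forall A, D A -> (\int[P]_w ((M A w) ^+ 2)%:E = kappa%:E * mu A)%E.

Let mM A : measurable_fun setT (M' A). Proof. exact: measurable_funP. Qed.
Let dM : dominated_by P mu sq D M'.
Proof. exact: (dominated_by_second_moment Dm Dfin D0 DI DD DU mM aM kappa0 M2). Qed.

Lemma L2_prob_integral f (I : {RV P >-> R}) : modular_on sq f ->
  is_L2_integral D mu M f I -> prob_integral P M' f I.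
Proof.
move=> hf [fn [Dfn fnf fnI]]; have If := modular_on_integrable sq_modulus hf.
have mSI n : measurable_fun setT (lin M' (levels (fn n))) by exact: measurable_lin.
apply: (prob_integral_approx sq_modulus Dm mM dM If (h := fun n => levels (fn n))).
- by move=> n; exact: levels_over.
- rewrite (_ : (fun n => _) = (fun n => \int[mu]_x ((fn n x - f x) ^+ 2)%:E)%E)//.
  by apply/funext => n; apply: eq_integral => x _; rewrite step_levels.
- exact: measurable_funP.
(* Chebyshev's inequality loses [e ^+ 2]; a mean square error of [e ^+ 3] leaves the bound [e] on
   the probability. *)
- move=> e e0; have e2 : 0 < e ^+ 3 by rewrite exprn_gt0.
  move/fine_cvgP : fnI => [fin /cvgrPdist_le/(_ _ e2)]; apply: filterS2 fin => n /= fin.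
  rewrite sub0r normrN => /(le_trans (ler_norm _)) h.
  have mD := measurable_dist e (mSI n) (measurable_funP I).
  have := @integral_ge_level _ _ _ P (fun w => (simple_integral M (fn n) w - I w) ^+ 2)
    [set w | e <= `|lin M' (levels (fn n)) w - I w|] (e ^+ 2).
  have mSq : measurable_fun setT (fun w => (simple_integral M (fn n) w - I w) ^+ 2).
    apply: measurable_funX; apply: measurable_funB => //.
    by have -> : simple_integral M (fn n) = lin M' (levels (fn n)) by apply/funext => w; exact: simple_integral_lin.
  move=> /(_ mSq mD (fun w => sqr_ge0 _) (sqr_ge0 _)).
  rewrite prE// -EFinM -(fineK fin) lee_fin => h'.
  have e22 : 0 < e ^+ 2 by rewrite exprn_gt0.
  rewrite -(ler_pM2l e22) -exprSr; apply: le_trans h; apply: h' => w /=.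
  by rewrite simple_integral_lin; apply: sqr_le_abs; exact: ltW.
Qed.

(** The limit in probability is already available. By Fatou's lemma along its almost surely
    convergent subsequence, it is also a mean square limit, without appeal to completeness of
    [L^2]. *)
Lemma L2_integral_exists f : modular_on sq f -> exists I, is_L2_integral D mu M f I.
Proof.
move=> hf; have If := modular_on_integrable sq_modulus hf.
have [Y [s [[mY hY] sn smono aeY]]] := prob_integral_exists sq_modulus Dm mM dM If.
have mf := mo_measurable hf.
pose I : {RV P >-> R} := mfun_Sub (mem_set mY).
pose fn n : {sfun X >-> R} := quantized (as_mfun (mo_measurable hf)) (s n).
have Dfn n : simple_over D (fn n) by exact: (quantized_over sq_modulus).
have a0 : modular mu sq (fun x => quant (s n) (f x) - f x) @[n --> \oo] --> 0%E.
  apply: (cvg_comp s (fun n => modular mu sq (fun x => quant n (f x) - f x)) _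
    (modular_quant sq_modulus mf (mo_finite hf))).
  by move=> A [N _ NA]; exists N => // n /= Nn; apply: NA; exact: leq_trans Nn (sn n).
(* The two lists represent the same step function but may list different heights. Their difference
   has modular 0, so as a constant sequence it tends to 0 in probability, that is, it vanishes
   almost surely. *)
have linE n : {ae P, forall w, simple_integral M (fn n) w = lin M' (qlevels f (s n)) w}.
  pose h (k : nat) := levels (fn n) ++ opp_list (qlevels f (s n)).
  have Dh k : in_D D (h k).
    by apply: in_D_cat; [exact: levels_over|apply: in_D_opp; exact: (pi_levels If)].
  have h0 : modular mu sq (step (h k)) @[k --> \oo] --> 0%E.
    rewrite (_ : (fun k => _) = fun=> 0%E); first exact: cvg_cst.
    apply/funext => k; apply: modular_eq0 => [|x]; first exact: sq_modulus.
    by rewrite /h step_cat step_opp step_levels step_qlevels subrr.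
  have := cvgP_unique (fun k => measurable_lin (h k) mM) (measurable_lin (h 0%N) mM)
    (@measurable_cst _ _ _ _ setT (0 : R)) (cvgP_cst P (lin M' (h 0%N)) : cvgP P (fun k => lin M' (h k)) _) (lin_cvg0 dM Dh h0).
  apply: filterS => w; rewrite lin_cat lin_opp simple_integral_lin => /eqP.
  by rewrite subr_eq0 => /eqP.
exists I, fn; split => //.
have mq n : measurable_fun setT (fun x => quant n (f x) - f x).
  by apply: measurable_funB => //; exact: measurableT_comp.
have ml n : measurable_fun setT (lin M' (qlevels f n)) by exact: measurable_lin.
(* The 4 is the constant of [modularD], which splits [qlevels f (s n)] minus [qlevels f (s m)]
   through [f]; the part depending on [m] disappears in the lower limit. *)
have key n : (\int[P]_w ((simple_integral M (fn n) w - I w) ^+ 2)%:E <=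
    (kappa * 4)%:E * modular mu sq (fun x => (quant (s n) (f x) - f x)%R))%E.
  pose G m w := ((lin M' (qlevels f (s n)) w - lin M' (qlevels f (s m)) w) ^+ 2)%:E.
  have mG m : measurable_fun setT (G m).
    by apply/measurable_EFinP; apply: measurable_funX; exact: measurable_funB.
  have -> : (\int[P]_w ((simple_integral M (fn n) w - I w) ^+ 2)%:E =
      \int[P]_w limn_einf (G ^~ w))%E.
    apply: ae_eq_integral => //.
    - apply/measurable_EFinP; apply: measurable_funX; apply: measurable_funB => //.
      by have -> : simple_integral M (fn n) = lin M' (levels (fn n)); [apply/funext => w; exact: simple_integral_lin|exact: measurable_lin].
    - rewrite (_ : (fun w => _) = (fun w => - limn_esup (-%E \o (G ^~ w)))%E); last first.
        by apply/funext => w; rewrite limn_esupN oppeK.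
      apply: measurableT_comp => //; apply: measurable_fun_limn_esup => m.
      exact: measurableT_comp.
    - apply: filterS2 (linE n) aeY => w -> hw _.
      have cG : G ^~ w @ \oo --> ((lin M' (qlevels f (s n)) w - I w) ^+ 2)%:E; last first.
        by rewrite is_cvg_limn_einfE ?(cvg_lim _ cG)//; apply/cvg_ex; eexists; exact: cG.
      apply: cvg_EFin; first by apply: nearW.
      apply: (@cvg_comp _ _ _ _ (fun x : R => x ^+ 2)); last exact: sqr_continuous.
      by apply: cvgB => //; exact: cvg_cst.
  apply: (le_trans (fatou _ _ mG _)) => //.
    by move=> m w _; rewrite lee_fin sqr_ge0.
  apply: (@limn_einf_le_cvg _ _ (fun m => (kappa * 4)%:E *
     (modular mu sq (fun x => (quant (s n) (f x) - f x)%R) +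
      modular mu sq (fun x => (quant (s m) (f x) - f x)%R)))%E).
    move=> m; have Dnm : in_D D (qlevels f (s n) ++ opp_list (qlevels f (s m))).
      by apply: in_D_cat; [|apply: in_D_opp]; exact: (pi_levels If).
    have -> : (\int[P]_w G m w = \int[P]_w ((lin M' (qlevels f (s n) ++ opp_list (qlevels f (s m))) w) ^+ 2)%:E)%E.
      by apply: eq_integral => w _; rewrite lin_cat lin_opp.
    rewrite (second_moment_lin Dm Dfin D0 DI DD DU mM aM M2 Dnm).
    rewrite EFinM -muleA; apply: lee_wpmul2l => //.
    have := @modularD _ _ _ mu _ sq_modulus (fun x => quant (s n) (f x) - f x) (fun x => f x - quant (s m) (f x)).
    rewrite (_ : modular _ _ (fun x => f x - _) = modular mu sq (fun x => quant (s m) (f x) - f x)); last first.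
      by apply: eq_integral => x _; rewrite /sq -sqrrN opprB.
    rewrite (_ : modular _ _ (fun x => _ + _) = modular mu (fun x => x ^+ 2) (step (qlevels f (s n) ++ opp_list (qlevels f (s m))))); last first.
      by apply: eq_integral => x _; rewrite /sq step_cat step_opp !step_qlevels addrA subrK.
    by apply; [exact: mq|apply: measurable_funB => //; exact: measurableT_comp].
  rewrite -[X in _ --> (_ * X)%E]adde0; apply: cvgeZl => //.
  apply: cvgeD; [|exact: cvg_cst|exact: a0].
  by rewrite fin_num_adde_defl.
have lim0 : ((kappa * 4)%:E * modular mu sq (fun x => (quant (s n) (f x) - f x)%R))%E @[n --> \oo] --> 0%E.
  by rewrite -(mule0 (kappa * 4)%:E); apply: cvgeZl.
apply: (@squeeze_cvge _ _ _ _ (fun=> 0%E) _ _ _ _ _ lim0) => //; last exact: cvg_cst.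
near=> n; apply/andP; split; last exact: key.
by apply: integral_ge0 => w _; rewrite lee_fin sqr_ge0.
Unshelve. all: by end_near. Qed.

End second_order.

Section first_order.
Variable M : set X -> {RV P >-> R}.
Let M' : set X -> T -> R := fun A => M A.
Let mM A : measurable_fun setT (M' A). Proof. exact: measurable_funP. Qed.
Hypothesis dM : dominated_by P mu cut D M'.

(** Approximations increasing to [f] satisfy [0 <= f - fn n <= f], so they converge in modular by
    domination and any admissible sequence leads to the same limit. *)
Lemma poisson_nonneg_prob_integral f (I : {RV P >-> R}) : modular_on cut f ->
  (forall x, 0 <= f x) ->
  is_poisson_integral_nonneg D M f I -> prob_integral P M' f I.
Proof.
move=> hf f0 [fn [Dfn nd fnf fnI]]; have If := modular_on_integrable cut_modulus hf.
have mSI n : measurable_fun setT (lin M' (levels (fn n))) by exact: measurable_lin.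
apply: (prob_integral_approx cut_modulus Dm mM dM If (h := fun n => levels (fn n))).
- by move=> n; exact: levels_over.
- under eq_fun do under eq_fun do rewrite step_levels.
  apply: (modular_cvg0 cut_modulus _ (mo_measurable hf) (mo_finite hf)).
  + by move=> n; apply: measurable_funB => //; exact: (mo_measurable hf).
  + move=> n x; have h1 : 0 <= fn n x by exact: fun_ge0.
    have h2 : fn n x <= f x.
      rewrite -(cvg_lim _ (fnf x))//; apply: nondecreasing_cvgn_le => //.
      by apply/cvg_ex; exists (f x); exact: fnf.
    by rewrite (ger0_norm (f0 x)) ler0_norm ?subr_le0// opprB lerBlDr lerDl.
  + move=> x; rewrite -[X in _ --> X](subrr (f x)).
    apply: (@cvgB _ R^o); [exact: fnf|exact: cvg_cst].
- exact: measurable_funP.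
- apply: ae_cvgP => //.
  by apply: filterS fnI => w; under eq_fun do rewrite simple_integral_lin.
Qed.

(** On nonnegative values the quantizer is its positive part, which increases with [n]; a
    nondecreasing subsequence keeps this. *)
Lemma poisson_integral_nonneg_exists f : modular_on cut f -> (forall x, 0 <= f x) ->
  exists I, is_poisson_integral_nonneg D M f I.
Proof.
move=> hf f0; have If := modular_on_integrable cut_modulus hf.
have [Y [s [[mY hY] sn smono aeY]]] := prob_integral_exists cut_modulus Dm mM dM If.
pose I : {RV P >-> R} := mfun_Sub (mem_set mY).
pose fn n : {nnsfun X >-> R} := pquantized (as_mfun (mo_measurable hf)) (s n).
have Dfn n : simple_over D (fn n) by exact: (pquantized_over cut_modulus).
exists I, fn; split => //.
- by move=> x m n mn; apply: pquant_nd; exact: smono.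
- move=> x; rewrite -[X in _ --> X](@max_l _ _ (f x) 0)//.
  apply: (cvg_comp s (fun n => pquant n (f x)) _ (pquant_cvg (x := f x))).
  by move=> A [N _ NA]; exists N => // n /= Nn; apply: NA; exact: leq_trans Nn (sn n).
- have linE n : {ae P, forall w, simple_integral M (fn n) w = lin M' (qlevels f (s n)) w}.
    pose h (k : nat) := levels (fn n) ++ opp_list (qlevels f (s n)).
    have Dh k : in_D D (h k).
      by apply: in_D_cat; [exact: levels_over|apply: in_D_opp; exact: (pi_levels If)].
    have h0 : modular mu cut (step (h k)) @[k --> \oo] --> 0%E.
      rewrite (_ : (fun k => _) = fun=> 0%E); first exact: cvg_cst.
      apply/funext => k; apply: modular_eq0 => [|x]; first exact: cut_modulus.
      by rewrite /h step_cat step_opp step_levels step_qlevels pquantE// subrr.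
    have := cvgP_unique (fun k => measurable_lin (h k) mM) (measurable_lin (h 0%N) mM)
      (@measurable_cst _ _ _ _ setT (0 : R)) (cvgP_cst P (lin M' (h 0%N)) : cvgP P (fun k => lin M' (h k)) _) (lin_cvg0 dM Dh h0).
    apply: filterS => w; rewrite lin_cat lin_opp simple_integral_lin => /eqP.
    by rewrite subr_eq0 => /eqP.
  have := ae_foralln linE.
  move=> h; apply: filterS2 h aeY => w hw.
  by under eq_fun do rewrite -hw.
Qed.

Lemma poisson_prob_integral f (I : {RV P >-> R}) : modular_on cut f ->
  is_poisson_integral D M f I -> prob_integral P M' f I.
Proof.
move=> hf [Ip [Im [hp hm Iae]]]; have mf := mo_measurable hf.
have hfp : modular_on cut f^\+.
  apply: (modular_on_le cut_modulus hf); first exact: measurable_funrpos.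
  by move=> x; rewrite /funrpos; case: (leP (f x) 0) => h; rewrite ?normr0.
have hfm : modular_on cut f^\-.
  apply: (modular_on_le cut_modulus hf); first exact: measurable_funrneg.
  by move=> x; rewrite /funrneg; case: (leP (- f x) 0) => h; rewrite ?normr0// normrN.
have hfm' : modular_on cut (fun x => - f^\- x).
  by apply: (modular_on_le cut_modulus hfm) => [|x]; [exact: measurableT_comp (measurable_funrneg mf)|rewrite normrN].
have pp := poisson_nonneg_prob_integral hfp (@funrpos_ge0 _ _ f) hp.
have pm := poisson_nonneg_prob_integral hfm (@funrneg_ge0 _ _ f) hm.
have pm' := prob_integralN cut_modulus mM dM hfm pm.
have := prob_integralD cut_modulus Dm mM dM (modular_on_integrable cut_modulus hfp)
  (modular_on_integrable cut_modulus hfm') (modular_on_integrable cut_modulus hf) _ pp pm'.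
move=> h; apply: prob_integral_ae (h _) => //.
- by apply: filterS Iae => w ->.
- by move=> x; have := funrposBneg f; move=> /(congr1 (fun h => h x)) <-.
Qed.

Lemma poisson_integral_exists f : modular_on cut f -> exists I, is_poisson_integral D M f I.
Proof.
move=> hf; have mf := mo_measurable hf.
have hfp : modular_on cut f^\+.
  apply: (modular_on_le cut_modulus hf); first exact: measurable_funrpos.
  by move=> x; rewrite /funrpos; case: (leP (f x) 0) => h; rewrite ?normr0.
have hfm : modular_on cut f^\-.
  apply: (modular_on_le cut_modulus hf); first exact: measurable_funrneg.
  by move=> x; rewrite /funrneg; case: (leP (- f x) 0) => h; rewrite ?normr0// normrN.
have [Ip hp] := poisson_integral_nonneg_exists hfp (@funrpos_ge0 _ _ f).
have [Im hm] := poisson_integral_nonneg_exists hfm (@funrneg_ge0 _ _ f).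
exists (Ip \- Im : {mfun T >-> R}), Ip, Im; split => //.
exact: aeW.
Qed.

End first_order.

End defs_integrals.

Section integrals_wrt_gaussian.
Context {R : realType} {dT} {T : measurableType dT} {P : probability T R}.
Context {dX} {X : measurableType dX} (mu : {measure set X -> \bar R}).
Variable D : set (set X).
Hypothesis Dm : D `<=` measurable.
Hypothesis D0 : D set0.
Hypothesis DI : setI_closed D.
Hypothesis DD : forall A B, D A -> D B -> D (A `\` B).
Hypothesis DU : forall A B, D A -> D B -> D (A `|` B).
Variable S : set X.
Hypothesis hS : forall A, measurable A -> A `<=` S -> (mu A < +oo)%E -> D A.
Variable W : set X -> {RV P >-> R}.
Hypothesis aW : fin_additive P D (fun A => W A : T -> R).
Hypothesis lawW : forall A, D A -> exists2 v : R, mu A = v%:E & centred_gaussian P v (W A).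

Let Dfin A : D A -> (mu A < +oo)%E.
Proof. by move=> /lawW[v ->]; rewrite ltry. Qed.

Let M2 A : D A -> (\int[P]_w ((W A w) ^+ 2)%:E = (@gauss_moment2 R)%:E * mu A)%E.
Proof.
move=> /lawW[v -> hv]; rewrite -EFinM; apply: gaussian_second_moment => //.
Qed.

Let k0 : 0 <= @gauss_moment2 R.
Proof.
by rewrite fine_ge0//; apply: integral_ge0 => x _; rewrite lee_fin mulr_ge0 ?sqr_ge0 ?normal_pdf_ge0.
Qed.

Lemma gaussian_dominated : dominated_by P mu sq D (fun A => W A : T -> R).
Proof. exact: (dominated_by_second_moment Dm Dfin D0 DI DD DU _ aW k0 M2). Qed.

(** Existence shows that the value chosen by [xget] satisfies the specification and is not the
    default; from here on only its description as a limit in probability is used. *)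
Lemma wiener_prob_integral f : modular_on mu S sq f ->
  prob_integral P (fun A => W A : T -> R) f (wiener_integral D mu W f).
Proof.
move=> hf; apply: (L2_prob_integral Dm Dfin D0 DI DD DU hS k0 aW M2 hf).
apply: (@xgetPex {mfun T >-> R} (cst 0) ([set I | is_L2_integral D mu W f I])).
exact: (L2_integral_exists Dm Dfin D0 DI DD DU hS k0 aW M2 hf).
Qed.

End integrals_wrt_gaussian.

Section integrals_wrt_poisson.
Context {R : realType} {dT} {T : measurableType dT} {P : probability T R}.
Context {dX} {X : measurableType dX} (mu : {measure set X -> \bar R}).
Variable D : set (set X).
Hypothesis Dm : D `<=` measurable.
Hypothesis D0 : D set0.
Hypothesis DI : setI_closed D.
Hypothesis DD : forall A B, D A -> D B -> D (A `\` B).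
Hypothesis DU : forall A B, D A -> D B -> D (A `|` B).
Variable S : set X.
Hypothesis hS : forall A, measurable A -> A `<=` S -> (mu A < +oo)%E -> D A.
Variable N : set X -> {RV P >-> R}.
Let N' : set X -> T -> R := fun A => N A.
Hypothesis aN : fin_additive P D N'.
Hypothesis lawN : forall A, D A -> exists2 l : R, mu A = l%:E & poisson_law P l (N A).

Let Dfin A : D A -> (mu A < +oo)%E.
Proof. by move=> /lawN[v ->]; rewrite ltry. Qed.

Let mN A : measurable_fun setT (N' A). Proof. exact: measurable_funP. Qed.

Let C' : set X -> T -> R := fun A => compensated mu N A.

Let mC A : measurable_fun setT (C' A).
Proof. exact: (measurable_funP (compensated mu N A)). Qed.

Lemma poisson_dominated : dominated_by P mu cut D N'.
Proof.
apply: (dominated_by_first_moment Dm Dfin D0 DI DD mN aN) => A DA.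
  have [l Al hl] := lawN DA.
  by rewrite /weight Al /= (poisson_law_mean (mN A) hl).
have [l Al hl] := lawN DA; rewrite /weight Al /= -lee_fin.
have -> : [set w | N' A w != 0] = N' A @^-1` [set~ 0].
  by apply/seteqP; split => w /= /eqP.
rewrite -prE; first exact: (poisson_law_neq0 (mN A) hl).
by rewrite -[X in measurable X]setTI; apply: mN => //; apply: measurableC.
Qed.

Lemma poisson_integral_prob_integral f : modular_on mu S cut f ->
  prob_integral P N' f (poisson_integral D N f).
Proof.
move=> hf; apply: (poisson_prob_integral Dm hS poisson_dominated hf).
apply: (@xgetPex {mfun T >-> R} (cst 0) ([set I | is_poisson_integral D N f I])).
exact: (poisson_integral_exists Dm hS poisson_dominated hf).
Qed.

Lemma compensated_fin_additive : fin_additive P D C'.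
Proof.
move=> J A DA tA DU'; apply: filterS (aN DA tA DU') => w /= e.
have mA j : measurable (A j) by apply: Dm.
rewrite /C' /compensated /=.
have -> : fine (mu (\bigcup_j A j)) = \sum_j fine (mu (A j)).
  transitivity (fine (\sum_(j \in [set: J]) (fine (mu (A j)))%:E)%E).
    rewrite (measure_fin_bigcup mu finite_finset tA)//; congr fine; apply: eq_fsbigr => j _.
    by rewrite fineK// ge0_fin_numE// Dfin.
  rewrite fsumEFin//= (fsbigE (index_enum J)) ?index_enum_uniq//; last first.
    by move=> j _; rewrite mem_index_enum.
  by apply: eq_bigl => j; rewrite in_setT.
by rewrite [N _ w]e sumrB.
Qed.

Lemma compensated_second_moment A : D A ->
  (\int[P]_w ((C' A w) ^+ 2)%:E = 1 * mu A)%E.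
Proof.
move=> DA; have [l Al hl] := lawN DA.
rewrite mul1e Al -(poisson_law_variance (mN A) hl).
by apply: eq_integral => w _; rewrite /C' /compensated /= Al.
Qed.

Lemma compensated_first_moment A : D A ->
  (\int[P]_w `|C' A w|%:E <= (2 * weight mu A)%:E)%E.
Proof.
move=> DA; have [l Al hl] := lawN DA; have [l0 _] := hl.
apply: (@le_trans _ _ (\int[P]_w (`|N' A w|%:E + l%:E))%E).
  apply: ge0_le_integral => //.
  - apply/measurable_EFinP; exact: measurableT_comp.
  - by apply: emeasurable_funD => //; apply/measurable_EFinP; exact: measurableT_comp.
  - move=> w _; rewrite -EFinD lee_fin /C' /compensated /= Al /=.
    by apply: (le_trans (ler_normB _ _)); rewrite (ger0_norm l0).
rewrite ge0_integralD//; last first.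
  by apply/measurable_EFinP; exact: measurableT_comp.
rewrite (poisson_law_mean (mN A) hl) integral_cst// [X in (_ * X)%E]probability_setT mule1.
rewrite /weight Al /= -EFinD.
by rewrite lee_fin; lra.
Qed.

Lemma compensated_dominated : dominated_by P mu mix D C'.
Proof.
exact: (dominated_by_mixed_moment Dm Dfin D0 DI DD DU mC compensated_fin_additive
  (ler0n _ 2) compensated_second_moment compensated_first_moment).
Qed.

Section small_and_large_values.
Variable f : X -> R.
Hypothesis hf : modular_on mu S mix f.

(** The splitting made by the definition of the compensated integral. The minimum in [mix] is the
    square on the values of [f1] and the absolute value on those of [f2]; the latter dominates [cut]
    and makes [f2] integrable for the intensity, so each part is admissible for its own integral. *)
Let f1 (x : X) : R := if `|f x| <= 1 then f x else 0.
Let f2 (x : X) : R := if `|f x| <= 1 then 0 else f x.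

Let mle : measurable_fun setT (fun x => `|f x| <= 1).
Proof. by apply: measurable_fun_ler => //; apply: measurableT_comp => //; exact: mo_measurable hf. Qed.

Let mf1 : measurable_fun setT f1.
Proof. by apply: measurable_fun_ifT => //; exact: mo_measurable hf. Qed.

Let mf2 : measurable_fun setT f2.
Proof. by apply: measurable_fun_ifT => //; exact: mo_measurable hf. Qed.

Let f1f x : `|f1 x| <= `|f x|.
Proof. by rewrite /f1; case: ifP => //; rewrite normr0. Qed.

Let f2f x : `|f2 x| <= `|f x|.
Proof. by rewrite /f2; case: ifP => //; rewrite normr0. Qed.

Let hf1 : modular_on mu S mix f1. Proof. exact: (modular_on_le mix_modulus hf). Qed.
Let hf2 : modular_on mu S mix f2. Proof. exact: (modular_on_le mix_modulus hf). Qed.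

Let sq_f1 : modular_on mu S sq f1.
Proof.
have [m foo s] := hf1; split => //.
rewrite (_ : modular mu sq f1 = modular mu mix f1)//.
apply: eq_integral => x _; congr EFin; rewrite /sq /mix min_l// /f1.
case: ifP => [h|_]; last by rewrite expr0n normr0.
by rewrite -(real_normK (num_real (f x))) expr2 ler_piMr.
Qed.

Let cut_f2 : modular_on mu S cut f2.
Proof.
have [m foo s] := hf2; split => //; apply: le_lt_trans foo.
apply: ge0_le_integral => //.
- by move=> x _; rewrite lee_fin (modulus_ge0 cut_modulus).
- exact: (measurable_modulus_comp cut_modulus).
- exact: (measurable_modulus_comp mix_modulus).
move=> x _; rewrite lee_fin /cut /mix /f2.
case: (leP `|f x| 1) => [_|h]; first by rewrite expr0n normr0 !min_l.
rewrite -(real_normK (num_real (f x))) (min_r (ltW h)) le_min (ltW h) andbT.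
by rewrite expr2 -[1]mulr1 ler_pM// ltW.
Qed.

Let int_f2 : mu.-integrable setT (fun x => (f2 x)%:E).
Proof.
apply/integrableP; split; first exact/measurable_EFinP.
have [_ foo _] := hf2; rewrite (_ : integral _ _ _ = modular mu mix f2)//.
apply: eq_integral => x _; rewrite abse_EFin; congr EFin; rewrite /mix min_r// /f2.
case: (leP `|f x| 1) => [_|h]; first by rewrite expr0n normr0.
by rewrite -(real_normK (num_real (f x))) expr2 ler_peMr// ltW.
Qed.

Let large : \int[mu]_(x in [set x | 1 < `|f x|]) f x = \int[mu]_x f2 x.
Proof.
rewrite /Rintegral; congr fine; rewrite integral_mkcond; apply: eq_integral => x _.
rewrite patchE /f2; case: (leP `|f x| 1) => h.
  by rewrite memNset//= ltNge h.
by rewrite mem_set.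
Qed.

Let lin_comp l w : in_D D l -> lin C' l w = lin N' l w - \int[mu]_x step l x.
Proof.
move=> Dl; have [_ ->] := integral_step Dm Dfin Dl.
by rewrite /lin -sumrB; apply: eq_bigr => p _; rewrite /C' /compensated /= mulrBr.
Qed.

Let If2 := modular_on_integrable hS mix_modulus hf2.

Let mean_cvg : \int[mu]_x step (qlevels f2 n) x @[n --> \oo] --> \int[mu]_x f2 x.
Proof.
apply: fine_cvg; rewrite fineK; last exact: integrable_fin_num.
under eq_fun do under eq_integral do rewrite step_qlevels.
apply: (@dominated_cvg _ _ _ mu setT measurableT _ _ (fun x => `|f2 x|%:E)) => //.
- by move=> n; apply/measurable_EFinP; exact: measurableT_comp.
- by move=> x _; apply: cvg_EFin; [exact: nearW|exact: quant_cvg].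
- exact: (integrable_abse int_f2).
- by move=> n x _; rewrite abse_EFin lee_fin; have [] := quant_bound n (f2 x).
Qed.

(** Compensated sums differ from Poisson sums by the integral of the step function, which converges
    to the integral of [f2] by domination. *)
Let prob_f2 (I2 : {RV P >-> R}) : is_poisson_integral D N f2 I2 ->
  prob_integral P C' f2 (fun w => I2 w - \int[mu]_x f2 x).
Proof.
move=> /(poisson_prob_integral Dm hS poisson_dominated cut_f2)[mI2 cI2].
split; first exact: measurable_funB.
have ml n : measurable_fun setT (lin N' (qlevels f2 n)) by exact: measurable_lin.
have cc : cvgP P (fun n _ => - \int[mu]_x step (qlevels f2 n) x) (fun=> - \int[mu]_x f2 x).
  apply: ae_cvgP => //; apply: aeW => w; exact: cvgN mean_cvg.
have := cvgPD ml (fun n => measurable_cst _) mI2 (measurable_cst _) cI2 cc.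
apply: cvgP_ext => //.
- by move=> n; exact: measurable_funD.
- by move=> n; exact: measurable_lin.
- exact: measurable_funD.
- exact: measurable_funB.
- by move=> n; apply: aeW => w; rewrite lin_comp//; exact: (pi_levels If2 (n := n)).
- exact: aeW.
Qed.

Lemma compensated_prob_integral (I : {RV P >-> R}) :
  is_compensated_integral D mu N f I -> prob_integral P C' f I.
Proof.
move=> [I1 [I2 [h1 h2 h]]].
have p1 : prob_integral P C' f1 I1.
  exact: (L2_prob_integral Dm Dfin D0 DI DD DU hS ler01 compensated_fin_additive
    compensated_second_moment sq_f1 h1).
have p2 := prob_f2 h2.
have := prob_integralD mix_modulus Dm mC compensated_dominated
  (modular_on_integrable hS mix_modulus hf1) If2 (modular_on_integrable hS mix_modulus hf)
  _ p1 p2.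
move=> hh; apply: (prob_integral_ae mC _ _ (hh _)) => //.
- by apply: filterS h => w ->; rewrite large addrA.
- by move=> x; rewrite /f1 /f2; case: ifP; rewrite ?addr0 ?add0r.
Qed.

Lemma compensated_integral_exists : exists I, is_compensated_integral D mu N f I.
Proof.
have [I1 h1] := L2_integral_exists Dm Dfin D0 DI DD DU hS ler01 compensated_fin_additive
    compensated_second_moment sq_f1.
have [I2 h2] := poisson_integral_exists Dm hS poisson_dominated cut_f2.
exists (I1 \+ I2 \- cst (\int[mu]_(x in [set x | 1 < `|f x|]) f x) : {mfun T >-> R}), I1, I2.
by split => //; exact: aeW.
Qed.

Lemma compensated_integral_prob_integral :
  prob_integral P C' f (compensated_integral D mu N f).
Proof.
apply: compensated_prob_integral.
exact: (@xgetPex {mfun T >-> R} (cst 0) [set I | is_compensated_integral D mu N f I] compensated_integral_exists).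
Qed.

End small_and_large_values.

End integrals_wrt_poisson.

(** * Gaussian and Poisson noise as one scattered family *)

Lemma trivIset_preimage {X Y : Type} {J : eqType} (g : Y -> X) (C : J -> set X) :
  trivIset setT C -> trivIset setT (fun j => g @^-1` C j).
Proof.
move=> tC; apply/trivIsetP => i k _ _ ik.
by rewrite -preimage_setI (iffLR trivIsetP tC i k Logic.I Logic.I ik) preimage_set0.
Qed.

Lemma measurable_forall {R : realType} {dT} {T : measurableType dT} (J : finType)
    (F : J -> T -> R) (S : J -> set R) :
  (forall j, measurable_fun setT (F j)) -> (forall j, measurable (S j)) ->
  measurable [set w | forall j, S j (F j w)].
Proof.
move=> mF mS; rewrite (_ : [set w | _] = \bigcap_j (F j @^-1` S j)); last first.
  by apply/seteqP; split => w /= h j; [move=> _|]; exact: h.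
apply: fin_bigcap_measurable => [|j _]; first exact: finite_finset.
by rewrite -[X in measurable X]setTI; apply: mF.
Qed.

Section scattered_families.
Context {R : realType} {dT} {T : measurableType dT} {P : probability T R}.
Context {dX} {X : measurableType dX} (D : set (set X)).
Hypothesis D0 : D set0.
Variable M : set X -> {RV P >-> R}.
Hypothesis hM : independently_scattered D M.
Let M' : set X -> T -> R := fun A => M A.

(** A finite family as a sequence that is empty from [#|J|] on, because random measures are
    specified on sequences. *)
Let ranked (J : finType) (C : J -> set X) (k : nat) : set X :=
  [set x | exists2 j, k = enum_rank j & C j x].

Let rankedE (J : finType) (C : J -> set X) j : ranked C (enum_rank j) = C j.
Proof.
apply/seteqP; split => x /=; last by exists j.
by move=> [i /val_inj/enum_rank_inj ->].
Qed.

Let ranked0 (J : finType) (C : J -> set X) k : (#|J| <= k)%N -> ranked C k = set0.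
Proof.
move=> Jk; apply/seteqP; split => x //= [j kj _].
by move: (ltn_ord (enum_rank j)); rewrite -kj ltnNge Jk.
Qed.

Let ranked_rect (J : finType) (C : J -> set X) (Q : set X -> Prop) :
  Q set0 -> (forall j, Q (C j)) -> forall k, Q (ranked C k).
Proof.
move=> Q0 QC k; have [Jk|kJ] := leqP #|J| k; first by rewrite ranked0.
by rewrite -[k]/(nat_of_ord (Ordinal kJ)) -(enum_valK (Ordinal kJ)) rankedE.
Qed.

Let ranked_trivIset (J : finType) (C : J -> set X) :
  trivIset setT C -> trivIset setT (ranked C).
Proof.
move=> tC; apply/trivIsetP => i k _ _ ik; apply/seteqP; split => x //= [[j ij Cx] [j' kj Cx']].
have jj' : j != j' by apply: contra ik => /eqP jj'; rewrite ij kj jj'.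
have /seteqP[/(_ x) + _] := iffLR trivIsetP tC j j' Logic.I Logic.I jj'; exact.
Qed.

Let ranked_bigcup (J : finType) (C : J -> set X) : \bigcup_k ranked C k = \bigcup_j C j.
Proof.
apply/seteqP; split => x /= [i _] => [[j _ Cx]|Cx]; first by exists j.
by exists (enum_rank i) => //; exists i.
Qed.

(** For the sequence of empty sets the partial sums are the multiples [n * x] of [x = M set0 w];
    they converge, so their constant increment [x] tends to 0. *)
Let scattered0 : {ae P, forall w, M' set0 w = 0}.
Proof.
have t0 : trivIset setT (fun _ : nat => set0 : set X).
  by apply/trivIsetP => i j _ _ _; rewrite setI0.
have E : \bigcup_(j in [set: nat]) (set0 : set X) = set0 by rewrite bigcup0.
have [_ h] := hM (fun=> D0) t0.
rewrite E in h; apply: filterS (h D0) => w hw; rewrite /M'; set x : R := M set0 w in hw *.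
have hw1 : \sum_(k < n.+1) x @[n --> \oo] --> x by move: hw; rewrite -cvg_shiftS.
have : (\sum_(k < n.+1) x - \sum_(k < n) x) @[n --> \oo] --> x - x by exact: (@cvgB _ R^o).
rewrite subrr (_ : (fun n => _) = fun=> x); last first.
  by apply/funext => n; rewrite big_ord_recr /= addrAC subrr add0r.
by move=> /cvg_lim; rewrite lim_cst//; apply.
Qed.

Lemma scattered_fin_additive : fin_additive P D M'.
Proof.
move=> J C DC tC DU; have [_] := hM (ranked_rect D0 DC) (ranked_trivIset tC).
rewrite ranked_bigcup => /(_ DU); apply: filterS2 scattered0 => w w0 hw.
rewrite /M' -(cvg_lim _ hw)//; apply: lim_near_cst => //.
exists #|J| => // n /= Jn.
rewrite -(big_mkord xpredT (fun k => M (ranked C k) w)) (big_cat_nat (n := #|J|))//=.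
rewrite [X in _ + X]big_nat [X in _ + X]big1 ?addr0; last first.
  by move=> k /andP[Jk _]; rewrite ranked0.
rewrite big_mkord (reindex (@enum_rank J))/=; last first.
  by apply: onW_bij; exact: enum_rank_bij.
by apply: eq_bigr => j _; rewrite rankedE.
Qed.

Lemma scattered_fin_independent : fin_independent P D M'.
Proof.
move=> J C DC tC S mS; have [iM _] := hM (ranked_rect D0 DC) (ranked_trivIset tC).
pose S' (k : nat) : set R := [set x | forall j, k = enum_rank j -> S j x].
have S'E j : S' (enum_rank j) = S j.
  apply/seteqP; split => x /=; first exact.
  by move=> Sx i /val_inj/enum_rank_inj <-.
have mS' k : measurable (S' k).
  have [Jk|kJ] := leqP #|J| k.
    rewrite (_ : S' k = setT)//; apply/seteqP; split => x //= _ j kj.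
    by move: (ltn_ord (enum_rank j)); rewrite -kj ltnNge Jk.
  by rewrite -[k]/(nat_of_ord (Ordinal kJ)) -(enum_valK (Ordinal kJ)) S'E.
have := iM [fset k in iota 0 #|J|]%fset S' mS'.
rewrite (perm_big (iota 0 #|J|))/=; last first.
  by apply: uniq_perm; rewrite ?fset_uniq ?iota_uniq// => k; rewrite !inE.
rewrite [X in _ = X](_ : _ = \prod_(i < #|J|) fine (P (M (ranked C i) @^-1` S' i))); last first.
  by rewrite -(big_mkord xpredT (fun i => fine (P (M (ranked C i) @^-1` S' i)))) /index_iota subn0.
rewrite (reindex (@enum_rank J))/=; last first.
  by apply: onW_bij; exact: enum_rank_bij.
under eq_bigr do rewrite rankedE S'E.
move=> <-; congr (fine (P _)); apply/seteqP; split => w /= h.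
  move=> k _ /= j kj; rewrite kj rankedE; exact: h.
move=> j; have := h (enum_rank j); rewrite rankedE S'E; apply.
by rewrite /= !inE mem_iota /= add0n ltn_ord.
Qed.

End scattered_families.

(** * Two independent families on the disjoint union of their spaces *)

Section two_random_measures.
Context {R : realType} {dT} {T : measurableType dT} (P : probability T R).
Context {X1 X2 : Type} (D1 : set (set X1)) (D2 : set (set X2)).
Hypotheses (D10 : D1 set0) (D20 : D2 set0) (D1I : setI_closed D1) (D2I : setI_closed D2).
Hypothesis D1D : forall A B, D1 A -> D1 B -> D1 (A `\` B).
Hypothesis D2D : forall A B, D2 A -> D2 B -> D2 (A `\` B).

(** Sets lying on one side only. The law of [joint] on such a set is that of one of the two
    families, so no convolution of a Gaussian and a Poisson law occurs. The class is not stable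
    under unions, but cutting into atoms takes only intersections and differences. *)
Definition pure : set (set (X1 + X2)) :=
  [set C | (D1 (inl @^-1` C) /\ inr @^-1` C = set0) \/
           (inl @^-1` C = set0 /\ D2 (inr @^-1` C))].

Lemma pure0 : pure set0. Proof. by left; rewrite !preimage_set0. Qed.

Lemma pureI : setI_closed pure.
Proof.
move=> A B; rewrite /pure /= !preimage_setI.
move=> [[A1 A2]|[A1 A2]] [[B1 B2]|[B1 B2]].
- by left; split; [exact: D1I|rewrite A2 set0I].
- by left; rewrite A2 B1 setI0 set0I.
- by left; rewrite A1 B2 setI0 set0I.
- by right; split; [rewrite A1 set0I|exact: D2I].
Qed.

Lemma pureD A B : pure A -> pure B -> pure (A `\` B).
Proof.
rewrite /pure /= -![_ @^-1` (A `\` B)]/(_ @^-1` A `\` _ @^-1` B).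
move=> [[A1 A2]|[A1 A2]] [[B1 B2]|[B1 B2]].
- by left; split; [exact: D1D|rewrite A2 set0D].
- by left; rewrite A2 B1 setD0 set0D.
- by right; rewrite A1 B2 setD0 set0D.
- by right; split; [rewrite A1 set0D|exact: D2D].
Qed.

Let pure1 C : pure C -> D1 (inl @^-1` C).
Proof. by move=> [[]|[-> _]]. Qed.

Let pure2 C : pure C -> D2 (inr @^-1` C).
Proof. by move=> [[_ ->]|[]]. Qed.

Definition left_set (A : set X1) : set (X1 + X2) := inl @` A.

Definition right_set (A : set X2) : set (X1 + X2) := inr @` A.

Lemma preimage_left_set A : (inl @^-1` left_set A = A) * (inr @^-1` left_set A = set0).
Proof.
split; apply/seteqP; split => x //=; [by move=> [y Ay [<-]]|by move=> Ax; exists x|by move=> []].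
Qed.

Lemma preimage_right_set A : (inl @^-1` right_set A = set0) * (inr @^-1` right_set A = A).
Proof.
split; apply/seteqP; split => x //=; [by move=> []|by move=> [y Ay [<-]]|by move=> Ax; exists x].
Qed.

Lemma pure_inl A : D1 A -> pure (left_set A).
Proof. by move=> DA; left; rewrite !preimage_left_set. Qed.

Lemma pure_inr A : D2 A -> pure (right_set A).
Proof. by move=> DA; right; rewrite !preimage_right_set. Qed.

Definition joint (W : set X1 -> T -> R) (N : set X2 -> T -> R) (C : set (X1 + X2)) (w : T) : R :=
  W (inl @^-1` C) w + N (inr @^-1` C) w.

Definition cross_independent (W : set X1 -> T -> R) (N : set X2 -> T -> R) : Prop :=
  forall (J : finType) (A : J -> set X1) (E : J -> set X2) (S S' : J -> set R),
    (forall j, D1 (A j)) -> (forall j, D2 (E j)) ->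
    (forall j, measurable (S j)) -> (forall j, measurable (S' j)) ->
    pr P ([set w | forall j, S j (W (A j) w)] `&` [set w | forall j, S' j (N (E j) w)]) =
    pr P [set w | forall j, S j (W (A j) w)] * pr P [set w | forall j, S' j (N (E j) w)].

Section joint_measure.
Variables (W : set X1 -> T -> R) (N : set X2 -> T -> R).
Hypotheses (mW : forall A, measurable_fun setT (W A)) (mN : forall A, measurable_fun setT (N A)).
Hypotheses (aW : fin_additive P D1 W) (aN : fin_additive P D2 N).
Hypotheses (iW : fin_independent P D1 W) (iN : fin_independent P D2 N).
Hypothesis iWN : cross_independent W N.

Lemma measurable_joint C : measurable_fun setT (joint W N C).
Proof. exact: measurable_funD. Qed.

Lemma joint_fin_additive : fin_additive P pure (joint W N).
Proof.
move=> J C DC tC DU.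
have E1 : \bigcup_j (inl @^-1` C j) = inl @^-1` (\bigcup_j C j) by rewrite preimage_bigcup.
have E2 : \bigcup_j (inr @^-1` C j) = inr @^-1` (\bigcup_j C j) by rewrite preimage_bigcup.
have h1 := aW (fun j => pure1 (DC j)) (trivIset_preimage tC).
have h2 := aN (fun j => pure2 (DC j)) (trivIset_preimage tC).
rewrite E1 in h1; rewrite E2 in h2.
apply: filterS2 (h1 (pure1 DU)) (h2 (pure2 DU)) => w e1 e2.
by rewrite /joint e1 e2 big_split.
Qed.

(** Each set of the family lives on one side; the condition imposed there becomes trivial on the
    other, where the value at [set0] vanishes almost surely. Independence of the two families then
    splits the event into two, and each splits further by its own independence. A set empty on both
    sides counts as left. *)
Lemma joint_fin_independent : fin_independent P pure (joint W N).
Proof.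
move=> J C DC tC S mS.
pose l j := `[< inr @^-1` C j = (set0 : set X2) >].
have lE j : if l j then inr @^-1` C j = set0 else inl @^-1` C j = set0.
  by rewrite /l; case: asboolP => // nl; case: (DC j) => -[].
pose SL j := if l j then S j else setT; pose SR j := if l j then setT else S j.
have mSL j : measurable (SL j) by rewrite /SL; case: ifP.
have mSR j : measurable (SR j) by rewrite /SR; case: ifP.
have mL : measurable [set w | forall j, SL j (W (inl @^-1` C j) w)].
  by apply: measurable_forall.
have mR : measurable [set w | forall j, SR j (N (inr @^-1` C j) w)].
  by apply: measurable_forall.
have mV : measurable [set w | forall j, S j (joint W N (C j) w)].
  by apply: measurable_forall => // j; exact: measurable_joint.
have W0 := fin_additive0 D10 aW; have N0 := fin_additive0 D20 aN.
have WN0 : {ae P, forall w, W set0 w = 0 /\ N set0 w = 0} by apply: filterS2 W0 N0.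
transitivity (pr P ([set w | forall j, SL j (W (inl @^-1` C j) w)] `&`
    [set w | forall j, SR j (N (inr @^-1` C j) w)])).
  apply: (ae_pr_eq _ _ WN0) => //; first exact: measurableI.
  move=> w [w0 n0]; split => [h|[hl hr] j] /=.
    split => j; have := h j; have := lE j; rewrite /SL /SR /joint; case: ifP => // _ ->.
      by rewrite n0 addr0.
    by rewrite w0 add0r.
  have := hl j; have := hr j; have := lE j; rewrite /SL /SR /joint; case: ifP => _ ->.
    by rewrite n0 addr0.
  by rewrite w0 add0r.
rewrite iWN//; [|by move=> j; exact: pure1|by move=> j; exact: pure2].
rewrite iW//; [|by move=> j; exact: pure1|exact: trivIset_preimage].
rewrite iN//; [|by move=> j; exact: pure2|exact: trivIset_preimage].
rewrite -big_split /=; apply: eq_bigr => j _.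
have mm (Q : set R) (f : T -> R) : measurable Q -> measurable_fun setT f -> measurable (f @^-1` Q).
  by move=> mQ mf; rewrite -[X in measurable X]setTI; exact: mf.
have := lE j; rewrite /SL /SR; case: ifP => _ e0; rewrite preimage_setT prT ?mulr1 ?mul1r.
  apply: (ae_pr_eq _ _ N0) => //; [exact: mm|by apply: mm => //; exact: measurable_joint|].
  by move=> w n0; rewrite /= /joint e0 n0 addr0.
apply: (ae_pr_eq _ _ W0) => //; [exact: mm|by apply: mm => //; exact: measurable_joint|].
by move=> w w0; rewrite /= /joint e0 w0 add0r.
Qed.

End joint_measure.

End two_random_measures.

Section generated.
Context {R : realType} {dT} {T : measurableType dT} {P : probability T R}.
Context {dX} {X : measurableType dX} (D : set (set X)) (M : set X -> {RV P >-> R}).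

Lemma generated_forall (J : finType) (A : J -> set X) (S : J -> set R) :
  (forall j, D (A j)) -> (forall j, measurable (S j)) ->
  generated_sigma_algebra D M [set w | forall j, S j (M (A j) w)].
Proof.
move=> DA mS; pose G := [set F | exists A S, [/\ D A, measurable S & F = M A @^-1` S]].
rewrite (_ : [set w | _] = \bigcap_j (M (A j) @^-1` S j)); last first.
  by apply/seteqP; split => w /= h j; [move=> _|]; exact: h.
apply: (@fin_bigcap_measurable _ (g_sigma_algebraType G)) => [|j _]; first exact: finite_finset.
by apply: sub_sigma_algebra; exists (A j), (S j).
Qed.

End generated.

(** * Bounded Borel sets and time shifts *)

Section relatively_compact.
Context {S : topologicalType}.

Lemma compact_closure_sub (A B : set S) : A `<=` B -> compact (closure B) -> compact (closure A).
Proof.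
by move=> AB cB; apply: subclosed_compact cB (closure_subset AB); exact: closed_closure.
Qed.

Lemma compact_closure_le (A K : set S) : A `<=` K -> closed K -> compact K -> compact (closure A).
Proof.
move=> AK clK cK; apply: subclosed_compact cK _; first exact: closed_closure.
by rewrite [X in _ `<=` X](closure_id K).1//; exact: closure_subset.
Qed.

End relatively_compact.

Section delta_ring_lemmas.
Context {R : realType} {d : nat} (O : set 'rV[R]_d).
Implicit Types (A : set 'rV[R]_d) (B : set (R * 'rV[R]_d)).

Lemma Borel_b0 : Borel_b O set0.
Proof. by split => //; rewrite closure0; exact: compact0. Qed.

Lemma Borel_b_sub A A' : Borel_b O A -> measurable A' -> A' `<=` A -> Borel_b O A'.
Proof.
move=> [mA AO cA] mA' A'A; split => //; last exact: compact_closure_sub cA.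
exact: subset_trans AO.
Qed.

Lemma Borel_bU A A' : Borel_b O A -> Borel_b O A' -> Borel_b O (A `|` A').
Proof.
move=> [mA AO cA] [mA' AO' cA']; split; first exact: measurableU.
  by rewrite subUset.
by rewrite closureU; exact: compactU.
Qed.

Lemma Borel_b_time0 : Borel_b_time O set0.
Proof. by split => //; rewrite closure0; exact: compact0. Qed.

Lemma Borel_b_time_sub B B' : Borel_b_time O B -> measurable B' -> B' `<=` B ->
  Borel_b_time O B'.
Proof.
move=> [mB BO cB] mB' B'B; split => //; last exact: compact_closure_sub cB.
exact: subset_trans BO.
Qed.

Lemma Borel_b_timeU B B' : Borel_b_time O B -> Borel_b_time O B' -> Borel_b_time O (B `|` B').
Proof.
move=> [mB BO cB] [mB' BO' cB']; split; first exact: measurableU.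
  by rewrite subUset.
by rewrite closureU; exact: compactU.
Qed.

Lemma Borel_b_time_measurable : Borel_b_time O `<=` measurable.
Proof. by move=> B []. Qed.

Lemma Borel_b_timeI : setI_closed (Borel_b_time O).
Proof.
move=> B B' bB bB'; apply: (Borel_b_time_sub bB); last exact: subIsetl.
by apply: measurableI; exact: Borel_b_time_measurable.
Qed.

Lemma Borel_b_timeD B B' : Borel_b_time O B -> Borel_b_time O B' -> Borel_b_time O (B `\` B').
Proof.
move=> bB bB'; apply: (Borel_b_time_sub bB); last exact: subDsetl.
by apply: measurableD; exact: Borel_b_time_measurable.
Qed.

Lemma Borel_b_time_rectangle (s t : R) A : 0 <= s -> Borel_b O A ->
  Borel_b_time O (`]s, t] `*` A).
Proof.
move=> s0 [mA AO cA]; split; first exact: measurableX.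
  move=> z [/=]; rewrite in_itv/= => /andP[sz _] Az; split => /=; last exact: AO.
  by rewrite in_itv/= andbT (le_trans s0)// ltW.
have st : (`]s, t]%classic `*` A) `<=` `[s, t]%classic `*` closure A.
  move=> z [/=]; rewrite !in_itv/= => /andP[sz zt] Az; split => /=.
    by rewrite ltW.
  exact: subset_closure.
apply: (compact_closure_le st); last first.
  by apply: compact_setX => //; exact: segment_compact.
rewrite (_ : _ `*` _ = (fst @^-1` `[s, t]%classic) `&` (snd @^-1` closure A))//.
apply: closedI; apply: preimage_closed => //.
- by move=> ? _; exact: cvg_fst.
- exact: interval_closed.
- by move=> ? _; exact: cvg_snd.
- exact: closed_closure.
Qed.

(** The time projection of the compact closure is compact. The resulting horizon is what makes
    integrands over [B] have finite modular. *)
Lemma Borel_b_time_bounded B : Borel_b_time O B -> exists2 t : R, 0 <= t &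
  B `<=` `[0, t]%classic `*` O.
Proof.
move=> [mB BO cB].
have : bounded_set (fst @` closure B).
  apply: compact_bounded; apply: continuous_compact => //.
  by apply: continuous_subspaceT => z; exact: cvg_fst.
move=> [M [_ /(_ (Num.max M 0 + 1))]]; rewrite ltr_pwDr ?le_max ?lexx//= => /(_ isT) hM.
exists (Num.max M 0 + 1).
  by rewrite addr_ge0// le_max lexx orbT.
move=> z Bz; have [/= z1 z2] := BO _ Bz; split => //=; rewrite in_itv/=.
move: z1; rewrite in_itv/= andbT => -> /=; apply: (le_trans (ler_norm _)); apply: hM.
by exists z => //; exact: subset_closure.
Qed.

Definition time_shift (h : R) (z : R * 'rV[R]_d) : R * 'rV[R]_d := (z.1 - h, z.2).

Lemma time_shiftK h : cancel (time_shift (- h)) (time_shift h).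
Proof. by move=> [u x]; rewrite /time_shift /= opprK addrK. Qed.

Lemma time_shiftNK h : cancel (time_shift h) (time_shift (- h)).
Proof. by move=> [u x]; rewrite /time_shift /= opprK subrK. Qed.

Lemma continuous_time_shift h : continuous (time_shift h).
Proof.
move=> z; apply: (@cvg_pair _ _ _ (nbhs z) (nbhs (z.1 - h)) (nbhs z.2) _ _ _
  (fun z => z.1 - h) snd); last exact: cvg_snd.
by apply: (@cvgB _ R^o); [exact: cvg_fst|exact: cvg_cst].
Qed.

Lemma measurable_time_shift h : measurable_fun setT (time_shift h).
Proof.
apply: measurable_fun_pair; last exact: measurable_snd.
by apply: measurable_funB => //; exact: measurable_fst.
Qed.

Lemma time_shift_preimage h B : time_shift h @^-1` B = time_shift (- h) @` B.
Proof.
apply/seteqP; split => z /=.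
  by move=> Bz; exists (time_shift h z) => //; exact: time_shiftNK.
by move=> [z' Bz' <-]; rewrite time_shiftK.
Qed.

Lemma Borel_b_time_shift h B : 0 <= h -> Borel_b_time O B -> Borel_b_time O (time_shift h @^-1` B).
Proof.
move=> h0 [mB BO cB]; split.
- by rewrite -[X in measurable X]setTI; apply: measurable_time_shift.
- move=> z /BO[/=]; rewrite !in_itv/= !andbT subr_ge0 => hz Oz; split => //=.
  by rewrite (le_trans h0).
- apply: (@compact_closure_le _ _ (time_shift h @^-1` closure B)).
  + by move=> z /=; exact: subset_closure.
  + by apply: preimage_closed => [z _|]; [exact: continuous_time_shift|exact: closed_closure].
  + rewrite time_shift_preimage; apply: continuous_compact => //.
    by apply: continuous_subspaceT => z; exact: continuous_time_shift.
Qed.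

Lemma time_shift_rectangle h s t A : time_shift h @^-1` (`]s, t] `*` A) = `]s + h, t + h] `*` A.
Proof.
by apply/seteqP; split => z [/=]; rewrite !in_itv/= ltrBrDr lerBlDr.
Qed.

Section marked.
Context {dU} {U : measurableType dU} (mu : {measure set (R * 'rV[R]_d * U) -> \bar R}).
Let DN := Borel_b_time_mark O mu.
Implicit Types (E : set (R * 'rV[R]_d * U)).

Definition mark_shift (h : R) (z : R * 'rV[R]_d * U) : R * 'rV[R]_d * U := (time_shift h z.1, z.2).

Lemma measurable_mark_shift h : measurable_fun setT (mark_shift h).
Proof.
apply: measurable_fun_pair; last exact: measurable_snd.
by apply: measurableT_comp; [exact: measurable_time_shift|exact: measurable_fst].
Qed.

Lemma Borel_b_time_mark0 : DN set0.
Proof. by split => //; [exists set0 => //; exact: Borel_b_time0|rewrite measure0]. Qed.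

Lemma Borel_b_time_mark_measurable : DN `<=` measurable.
Proof. by move=> E []. Qed.

Lemma Borel_b_time_mark_sub E E' : DN E -> measurable E' -> E' `<=` E -> DN E'.
Proof.
move=> [mE [B bB EB] Efin] mE' E'E; split => //.
  by exists B => //; exact: subset_trans EB.
by apply: le_lt_trans Efin; apply: le_measure; rewrite ?inE.
Qed.

Lemma Borel_b_time_markI : setI_closed DN.
Proof.
move=> E E' bE bE'; apply: (Borel_b_time_mark_sub bE); last exact: subIsetl.
by apply: measurableI; exact: Borel_b_time_mark_measurable.
Qed.

Lemma Borel_b_time_markD E E' : DN E -> DN E' -> DN (E `\` E').
Proof.
move=> bE bE'; apply: (Borel_b_time_mark_sub bE); last exact: subDsetl.
by apply: measurableD; exact: Borel_b_time_mark_measurable.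
Qed.

Lemma Borel_b_time_markU E E' : DN E -> DN E' -> DN (E `|` E').
Proof.
move=> [mE [B bB EB] Efin] [mE' [B' bB' EB'] Efin']; split.
- exact: measurableU.
- exists (B `|` B'); first exact: Borel_b_timeU.
  move=> z [/EB|/EB'] [Bz _]; split => //=; [by left|by right].
- by apply: le_lt_trans (measureU2 _ _ _) _ => //; exact: lte_add_pinfty.
Qed.

Lemma Borel_b_time_mark_shift h E : 0 <= h ->
  (forall E', measurable E' -> mu (mark_shift h @^-1` E') = mu E') ->
  DN E -> DN (mark_shift h @^-1` E).
Proof.
move=> h0 muh [mE [B bB EB] Efin]; split; last by rewrite muh.
  by rewrite -[X in measurable X]setTI; apply: measurable_mark_shift.
exists (time_shift h @^-1` B); first exact: Borel_b_time_shift.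
by move=> z /EB[].
Qed.

End marked.

End delta_ring_lemmas.

(** * Invariance of the intensities under time shifts *)

Section invariance.
Context {R : realType}.

Lemma leb_shift (h : R) (A : set R) : measurable A -> leb ((fun u => u - h) @^-1` A) = leb A.
Proof.
move=> mA.
pose f (u : measurableTypeR R) : measurableTypeR R := (u : R) - h.
have mf : measurable_fun setT f by exact: (@measurable_funB _ R R setT id (cst h)).
pose m' := pushforward (@lebesgue_measure R) f : {measure set (measurableTypeR R) -> \bar R}.
suff h0 X : ocitv X -> lebesgue_measure X = m' mf X.
  by have := @lebesgue_measure_unique R (m' mf) h0 A mA.
move=> [[a b] _ <-]; rewrite /m' /= /pushforward.
have -> : f @^-1` `]a, b] = `]a + h, b + h]%classic.
  by apply/seteqP; split => u /=; rewrite /f !in_itv/= ltrBrDr lerBlDr.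
rewrite [RHS]lebesgue_measure_itv lebesgue_measure_itv/= !lte_fin ltrD2r.
by case: ifP => // _; rewrite -!EFinD; congr EFin; lra.
Qed.

Context {d1 d2} {X1 : measurableType d1} {X2 : measurableType d2}.
Variables (m1 : {measure set X1 -> \bar R}) (m2 : {sigma_finite_measure set X2 -> \bar R}).
Variable g : X1 -> X1.
Hypothesis mg : measurable_fun setT g.
Hypothesis m1g : forall A, measurable A -> m1 (g @^-1` A) = m1 A.

(** A change of variable in the integral of the sections. Applied to time and space, and then once
    more to space-time and marks. *)
Lemma product_measure_invariant (E : set (X1 * X2)) : measurable E ->
  (m1 \x m2)%E ((fun z => (g z.1, z.2)) @^-1` E) = (m1 \x m2)%E E.
Proof.
move=> mE; rewrite /product_measure1.
pose m' := pushforward m1 g : {measure set X1 -> \bar R}.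
have -> : (\int[m1]_x m2 (xsection E x) = \int[m' mg]_x m2 (xsection E x))%E.
  by apply: eq_measure_integral => A mA _; rewrite -[LHS]m1g.
have mx : measurable_fun setT (fun x => m2 (xsection E x)) := measurable_fun_xsection m2 mE.
by rewrite [RHS](ge0_integral_pushforward mg m1 measurableT mx)// preimage_setT.
Qed.

End invariance.

Section rectangles.
Context {R : realType} {d : nat}.

(** The sections are [A] or empty, and [rho set0 = 0] turns the integrand into a multiple of the
    indicator of []0, t]]. *)
Lemma leb_prod_rectangle (rho : set 'rV[R]_d -> R) (t : R) (A : set 'rV[R]_d) : 0 <= t ->
  rho set0 = 0 -> leb_prod rho (`]0, t] `*` A) = t * rho A.
Proof.
move=> t0 rho0; rewrite /leb_prod.
have L : leb `]0, t]%classic = t%:E.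
  rewrite /leb lebesgue_measure_itv/= lte_fin oppr0 addr0.
  by case: ltP => // t0'; congr EFin; apply/le_anti; rewrite t0 t0'.
transitivity (\int[leb]_(s in (`]0, t]%classic : set R)) rho A).
  rewrite /Rintegral; congr fine; rewrite integral_mkcond [RHS]integral_mkcond.
  apply: eq_integral => u _; rewrite !patchE.
  have xs : xsection (`]0, t]%classic `*` A) u = if u \in (`]0, t]%classic : set R) then A else set0.
    apply/seteqP; split => x; case: ifPn; rewrite ?inE ?notin_setE /xsection /= ?inE/=.
    - by move=> _ [].
    - by move=> nu [].
    - by [].
    - by [].
  rewrite xs; case: (boolP (u \in (`]0, t]%classic : set R))) => [u0|nu]; last first.
    by rewrite rho0; case: ifP.
  rewrite ifT//; move: u0; rewrite !inE /= !in_itv/= => /andP[/ltW -> _]//.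
rewrite Rintegral_cst// mulrC; congr (_ * _).
by rewrite [X in fine X]L.
Qed.

End rectangles.

Section tonelli.
Context {R : realType} {dX} {X : measurableType dX}.
Variable m : {sigma_finite_measure set X -> \bar R}.

Lemma integral_time (s t : R) (g : X -> \bar R) : s <= t -> measurable_fun setT g ->
  (forall x, 0 <= g x)%E ->
  (\int[leb \x m]_z ((\1_(`]s, t]%classic) z.1)%:E * g z.2) = (t - s)%:E * \int[m]_x g x)%E.
Proof.
move=> st mg g0.
have m1 : measurable_fun setT (fun u : R => (\1_(`]s, t]%classic) u : R)%:E).
  by apply/measurable_EFinP; exact: measurable_indic.
rewrite fubini_tonelli1//; last 2 first.
- apply: emeasurable_funM; last by apply: measurableT_comp mg _; exact: measurable_snd.
  by apply: measurableT_comp m1 _; exact: measurable_fst.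
- by move=> z; rewrite mule_ge0// lee_fin.
rewrite /fubini_F /=.
under eq_integral do rewrite ge0_integralZl// muleC.
rewrite ge0_integralZl//; last exact: integral_ge0.
have L : leb `]s, t]%classic = (t - s)%:E.
  rewrite /leb lebesgue_measure_itv/= lte_fin -EFinB.
  by move: st; rewrite le_eqVlt => /predU1P[->|->//]; rewrite ltxx subrr.
by rewrite integral_indic// setIT muleC; congr (_ * _)%E.
Qed.

(* The library declares (m1 \x m2) a sigma-finite measure only for
   subprobabilities m1 and m2. *)
Definition time_product : set (R * X) -> \bar R := (leb \x m)%E.

HB.instance Definition _ := Measure.on time_product.

Let time_product_sigma_finite : sigma_finite setT time_product.
Proof.
have /sigma_finiteP[F [TF ndF Foo]] := sigma_finiteT (@leb R).
have /sigma_finiteP[G [TG ndG Goo]] := sigma_finiteT m.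
exists (fun k => F k `*` G k) => [|k].
  apply/seteqP; split => // -[u x] _.
  have [i _ Fu] : (\bigcup_k F k) u by rewrite -TF.
  have [j _ Gx] : (\bigcup_k G k) x by rewrite -TG.
  exists (maxn i j) => //; split.
    by have /subsetPset := ndF _ _ (leq_maxl i j); exact.
  by have /subsetPset := ndG _ _ (leq_maxr i j); exact.
have [mF Fk] := Foo k; have [mG Gk] := Goo k.
split; first exact: measurableX.
by rewrite /time_product product_measure1E// lte_mul_pinfty// ge0_fin_numE.
Qed.

HB.instance Definition _ := Measure_isSigmaFinite.Build _ _ _ time_product
  time_product_sigma_finite.

Context {dU} {U : measurableType dU} (n : {sigma_finite_measure set U -> \bar R}).

Lemma integral_time_mark (s t : R) (g : X * U -> \bar R) : s <= t -> measurable_fun setT g ->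
  (forall x, 0 <= g x)%E ->
  (\int[(leb \x m) \x n]_z ((\1_(`]s, t]%classic) z.1.1)%:E * g (z.1.2, z.2)) =
   (t - s)%:E * \int[m \x n]_x g x)%E.
Proof.
move=> st mg g0.
have m1 : measurable_fun setT (fun u : R => (\1_(`]s, t]%classic) u : R)%:E).
  by apply/measurable_EFinP; exact: measurable_indic.
have mp : measurable_fun setT (fun z : R * X * U => (z.1.2, z.2)).
  apply: measurable_fun_pair; last exact: measurable_snd.
  by apply: measurableT_comp; [exact: measurable_snd|exact: measurable_fst].
rewrite (@fubini_tonelli1 _ _ _ _ _ time_product n)//; last 2 first.
- apply: emeasurable_funM; last exact: measurableT_comp mg mp.
  apply: (measurableT_comp m1); apply: measurableT_comp; exact: measurable_fst.
- by move=> z; rewrite mule_ge0// lee_fin.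
rewrite fubini_tonelli1// -(integral_time st) //; last 2 first.
- exact: measurable_fun_fubini_tonelli_F.
- by move=> x; exact: integral_ge0.
apply: eq_integral => z _; rewrite /fubini_F /= ge0_integralZl//.
by apply: measurableT_comp mg _; exact: pair1_measurable.
Qed.

End tonelli.

(** * From an additive random set function to a Levy-valued measure *)

Lemma measurable_row_coords {R : realType} {dT} {T : measurableType dT} n (f : T -> 'rV[R]_n) :
  (forall j, measurable_fun setT (fun w => f w 0 j)) -> measurable_fun setT f.
Proof.
move=> h; rewrite (_ : f = fun w => \row_j f w 0 j); first exact: measurable_row.
by apply/funext => w; apply/rowP => j; rewrite mxE.
Qed.

Lemma measurable_exists {dT} {T : measurableType dT} (I : finType) (A : I -> set T) :
  (forall i, measurable (A i)) -> measurable [set w | exists i, A i w].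
Proof.
move=> mA; rewrite (_ : [set w | _] = \bigcup_i A i); last first.
  by apply/seteqP; split => w /= [i]; exists i.
by apply: fin_bigcup_measurable => //; exact: finite_finset.
Qed.

Lemma row_norm_ge {R : realType} {T : Type} n (X Z : 'I_n -> T -> R) (r : R) : 0 < r ->
  [set w | r <= `|\row_i X i w - \row_i Z i w : 'rV[R]_n|] =
  [set w | exists i, r <= `|X i w - Z i w|].
Proof.
move=> r0; apply/seteqP; split => w /=.
  move=> rw; apply: contrapT => /forallNP h; move: rw; rewrite leNgt => /negP; apply.
  rewrite [X in X < _]mx_normrE; apply: bigmax_lt => // -[i j] _ /=.
  by rewrite !mxE ltNge; apply/negP; exact: h.
move=> [i ri]; apply: (le_trans ri); rewrite [X in _ <= X]mx_normrE.
by apply: le_trans (le_bigmax _ _ (ord0, i)); rewrite /= !mxE.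
Qed.

Lemma signed_measure_onU {R : realType} {X : Type} (D : set (set X)) (rho : set X -> R) A A' :
  D set0 -> signed_measure_on D rho -> D A -> D A' -> D (A `|` A') -> A `&` A' = set0 ->
  rho (A `|` A') = rho A + rho A'.
Proof.
move=> D0 [rho0 hrho] DA DA' DU AA'; pose C k := nth set0 [:: A; A'] k.
have E : \bigcup_k C k = A `|` A'.
  apply/seteqP; split => x /=; first by move=> [[|[|k]] _]; rewrite /C /= ?nth_nil => Cx //; [left|right].
  by move=> [Ax|Ax]; [exists 0%N|exists 1%N].
have tC : trivIset setT C.
  apply/trivIsetP => -[|[|i]] [|[|j]] _ _ //= _; rewrite /C /= ?nth_nil ?setI0 ?set0I//.
  by rewrite setIC.
have DC k : D (C k) by case: k => [|[|k]]; rewrite /C //= nth_nil.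
have := hrho C DC tC; rewrite E => /(_ DU) /cvg_lim <-//.
apply: lim_near_cst => //; exists 2%N => // n /= n2.
rewrite -(big_mkord xpredT (fun k => rho (C k))) (big_cat_nat (n := 2))//= [X in _ + X]big_nat.
rewrite [X in _ + X]big1 ?addr0; last by move=> [|[|k]] //; rewrite /C /= nth_nil.
by rewrite big_mkord !big_ord_recl big_ord0 /C /= addr0.
Qed.

Section process.
Context {R : realType} {dT} {T : measurableType dT} {P : probability T R}.
Context {d : nat} (O : set 'rV[R]_d).
Local Notation X1 := (R * 'rV[R]_d)%type.
Local Notation DW := (Borel_b_time O).
Context {X : Type} (D : set (set X)) (V : set X -> T -> R).
Hypotheses (D0 : D set0) (DI : setI_closed D) (DD : forall A B, D A -> D B -> D (A `\` B)).
Hypotheses (mV : forall A, measurable_fun setT (V A)) (aV : fin_additive P D V).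
Hypothesis iV : fin_independent P D V.
(** [K B] is the region of the index space of [V] that decides [Y B]; it need not belong to [D]. *)
Variable K : set X1 -> set X.
Hypothesis KI : forall B B', B `&` B' = set0 -> K B `&` K B' = set0.
Hypothesis Kle : forall B B', B `<=` B' -> K B `<=` K B'.
Variable Y : set X1 -> T -> R.
Hypothesis mY : forall B, measurable_fun setT (Y B).
Hypothesis YU : forall B B', DW B -> DW B' -> B `&` B' = set0 ->
  {ae P, forall w, Y (B `|` B') w = Y B w + Y B' w}.
Hypothesis Yloc : forall B, DW B -> local_rv P D V (K B) (Y B).
Hypothesis Yshift : forall (h : R) n (B : 'I_n -> set X1) (S : set 'rV[R]_n), 0 <= h ->
  (forall i, DW (B i)) -> measurable S -> pr P ((fun w => \row_i Y (B i) w) @^-1` S) =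
    pr P ((fun w => \row_i Y (time_shift h @^-1` B i) w) @^-1` S).
Hypothesis Yshort : forall r : R, 0 < r -> exists2 C : R, 0 <= C & forall s t B, s <= t -> DW B ->
  B `<=` `]s, t]%classic `*` setT -> pr P [set w | r <= `|Y B w|] <= C * (t - s).
Hypothesis Ycvg0 : forall B : nat -> set X1, (forall n, DW (B n)) -> (forall n, B n `<=` B 0%N) ->
  (forall z, \forall n \near \oo, ~ B n z) -> cvgP P (fun n => Y (B n)) (cst 0).
Variable rho : set 'rV[R]_d -> R.
Hypothesis hrho : signed_measure_on (Borel_b O) rho.

Let Y0 : {ae P, forall w, Y set0 w = 0}.
Proof.
have := YU (Borel_b_time0 O) (Borel_b_time0 O) (setI0 _); rewrite setU0.
by apply: filterS => w h; lra.
Qed.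

(** A version of the increment of [M] over []s, t]], equal to [M t A - M s A] only almost surely;
    unlike the difference it is visibly local to its own slab. *)
Definition block (s t : R) (A : set 'rV[R]_d) (w : T) : R :=
  (t - s) * rho A + Y (`]s, t] `*` A) w.

Lemma measurable_block s t A : measurable_fun setT (block s t A).
Proof. exact: measurable_funD. Qed.

Let rect s t A : 0 <= s -> Borel_b O A -> DW (`]s, t] `*` A).
Proof. exact: Borel_b_time_rectangle. Qed.

Lemma block_time s t u A : 0 <= s -> s <= t -> t <= u -> Borel_b O A ->
  {ae P, forall w, block s u A w = block s t A w + block t u A w}.
Proof.
move=> s0 st tu bA; have t0 := le_trans s0 st.
have E : `]s, u]%classic `*` A = (`]s, t]%classic `*` A) `|` (`]t, u]%classic `*` A).
  apply/seteqP; split => z /=.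
    rewrite !in_itv/= => -[/andP[sz zu] Az]; case: (leP z.1 t) => zt; [left|right]; split => //.
    by rewrite sz.
  rewrite !in_itv/= => -[[/andP[sz zt] Az]|[/andP[tz zu] Az]]; split => //.
    by rewrite sz (le_trans zt).
  by rewrite zu andbT (le_lt_trans st).
have := YU (rect t s0 bA) (rect u t0 bA) _; rewrite -E => h.
apply: filterS (h _) => [w hw|]; first by rewrite /block hw; lra.
apply/seteqP; split => z //= [[]]; rewrite !in_itv/= => /andP[_ zt] _ [/andP[tz _] _].
by move: tz; rewrite ltNge zt.
Qed.

Lemma block_space s t A A' : 0 <= s -> Borel_b O A -> Borel_b O A' -> A `&` A' = set0 ->
  rho (A `|` A') = rho A + rho A' ->
  {ae P, forall w, block s t (A `|` A') w = block s t A w + block s t A' w}.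
Proof.
move=> s0 bA bA' AA' rAA'.
have E : `]s, t]%classic `*` (A `|` A') = (`]s, t]%classic `*` A) `|` (`]s, t]%classic `*` A').
  by apply/seteqP; split => z /= [] => [zi []|[]|[]] => *; [left|right|split => //; left|split => //; right].
have := YU (rect t s0 bA) (rect t s0 bA') _; rewrite -E => h.
apply: filterS (h _) => [w|]; first by rewrite /block rAA' => ->; lra.
apply/seteqP; split => z //= [[_ Az] [_ Az']].
by have /seteqP[/(_ z.2) + _] := AA'; apply.
Qed.

Lemma local_rv_ae B Z Z' : measurable_fun setT Z' -> {ae P, forall w, Z w = Z' w} ->
  local_rv P D V B Z -> local_rv P D V B Z'.
Proof.
move=> mZ' ZZ' [mZ _ [a [l [sl cl _]]]].
have ml n : measurable_fun setT (fun w => a n + lin V (l n) w).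
  by apply: measurable_funD => //; exact: measurable_lin.
have cl' : cvgP P (fun n w => a n + lin V (l n) w) Z'.
  by apply: cvgP_ext cl => // n; exact: aeW.
by split => //; exists a, l.
Qed.

Lemma local_rv_cst B Z r : local_rv P D V B Z -> local_rv P D V B (fun w => r + Z w).
Proof.
move=> [mZ _ [a [l [sl cl _]]]].
have mr : measurable_fun setT (fun w => r + Z w) by exact: measurable_funD.
have cr : cvgP P (fun n w => (r + a n) + lin V (l n) w) (fun w => r + Z w).
  move=> e e0; apply: filterS (cl e e0) => n; rewrite (_ : [set w | _] =
    [set w | e <= `|a n + lin V (l n) w - Z w|])//.
  apply/seteqP; split => w /=; rewrite (_ : r + a n + _ - _ = a n + lin V (l n) w - Z w)//; ring.
by split => //; exists (fun n => r + a n), l.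
Qed.

Lemma local_block s t A : 0 <= s -> Borel_b O A ->
  local_rv P D V (K (`]s, t] `*` A)) (block s t A).
Proof. by move=> s0 bA; apply: local_rv_cst; apply: Yloc; exact: rect. Qed.

(** The drift depends on [t - s] only, so it is the same vector [v] before and after the shift and
    is absorbed by translating [S]. *)
Lemma block_stationary h s t n (A : 'I_n -> set 'rV[R]_d) (S : set 'rV[R]_n) :
  0 <= h -> 0 <= s -> (forall i, Borel_b O (A i)) -> measurable S ->
  pr P ((fun w => \row_i block s t (A i) w) @^-1` S) =
  pr P ((fun w => \row_i block (s + h) (t + h) (A i) w) @^-1` S).
Proof.
move=> h0 s0 bA mS; pose v : 'rV[R]_n := \row_i ((t - s) * rho (A i)).
have mS' : measurable [set x | S (v + x)].
  rewrite -[X in measurable X]setTI; apply: (_ : measurable_fun setT (fun x => v + x)) => //.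
  apply: measurable_row_coords => j; under eq_fun do rewrite mxE.
  by apply: measurable_funD => //; exact: measurable_coord.
have := Yshift h0 (fun i => rect t s0 (bA i)) mS'.
have -> : (fun w => \row_i Y (time_shift h @^-1` (`]s, t] `*` A i)) w) =
    (fun w => \row_i Y (`]s + h, t + h] `*` A i) w).
  by apply/funext => w; apply/rowP => i; rewrite !mxE time_shift_rectangle.
move=> Ys.
have E (u : R) (x : 'I_n -> R) : u = t - s ->
    \row_i (u * rho (A i) + x i) = v + \row_i x i :> 'rV[R]_n.
  by move=> ->; apply/rowP => i; rewrite !mxE.
have st : t + h - (s + h) = t - s by ring.
under [X in pr P (X @^-1` S)]eq_fun do rewrite /block E//.
under [X in _ = pr P (X @^-1` S)]eq_fun do rewrite /block E//.
rewrite -[_ @^-1` S]/((fun w => \row_i Y (`]s, t] `*` A i) w) @^-1` [set x | S (v + x)]).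
rewrite -[(fun w => v + \row_i Y (`]s + h, t + h] `*` A i) w) @^-1` S]/(
  (fun w => \row_i Y (`]s + h, t + h] `*` A i) w) @^-1` [set x | S (v + x)]).
exact: Ys.
Qed.

Lemma block_small (r : R) A : 0 < r -> Borel_b O A -> exists2 C : R, 0 <= C &
  forall s t, 0 <= s -> s <= t -> pr P [set w | r <= `|block s t A w|] <= C * (t - s).
Proof.
move=> r0 bA; have r2 : 0 < r / 2 by rewrite divr_gt0.
(* If [q * (t - s) >= 1] the claim holds because probabilities are at most 1; otherwise the drift
   stays below [r / 2] and the random part has to exceed the rest. *)
have [C C0 hC] := Yshort r2; pose q := 2 * `|rho A| / r.
have q0 : 0 <= q by rewrite divr_ge0 ?mulr_ge0// ltW.
exists (C + q); first by rewrite addr_ge0.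
move=> s t s0 st; have ts : 0 <= t - s by rewrite subr_ge0.
have [qt|qt] := lerP 1 (q * (t - s)).
  apply: (@le_trans _ _ 1); first by apply: pr_le1; apply: measurable_abs_ge; exact: measurable_block.
  by rewrite mulrDl; apply: (le_trans qt); rewrite lerDr mulr_ge0.
apply: (@le_trans _ _ (C * (t - s))); last by rewrite ler_wpM2r// lerDl.
apply: le_trans (hC s t (`]s, t] `*` A) st (rect t s0 bA) _); last by move=> z [].
apply: pr_le; [by apply: measurable_abs_ge; exact: measurable_block|exact: measurable_abs_ge|].
move=> w /= rw; rewrite leNgt; apply/negP => h; move: rw; rewrite leNgt => /negP; apply.
apply: (le_lt_trans (ler_normD _ _)); rewrite normrM (ger0_norm ts).
have : (t - s) * `|rho A| < r / 2.
  by move: qt; rewrite /q mulrAC ltr_pdivrMr// mul1r; lra.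
by move: h; lra.
Qed.


Let rhoU A A' : Borel_b O A -> Borel_b O A' -> A `&` A' = set0 ->
  rho (A `|` A') = rho A + rho A'.
Proof.
by move=> bA bA'; apply: (signed_measure_onU (Borel_b0 O) hrho) => //; exact: Borel_bU.
Qed.

Variable M : R -> set 'rV[R]_d -> {RV P >-> R}.
Hypothesis MY : forall t A, 0 <= t -> Borel_b O A -> M t A = block 0 t A :> (T -> R).

Let M0 A : Borel_b O A -> {ae P, forall w, M 0 A w = 0}.
Proof.
move=> bA; apply: filterS Y0 => w w0; rewrite MY// /block subrr mul0r add0r.
rewrite (_ : `]0, 0] `*` A = set0)//; apply/seteqP; split => z //= [].
by rewrite in_itv/= => /andP[/lt_le_trans h /h]; rewrite ltxx.
Qed.

Let M_increment s t A : 0 <= s -> s <= t -> Borel_b O A ->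
  {ae P, forall w, block s t A w = M t A w - M s A w}.
Proof.
move=> s0 st bA; apply: filterS (block_time (lexx 0) s0 st bA) => w hw.
by rewrite !MY ?(le_trans s0)// hw addrAC subrr add0r.
Qed.

Let local_increment s t A : 0 <= s -> s <= t -> Borel_b O A ->
  local_rv P D V (K (`]s, t] `*` A)) (fun w => M t A w - M s A w).
Proof.
move=> s0 st bA; apply: (local_rv_ae _ (M_increment s0 st bA)); last exact: local_block.
by apply: measurable_funB; exact: measurable_funP.
Qed.

Let local_le B B' Z : B `<=` B' -> local_rv P D V B Z -> local_rv P D V B' Z.
Proof. exact: local_pair_sub. Qed.

Lemma row_levy_process n (A : 'I_n -> set 'rV[R]_d) : (forall i, Borel_b O (A i)) ->
  levy_process P (fun t w => \row_i M t (A i) w).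
Proof.
move=> bA; have mrow t : measurable_fun setT (fun w => \row_i M t (A i) w : 'rV[R]_n).
  by apply: measurable_row => i; exact: measurable_funP.
split.
- have : {ae P, forall w, forall i, M 0 (A i) w = 0}.
    by apply: filter_forall => i; exact: M0.
  by apply: filterS => w h; apply/rowP => i; rewrite !mxE h.
- move=> t t0 nd J S mS.
  have tk k : 0 <= t k by apply: (le_trans t0); exact: nd.
  have tS k : t k <= t k.+1 by exact: nd.
  (* One region per time interval, wide enough for all coordinates. A repeated time gives an empty
     interval, so a nondecreasing sequence is allowed. *)
  pose B k := K (`]t k, t k.+1] `*` \bigcup_i A i).
  have tB : trivIset setT B.
    apply/trivIsetP => i j _ _ ij; apply: KI; apply/seteqP; split => z //= [[+ _] [+ _]].
    rewrite !in_itv/= => /andP[h1 h2] /andP[h3 h4].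
    move: ij; rewrite neq_lt => /orP[ij|ji].
    + by have := lt_le_trans h3 (le_trans h2 (nd _ _ ij)); rewrite ltxx.
    + by have := lt_le_trans h1 (le_trans h4 (nd _ _ ji)); rewrite ltxx.
  apply: (local_events_mutual D0 DI DD mV aV iV J tB) => k.
  have -> : (fun w => \row_i M (t k.+1) (A i) w - \row_i M (t k) (A i) w : 'rV[R]_n) =
      (fun w => \row_i (M (t k.+1) (A i) w - M (t k) (A i) w)).
    by apply/funext => w; apply/rowP => i; rewrite !mxE.
  apply: local_events_row => // i; apply: local_le (local_increment (tk k) (tS k) (bA i)).
  by apply: Kle => z [h1 h2]; split => //; exists i.
- move=> s t s0 st S mS; have ts : 0 <= t - s by rewrite subr_ge0.
  have -> : (fun w => \row_i M (t - s) (A i) w) = (fun w => \row_i block 0 (t - s) (A i) w).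
    by apply/funext => w; apply/rowP => i; rewrite !mxE MY.
  rewrite [RHS]prE; last first.
    by rewrite -[X in measurable X]setTI; apply: measurable_row => // i; exact: measurable_block.
  rewrite (block_stationary (t - s) s0 (lexx 0) bA mS) add0r subrK.
  rewrite prE; last first.
    rewrite -[X in measurable X]setTI; apply: measurable_row_coords => // j.
    under eq_fun do rewrite !mxE; apply: measurable_funB; exact: measurable_funP.
  congr EFin; have : {ae P, forall w, forall i, block s t (A i) w = M t (A i) w - M s (A i) w}.
    by apply: filter_forall => i; exact: M_increment.
  move=> hae; apply: (ae_pr_eq _ _ hae).
  + rewrite -[X in measurable X]setTI; apply: measurable_row_coords => // j.
    under eq_fun do rewrite !mxE; apply: measurable_funB; exact: measurable_funP.
  + by rewrite -[X in measurable X]setTI; apply: measurable_row => // i; exact: measurable_block.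
  + move=> w h /=; rewrite (_ : \row_i block s t (A i) w = \row_i M t (A i) w - \row_i M s (A i) w)//.
    by apply/rowP => i; rewrite !mxE h.
(* The norm of a row is the largest coordinate, so the constants of the coordinates add up in the
   union bound. *)
- move=> t r t0 r0; have [C [C0 hC]] : exists C : R, 0 <= C /\ forall u v, 0 <= u -> u <= v ->
      pr P [set w | r <= `|\row_i M v (A i) w - \row_i M u (A i) w : 'rV[R]_n|] <= C * (v - u).
    have /choice[C hC] : forall i, exists c : R, 0 <= c /\ forall u v, 0 <= u -> u <= v ->
        pr P [set w | r <= `|block u v (A i) w|] <= c * (v - u).
      by move=> i; have [c c0 hc] := block_small r0 (bA i); exists c.
    exists (\sum_i C i); split; first by apply: sumr_ge0 => i _; exact: (hC i).1.
    move=> u v u0 uv; have mM i : measurable [set w | r <= `|M v (A i) w - M u (A i) w|].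
      by apply: measurable_abs_ge; apply: measurable_funB; exact: measurable_funP.
    apply: (@le_trans _ _ (pr P [set w | exists i, r <= `|M v (A i) w - M u (A i) w|])).
      apply: pr_le.
      - rewrite (_ : [set w | _] = [set w | exists i, r <= `|M v (A i) w - M u (A i) w|]).
          exact: measurable_exists.
        exact: row_norm_ge.
      - exact: measurable_exists.
      - by move=> w; rewrite -[X in X -> _]/([set w | _] w) row_norm_ge.
    apply: (le_trans (pr_exists_le P mM)); rewrite mulr_suml; apply: ler_sum => i _.
    apply: le_trans ((hC i).2 u v u0 uv); rewrite le_eqVlt; apply/orP; left; apply/eqP.
    apply: (ae_pr_eq (mM i) _ (M_increment u0 uv (bA i))).
      by apply: measurable_abs_ge; exact: measurable_block.
    by move=> w hw /=; rewrite hw.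
  have mn u v : measurable [set w | r <= `|\row_i M v (A i) w - \row_i M u (A i) w : 'rV[R]_n|].
    rewrite row_norm_ge //; apply: measurable_exists => i.
    by apply: measurable_abs_ge; apply: measurable_funB; exact: measurable_funP.
  apply: cvg_EFin; first by apply: nearW => u; exact: fin_num_measure.
  apply/cvgr0Pnorm_le => eps eps0; have d0 : 0 < eps / (C + 1) by rewrite divr_gt0// ltr_wpDl.
  rewrite near_withinE; near=> u; rewrite /= in_itv/= andbT => u0.
  rewrite ger0_norm ?fine_ge0//.
  apply: (@le_trans _ _ (C * `|t - u|)).
    have [tu|ut] := leP t u.
      by rewrite distrC (ger0_norm (_ : 0 <= u - t)) ?subr_ge0//; exact: hC.
    have tu0 : 0 <= t - u by rewrite subr_ge0 ltW.
    rewrite (ger0_norm tu0).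
    apply: le_trans (hC u t u0 (ltW ut)); rewrite /pr le_eqVlt; apply/orP; left; apply/eqP.
    by congr (fine (P _)); apply/seteqP; split => w /=; rewrite distrC.
  apply: (@le_trans _ _ (C * (eps / (C + 1)))).
    by apply: ler_wpM2l => //; near: u; exact: (cvgr_dist_le _ _ _ (cvg_id) d0).
  by rewrite mulrCA ger_pMr// ler_pdivrMr ?ltr_wpDl// mul1r lerDl.
Unshelve. all: by end_near. Qed.

Lemma M_scattered t : 0 <= t -> independently_scattered (Borel_b O) (M t).
Proof.
move=> t0 A bA tA; split.
  move=> J S mS; apply: (local_events_mutual D0 DI DD mV aV iV
    (B := fun k => K (`]0, t] `*` A k)) J) => [|k].
    apply/trivIsetP => i j _ _ ij; apply: KI; apply/seteqP; split => z //= [[_ Ai] [_ Aj]].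
    by have /seteqP[/(_ z.2) + _] := iffLR trivIsetP tA i j Logic.I Logic.I ij; apply.
  by apply: local_events1 => //; rewrite MY//; exact: local_block.
move=> bU; pose Tl n := \bigcup_(k in [set k | (n <= k)%N]) A k.
have mA k : measurable (A k) by case: (bA k).
have mT n : measurable (Tl n) by apply: bigcup_measurable.
have TU n : Tl n `<=` \bigcup_k A k by move=> x [k _ Ax]; exists k.
have bT n : Borel_b O (Tl n) := Borel_b_sub bU (mT n) (TU n).
have Tle i m : (i <= m)%N -> Tl m `<=` Tl i.
  by move=> im x [k /= mk Ax]; exists k => //=; exact: leq_trans mk.
have T0 : Tl 0%N = \bigcup_k A k by apply/seteqP; split => x [k _ Ax]; exists k.
have AT n : A n `&` Tl n.+1 = set0.
  apply/seteqP; split => x //= [An [k /= nk Ak]].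
  have nk' : n != k by rewrite ltn_eqF.
  by have /seteqP[/(_ x) + _] := iffLR trivIsetP tA n k Logic.I Logic.I nk'; apply.
have TS n : Tl n = A n `|` Tl n.+1.
  apply/seteqP; split => x /=.
    by move=> [k /= nk Ax]; move: nk; rewrite leq_eqVlt => /predU1P[->|nk]; [left|right; exists k].
  by move=> [Ax|[k /= nk Ax]]; [exists n => /=|exists k => //=; exact: ltnW].
have rhoS n : rho (\bigcup_k A k) = \sum_(k < n) rho (A k) + rho (Tl n).
  elim: n => [|n IH]; first by rewrite big_ord0 add0r T0.
  by rewrite IH big_ord_recr/= -addrA -rhoU// -TS.
(* Outside one null set the total is, for all [n] at once, a partial sum plus a remainder; only the
   remainders are left to be studied. *)
have MS : {ae P, forall w, forall n, block 0 t (\bigcup_k A k) w =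
    \sum_(k < n) block 0 t (A k) w + block 0 t (Tl n) w}.
  have : {ae P, forall w, forall n, block 0 t (A n `|` Tl n.+1) w =
      block 0 t (A n) w + block 0 t (Tl n.+1) w}.
    by apply: ae_foralln => n; apply: block_space => //; exact: rhoU.
  apply: filterS => w hw; elim => [|n IH]; first by rewrite big_ord0 add0r T0.
  by rewrite IH big_ord_recr/= -addrA -hw -TS.
have rho0 : rho (Tl n) @[n --> \oo] --> (0 : R).
  rewrite (_ : (fun n => _) = (fun n => rho (\bigcup_k A k) - \sum_(k < n) rho (A k))).
    rewrite -[X in _ --> X](subrr (rho (\bigcup_k A k))).
    by apply: (@cvgB _ R^o); [exact: cvg_cst|exact: hrho.2].
  by apply/funext => n; rewrite {1}(rhoS n) addrAC subrr add0r.
pose B n := `]0, t]%classic `*` Tl n.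
have bB n : DW (B n) by exact: rect.
have Ble i m : (i <= m)%N -> B m `<=` B i.
  by move=> im z [z1 z2]; split => //; exact: Tle z2.
have mabs (r : R) : measurable [set x : R | r <= `|x|].
  by apply: measurable_abs_ge; exact: measurable_id.
(* The events [G m] are those decided over the remainder [B m]. The deterministic part of the
   remainder is treated separately by [rho0]. *)
have Yc : {ae P, forall w, Y (B n) w @[n --> \oo] --> (0 : R)}.
  apply: (@tail_ae_cvg0 _ _ _ P (fun n => Y (B n)) (fun n => mY (B n))
    (fun m => local_events P D V (K (B m)))).
  - by move=> m; exact: (@measurable0 _ (g_sigma_algebraType (local_boxes P D V (K (B m))))).
  - by move=> m; exact: (@measurableU _ (g_sigma_algebraType (local_boxes P D V (K (B m))))).
  - by move=> m; exact: (@measurableD _ (g_sigma_algebraType (local_boxes P D V (K (B m))))).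
  - move=> m j r mj; have lY : local_rv P D V (K (B m)) (Y (B j)).
      by apply: local_le (Yloc (bB j)); apply: Kle; exact: Ble.
    exact: (local_events1 lY (mabs r)).
  (* The difference of two remainders is almost surely the value on the set between them, which is
     disjoint from [B m]. *)
  - move=> i m F r im GF; have bD : DW (B i `\` B m) by exact: Borel_b_timeD.
    have BD : (B i `\` B m) `&` B m = set0 by rewrite setIC setDIK.
    have lD : local_rv P D V (K (B i `\` B m)) (fun w => Y (B i) w - Y (B m) w).
      apply: (local_rv_ae _ _ (Yloc bD)); first exact: measurable_funB.
      have := YU bD (bB m) BD; rewrite setUC setDUK; last exact: Ble.
      by apply: filterS => w ->; rewrite addrK.
    apply: (local_events_indep D0 DI DD mV aV iV (KI _) GF (local_events1 lD (mabs r))).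
    by rewrite setIC.
  - by move=> m; exact: local_events_measurable.
  - by move=> i m im; apply: local_events_sub; apply: Kle; exact: Ble.
  (* The remainders decrease to the empty set: a point of [A k] lies in no [Tl n] with [n > k]. *)
  apply: Ycvg0 => //; first by move=> n; exact: Ble.
  move=> z; have [[k _ Az]|nz] := pselect ((\bigcup_k A k) z.2).
    exists k.+1 => // n /= kn [_ [j /= nj Aj]].
    have kj : k != j by rewrite ltn_eqF// (leq_trans kn).
    by have /seteqP[/(_ z.2) + _] := iffLR trivIsetP tA k j Logic.I Logic.I kj; apply.
  by apply: nearW => n [_ /TU].
apply: filterS2 MS Yc => w hS hY; rewrite MY//.
rewrite (_ : (fun n => _) = (fun n => block 0 t (\bigcup_k A k) w - block 0 t (Tl n) w)); last first.
  apply/funext => n; rewrite {1}(hS n) addrK; apply: eq_bigr => k _; by rewrite MY.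
rewrite -[X in _ --> X]subr0; apply: (@cvgB _ R^o); first exact: cvg_cst.
rewrite /block -[X in _ --> X]addr0; apply: (@cvgD _ R^o) => //.
by rewrite -[X in _ --> X](mulr0 (t - 0)); apply: cvgM; [exact: cvg_cst|exact: rho0].
Qed.

Lemma block_stationary1 h s t A (S : set R) : 0 <= h -> 0 <= s -> Borel_b O A -> measurable S ->
  pr P (block s t A @^-1` S) = pr P (block (s + h) (t + h) A @^-1` S).
Proof.
move=> h0 s0 bA mS; pose S' := [set v : 'rV[R]_1 | S (v 0 0)].
have mS' : measurable S'.
  by rewrite -[X in measurable X]setTI; apply: (@measurable_coord R 1 0).
have E u v : (fun w => \row_(i < 1) block u v A w) @^-1` S' = block u v A @^-1` S.
  by apply/seteqP; split => w /=; rewrite /S' /= mxE.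
by have := block_stationary t h0 s0 (fun _ : 'I_1 => bA) mS'; rewrite !E.
Qed.

(** The required summands are the blocks over the intervals between the times [q i = t * i / n];
    they live on the given probability space. *)
Lemma M_infinitely_divisible t A : 0 <= t -> Borel_b O A -> infinitely_divisible P (M t A).
Proof.
move=> t0 bA n n0; pose q i : R := t * i%:R / n%:R.
have n0' : 0 < n%:R :> R by rewrite ltr0n.
have q0 i : 0 <= q i by rewrite divr_ge0// mulr_ge0.
have qS i : q i.+1 = t / n%:R + q i by rewrite /q -natr1 mulrDr mulr1 mulrDl addrC.
have tn0 : 0 <= t / n%:R by rewrite divr_ge0.
have qle i j : (i <= j)%N -> q i <= q j.
  by move=> ij; rewrite /q ler_pM2r ?invr_gt0//; apply: ler_wpM2l => //; rewrite ler_nat.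
pose Z (i : 'I_n) : {RV P >-> R} := mfun_Sub (mem_set (measurable_block (q i) (q i.+1) A)).
exists dT, T, P, Z; split.
- move=> J S mS; apply: (local_events_mutual D0 DI DD mV aV iV
    (B := fun i : 'I_n => K (`]q i, q i.+1] `*` A)) J) => [|i].
    apply/trivIsetP => i j _ _ ij; apply: KI; apply/seteqP; split => z //= [[+ _] [+ _]].
    rewrite !in_itv/= => /andP[h1 h2] /andP[h3 h4].
    move: ij; rewrite -val_eqE/= neq_ltn => /orP[ij|ji].
    + by have := lt_le_trans h3 (le_trans h2 (qle _ _ ij)); rewrite ltxx.
    + by have := lt_le_trans h1 (le_trans h4 (qle _ _ ji)); rewrite ltxx.
  by apply: local_events1 => //; exact: local_block.
- suff E (i : 'I_n) S : measurable S -> P (Z i @^-1` S) = (pr P (block 0 (t / n%:R) A @^-1` S))%:E.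
    by move=> i j S mS; rewrite !E.
  move=> mS; rewrite prE; last by rewrite -[X in measurable X]setTI; apply: measurable_funP.
  by rewrite (block_stationary1 (t / n%:R) (q0 i) (lexx 0))// add0r -qS.
- move=> S mS.
  have hs m : {ae P, forall w, block 0 (q m) A w = \sum_(i < m) block (q i) (q i.+1) A w}.
    elim: m => [|m IH].
      apply: filterS Y0 => w w0; rewrite big_ord0 /block /q mulr0 mul0r subrr mul0r add0r.
      rewrite (_ : `]0, 0] `*` A = set0)//; apply/seteqP; split => z //= [].
      by rewrite in_itv/= => /andP[/lt_le_trans h /h]; rewrite ltxx.
    apply: filterS2 IH (block_time (lexx 0) (q0 m) (qle _ _ (leqnSn m)) bA) => w e1 e2.
    by rewrite e2 e1 big_ord_recr.
  have qn : q n = t by rewrite /q mulfK// gt_eqF.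
  rewrite prE ?[RHS]prE; last 2 first.
  + by rewrite -[X in measurable X]setTI; apply: measurable_sum => // i; exact: measurable_funP.
  + by rewrite -[X in measurable X]setTI; apply: measurable_funP.
  congr EFin; apply: (ae_pr_eq _ _ (hs n)).
  + by rewrite -[X in measurable X]setTI; apply: measurable_funP.
  + by rewrite -[X in measurable X]setTI; apply: measurable_sum => // i; exact: measurable_funP.
  + by move=> w /=; rewrite qn MY// => ->.
Qed.

Lemma process_levy_valued : levy_valued_random_measure O M.
Proof.
split; last exact: row_levy_process.
move=> t t0; split; first exact: M_scattered.
by move=> A bA; exact: M_infinitely_divisible.
Qed.

End process.

(** * The random part of the space-time measure *)

Lemma addr3ACA {V : nmodType} (x x1 x2 y y1 y2 z z1 z2 : V) :
  x = x1 + x2 -> y = y1 + y2 -> z = z1 + z2 ->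
  x + y + z = x1 + y1 + z1 + (x2 + y2 + z2).
Proof. by move=> -> -> ->; rewrite (addrACA x1) (addrACA (x1 + y1)). Qed.

Section modular_product.
Context {R : realType} {dX} {X : measurableType dX}.
Variable m : {sigma_finite_measure set X -> \bar R}.
Variables (phi : R -> R) (hphi : is_modulus phi).

Lemma modular_time (s t : R) (g : X -> R) (f : R * X -> R) : s <= t ->
  measurable_fun setT g -> measurable_fun setT f ->
  (forall z, `|f z| <= \1_(`]s, t]%classic) z.1 * `|g z.2|) ->
  (modular (leb \x m)%E phi f <= (t - s)%:E * modular m phi g)%E.
Proof.
move=> st mg mf fg; have mpg := measurable_modulus_comp hphi mg.
have pg0 x : (0 <= (phi (g x))%:E)%E by rewrite lee_fin (modulus_ge0 hphi).
rewrite /modular -(integral_time m st mpg pg0); apply: ge0_le_integral => //.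
- by move=> z _; rewrite lee_fin (modulus_ge0 hphi).
- exact: measurable_modulus_comp.
- apply: emeasurable_funM; last by apply: measurableT_comp mpg _; exact: measurable_snd.
  have mi : measurable_fun setT (\1_(`]s, t]%classic) : R -> R) by exact: measurable_indic.
  by apply/measurable_EFinP; exact: (measurableT_comp mi measurable_fst).
move=> z _; rewrite -EFinM lee_fin; have := fg z; rewrite indicE.
case: (z.1 \in _); rewrite ?mul1r ?mul0r; first exact: modulus_le.
by move=> h; rewrite -(modulus0 hphi); apply: modulus_le => //; rewrite normr0.
Qed.

Context {dU} {U : measurableType dU} (n : {sigma_finite_measure set U -> \bar R}).

Lemma modular_time_mark (s t : R) (g : X * U -> R) (f : R * X * U -> R) : s <= t ->
  measurable_fun setT g -> measurable_fun setT f ->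
  (forall z, `|f z| <= \1_(`]s, t]%classic) z.1.1 * `|g (z.1.2, z.2)|) ->
  (modular ((leb \x m) \x n)%E phi f <= (t - s)%:E * modular (m \x n)%E phi g)%E.
Proof.
move=> st mg mf fg; have mpg := measurable_modulus_comp hphi mg.
have pg0 x : (0 <= (phi (g x))%:E)%E by rewrite lee_fin (modulus_ge0 hphi).
rewrite /modular -(integral_time_mark m n st mpg pg0); apply: ge0_le_integral => //.
- by move=> z _; rewrite lee_fin (modulus_ge0 hphi).
- exact: measurable_modulus_comp.
- apply: emeasurable_funM.
    have mi : measurable_fun setT (\1_(`]s, t]%classic) : R -> R) by exact: measurable_indic.
    apply/measurable_EFinP.
    exact: (measurableT_comp mi (measurableT_comp measurable_fst measurable_fst)).
  apply: measurableT_comp mpg _; apply: measurable_fun_pair; last exact: measurable_snd.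
  by apply: measurableT_comp; [exact: measurable_snd|exact: measurable_fst].
move=> z _; rewrite -EFinM lee_fin; have := fg z; rewrite indicE.
case: (z.1.1 \in _); rewrite ?mul1r ?mul0r; first exact: modulus_le.
by move=> h; rewrite -(modulus0 hphi); apply: modulus_le => //; rewrite normr0.
Qed.

End modular_product.

Section image_measures.
Context {R : realType} {dT} {T : measurableType dT} {P : probability T R}.
Context {X : Type} (D : set (set X)) (g : X -> X).
Hypothesis Dg : forall A, D A -> D (g @^-1` A).
Variable V : set X -> T -> R.

Lemma fin_additive_preimage : fin_additive P D V -> fin_additive P D (fun A => V (g @^-1` A)).
Proof.
move=> aV J C DC tC DU; have := aV J (fun j => g @^-1` C j) (fun j => Dg (DC j)) (trivIset_preimage tC).
have -> : \bigcup_j (g @^-1` C j) = g @^-1` (\bigcup_j C j) by rewrite preimage_bigcup.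
by apply; exact: Dg.
Qed.

Lemma fin_independent_preimage : fin_independent P D V ->
  fin_independent P D (fun A => V (g @^-1` A)).
Proof.
by move=> iV J C DC tC; apply: (iV J (fun j => g @^-1` C j)); [move=> j; exact: Dg|exact: trivIset_preimage].
Qed.

End image_measures.

(** * The three stochastic integrals over bounded space-time sets *)

Section integral_process.
Context {R : realType} {dT} {T : measurableType dT} {P : probability T R}.
Context {d : nat} (O : set 'rV[R]_d) (mO : measurable O).
Variable zeta : {sigma_finite_measure set 'rV[R]_d -> \bar R}.
Context {dU} {U : measurableType dU}.
Variable nu : {sigma_finite_measure set U -> \bar R}.
Local Notation X1 := (R * 'rV[R]_d)%type.
Local Notation X2 := (R * 'rV[R]_d * U)%type.
Local Notation DW := (Borel_b_time O).
Local Notation mu1 := (intensity_time zeta).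
Local Notation mu2 := (intensity_time_mark zeta nu).
Local Notation DN := (Borel_b_time_mark O mu2).
Variables (W : set X1 -> {RV P >-> R}) (N : set X2 -> {RV P >-> R}).
Hypothesis hW : gaussian_random_measure DW mu1 W.
Hypothesis hN : poisson_random_measure DN mu2 N.
Hypothesis hWN : independent_random_measures DW W DN N.
Variables (b : 'rV[R]_d -> R) (c e : 'rV[R]_d * U -> R).
Hypothesis mb : measurable_fun O b.
Hypothesis hb : (\int[zeta]_(x in O) ((b x) ^+ 2)%:E < +oo)%E.
Hypothesis mc : measurable_fun (O `*` setT) c.
Hypothesis hc : (\int[zeta \x nu]_(z in O `*` setT)
   (Num.min (`|c z| ^+ 2) `|c z|)%:E < +oo)%E.
Hypothesis me : measurable_fun (O `*` setT) e.
Hypothesis he : (\int[zeta \x nu]_(z in O `*` setT) (Num.min `|e z| 1)%:E < +oo)%E.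

Let W' : set X1 -> T -> R := fun A => W A.
Let N' : set X2 -> T -> R := fun A => N A.
Let C' : set X2 -> T -> R := fun A => compensated mu2 N A.

Let mW A : measurable_fun setT (W' A). Proof. exact: measurable_funP. Qed.
Let mN A : measurable_fun setT (N' A). Proof. exact: measurable_funP. Qed.
Let mC A : measurable_fun setT (C' A).
Proof. exact: (measurable_funP (compensated mu2 N A)). Qed.

Let aW : fin_additive P DW W'.
Proof. by have [h _] := hW; exact: (scattered_fin_additive (Borel_b_time0 O) h). Qed.
Let iW : fin_independent P DW W'.
Proof. by have [h _] := hW; exact: (scattered_fin_independent (Borel_b_time0 O) h). Qed.
Let aN : fin_additive P DN N'.
Proof. by have [h _] := hN; exact: (scattered_fin_additive (Borel_b_time_mark0 O mu2) h). Qed.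
Let iN : fin_independent P DN N'.
Proof. by have [h _] := hN; exact: (scattered_fin_independent (Borel_b_time_mark0 O mu2) h). Qed.

Let lawW A : DW A -> exists2 v : R, mu1 A = v%:E & centred_gaussian P v (W A).
Proof. by have [_] := hW; apply. Qed.
Let lawN A : DN A -> exists2 l : R, mu2 A = l%:E & poisson_law P l (N A).
Proof. by have [_] := hN; apply. Qed.

Let fW (B : set X1) (z : X1) : R := \1_B z * b z.2.
Let fC (B : set X1) (z : X2) : R := \1_B z.1 * c (z.1.2, z.2).
Let fE (B : set X1) (z : X2) : R := \1_B z.1 * e (z.1.2, z.2).

(** The integrands are measurable on [O] only; extended by 0 they are measurable everywhere, and
    over subsets of the space-time domain this changes nothing. *)
Let b0 := b \_ O.
Let c0 := c \_ (O `*` setT).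
Let e0 := e \_ (O `*` setT).

Let mb0 : measurable_fun setT b0. Proof. exact: (iffLR (measurable_restrictT b mO) mb). Qed.
Let mc0 : measurable_fun setT c0.
Proof. exact: (iffLR (measurable_restrictT c (measurableX mO measurableT)) mc). Qed.
Let me0 : measurable_fun setT e0.
Proof. exact: (iffLR (measurable_restrictT e (measurableX mO measurableT)) me). Qed.

Let in_O (B : set X1) z : DW B -> B z -> O z.2.
Proof. by move=> [_ BO _] /BO[]. Qed.

Let fWE B : DW B -> fW B = (fun z => \1_B z * b0 z.2).
Proof.
move=> bB; apply/funext => z; rewrite /fW indicE /b0 patchE.
case: (boolP (z \in B)); rewrite ?inE ?mul0r// => Bz.
by rewrite mem_set//; exact: in_O Bz.
Qed.

Let fCE B : DW B -> fC B = (fun z => \1_B z.1 * c0 (z.1.2, z.2)).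
Proof.
move=> bB; apply/funext => z; rewrite /fC indicE /c0 patchE.
case: (boolP (z.1 \in B)); rewrite ?inE ?mul0r// => Bz.
by rewrite mem_set//=; split => //; exact: in_O Bz.
Qed.

Let fEE B : DW B -> fE B = (fun z => \1_B z.1 * e0 (z.1.2, z.2)).
Proof.
move=> bB; apply/funext => z; rewrite /fE indicE /e0 patchE.
case: (boolP (z.1 \in B)); rewrite ?inE ?mul0r// => Bz.
by rewrite mem_set//=; split => //; exact: in_O Bz.
Qed.

Let mfW B : DW B -> measurable_fun setT (fW B).
Proof.
move=> bB; rewrite fWE//; have mB := Borel_b_time_measurable bB.
by apply: measurable_funM => //; apply: measurableT_comp => //; exact: measurable_snd.
Qed.

Let mark_measurable (B : set X1) (g : 'rV[R]_d * U -> R) : measurable B ->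
  measurable_fun setT g -> measurable_fun setT (fun z : X2 => \1_B z.1 * g (z.1.2, z.2)).
Proof.
move=> mB mg; apply: measurable_funM.
  have mi : measurable_fun setT (\1_B : X1 -> R) by exact: measurable_indic.
  exact: (measurableT_comp mi measurable_fst).
apply: measurableT_comp mg _; apply: measurable_fun_pair; last exact: measurable_snd.
by apply: measurableT_comp; [exact: measurable_snd|exact: measurable_fst].
Qed.

Let mfC B : DW B -> measurable_fun setT (fC B).
Proof. by move=> bB; rewrite fCE//; apply: mark_measurable => //; case: bB. Qed.

Let mfE B : DW B -> measurable_fun setT (fE B).
Proof. by move=> bB; rewrite fEE//; apply: mark_measurable => //; case: bB. Qed.

Let b0_fin : (modular zeta sq b0 < +oo)%E.
Proof.
apply: le_lt_trans hb; rewrite [X in (_ <= X)%E]integral_mkcond le_eqVlt; apply/orP; left; apply/eqP.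
by apply: eq_integral => x _; rewrite /b0 !patchE /sq; case: ifP => //; rewrite expr0n.
Qed.

Let c0_fin : (modular (zeta \x nu)%E mix c0 < +oo)%E.
Proof.
apply: le_lt_trans hc; rewrite [X in (_ <= X)%E]integral_mkcond le_eqVlt; apply/orP; left; apply/eqP.
apply: eq_integral => x _; rewrite /c0 !patchE /mix; case: ifP => _.
  by rewrite real_normK ?num_real.
by rewrite expr0n normr0 min_l.
Qed.

Let e0_fin : (modular (zeta \x nu)%E cut e0 < +oo)%E.
Proof.
apply: le_lt_trans he; rewrite [X in (_ <= X)%E]integral_mkcond le_eqVlt; apply/orP; left; apply/eqP.
apply: eq_integral => x _; rewrite /e0 !patchE /cut; case: ifP => _ //.
by rewrite normr0 min_l.
Qed.

Let indic_le (B : set X1) (s t : R) (z : X1) (x : R) : B `<=` `]s, t]%classic `*` setT ->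
  `|\1_B z * x| <= \1_(`]s, t]%classic) z.1 * `|x|.
Proof.
move=> Bst; rewrite normrM; apply: ler_wpM2r => //.
rewrite !indicE; case: (boolP (z \in B)); rewrite ?normr0// ?normr1 inE => /Bst[/= h _].
by rewrite mem_set.
Qed.

Let modular_rectangle (B : set X1) (s t : R) : s <= t -> DW B -> B `<=` `]s, t]%classic `*` setT ->
  [/\ (modular mu1 sq (fW B) <= (t - s)%:E * modular zeta sq b0)%E,
      (modular mu2 mix (fC B) <= (t - s)%:E * modular (zeta \x nu)%E mix c0)%E &
      (modular mu2 cut (fE B) <= (t - s)%:E * modular (zeta \x nu)%E cut e0)%E].
Proof.
move=> st bB Bst; split.
- apply: (modular_time zeta sq_modulus st mb0 (mfW bB)) => z.
  by rewrite fWE//; exact: indic_le.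
- apply: (modular_time_mark zeta mix_modulus nu st mc0 (mfC bB)) => z.
  by rewrite fCE//; exact: indic_le.
- apply: (modular_time_mark zeta cut_modulus nu st me0 (mfE bB)) => z.
  by rewrite fEE//; exact: indic_le.
Qed.

Let modular_fin (B : set X1) : DW B ->
  [/\ (modular mu1 sq (fW B) < +oo)%E, (modular mu2 mix (fC B) < +oo)%E &
      (modular mu2 cut (fE B) < +oo)%E].
Proof.
move=> bB; have [t t0 Bt] := Borel_b_time_bounded bB.
(* The slabs are open on the left, and [B] may contain points at time 0; starting at -1 includes
   them. *)
have Bst : B `<=` `]-1, t]%classic `*` setT.
  move=> z /Bt[/= h _]; split => //=; move: h; rewrite !in_itv/= => /andP[h ->].
  by rewrite andbT (lt_le_trans _ h)//; lra.
have st : -1 <= t by lra.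
have [h1 h2 h3] := modular_rectangle st bB Bst.
have fin x : (0 <= x)%E -> (x < +oo)%E -> ((t - -1)%:E * x < +oo)%E.
  by move=> x0 xoo; rewrite lte_mul_pinfty// lee_fin; lra.
split.
- by apply: (le_lt_trans h1); apply: fin => //; exact: (modular_ge0 _ sq_modulus).
- by apply: (le_lt_trans h2); apply: fin => //; exact: (modular_ge0 _ mix_modulus).
- by apply: (le_lt_trans h3); apply: fin => //; exact: (modular_ge0 _ cut_modulus).
Qed.

Let oW B : DW B -> modular_on mu1 B sq (fW B).
Proof.
move=> bB; have [h _ _] := modular_fin bB; split => //; first exact: mfW.
by move=> z nB; rewrite /fW indicE memNset// mul0r.
Qed.

Let oC B : DW B -> modular_on mu2 (B `*` setT) mix (fC B).
Proof.
move=> bB; have [_ h _] := modular_fin bB; split => //; first exact: mfC.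
by move=> z nB; rewrite /fC indicE memNset ?mul0r// => Bz; apply: nB.
Qed.

Let oE B : DW B -> modular_on mu2 (B `*` setT) cut (fE B).
Proof.
move=> bB; have [_ _ h] := modular_fin bB; split => //; first exact: mfE.
by move=> z nB; rewrite /fE indicE memNset ?mul0r// => Bz; apply: nB.
Qed.

Let hS1 B : DW B -> forall A, measurable A -> A `<=` B -> (mu1 A < +oo)%E -> DW A.
Proof. by move=> bB A mA AB _; exact: Borel_b_time_sub AB. Qed.

Let hS2 B : DW B -> forall A, measurable A -> A `<=` B `*` setT -> (mu2 A < +oo)%E -> DN A.
Proof. by move=> bB A mA AB Afin; split => //; exists B. Qed.

Let Dm1 := @Borel_b_time_measurable R d O.
Let D10 := Borel_b_time0 O.
Let D1I := @Borel_b_timeI R d O.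
Let D1D := @Borel_b_timeD R d O.
Let D1U := @Borel_b_timeU R d O.
Let Dm2 := @Borel_b_time_mark_measurable R d O _ U mu2.
Let D20 := Borel_b_time_mark0 O mu2.
Let D2I := @Borel_b_time_markI R d O _ U mu2.
Let D2D := @Borel_b_time_markD R d O _ U mu2.
Let D2U := @Borel_b_time_markU R d O _ U mu2.

Let IW B := wiener_integral DW mu1 W (fW B).
Let IC B := compensated_integral DN mu2 N (fC B).
Let IE B := poisson_integral DN N (fE B).

Let pW B : DW B -> prob_integral P W' (fW B) (IW B).
Proof. by move=> bB; exact: (wiener_prob_integral Dm1 D10 D1I D1D D1U (hS1 bB) aW lawW (oW bB)). Qed.

Let pC B : DW B -> prob_integral P C' (fC B) (IC B).
Proof.
by move=> bB; exact: (compensated_integral_prob_integral Dm2 D20 D2I D2D D2U (hS2 bB) aN lawN (oC bB)).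
Qed.

Let pE B : DW B -> prob_integral P N' (fE B) (IE B).
Proof.
by move=> bB; exact: (poisson_integral_prob_integral Dm2 D20 D2I D2D (hS2 bB) aN lawN (oE bB)).
Qed.

Let qW B : DW B -> prob_integrable mu1 sq DW (fW B).
Proof. by move=> bB; exact: (modular_on_integrable (hS1 bB) sq_modulus (oW bB)). Qed.

Let qC B : DW B -> prob_integrable mu2 mix DN (fC B).
Proof. by move=> bB; exact: (modular_on_integrable (hS2 bB) mix_modulus (oC bB)). Qed.

Let qE B : DW B -> prob_integrable mu2 cut DN (fE B).
Proof. by move=> bB; exact: (modular_on_integrable (hS2 bB) cut_modulus (oE bB)). Qed.

Let domW : dominated_by P mu1 sq DW W'.
Proof. exact: (gaussian_dominated Dm1 D10 D1I D1D D1U aW lawW). Qed.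
Let domC : dominated_by P mu2 mix DN C'.
Proof. exact: (compensated_dominated Dm2 D20 D2I D2D D2U aN lawN). Qed.
Let domE : dominated_by P mu2 cut DN N'.
Proof. exact: (poisson_dominated Dm2 D20 D2I D2D aN lawN). Qed.

Definition noise (B : set X1) (w : T) : R := IW B w + IC B w + IE B w.

Lemma measurable_noise B : measurable_fun setT (noise B).
Proof.
by apply: measurable_funD; [apply: measurable_funD|]; exact: measurable_funP.
Qed.

Lemma noiseU B B' : DW B -> DW B' -> B `&` B' = set0 ->
  {ae P, forall w, noise (B `|` B') w = noise B w + noise B' w}.
Proof.
move=> bB bB' BB'; have bU := D1U bB bB'.
have iU z : (\1_(B `|` B') z : R) = \1_B z + \1_B' z.
  rewrite !indicE in_setU; case: (boolP (z \in B)) => h; case: (boolP (z \in B')) => h' /=;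
    rewrite ?addr0 ?add0r//.
  by exfalso; move: h h'; rewrite !inE => h h'; have /seteqP[/(_ z) + _] := BB'; apply.
have uW := prob_integralD sq_modulus Dm1 mW domW (qW bB) (qW bB') (qW bU) _ (pW bB) (pW bB').
have uC := prob_integralD mix_modulus Dm2 mC domC (qC bB) (qC bB') (qC bU) _ (pC bB) (pC bB').
have uE := prob_integralD cut_modulus Dm2 mN domE (qE bB) (qE bB') (qE bU) _ (pE bB) (pE bB').
have vW : {ae P, forall w, IW (B `|` B') w = IW B w + IW B' w}.
  by apply: (prob_integral_unique mW (pW bU)); apply: uW => z; rewrite /fW iU mulrDl.
have vC : {ae P, forall w, IC (B `|` B') w = IC B w + IC B' w}.
  by apply: (prob_integral_unique mC (pC bU)); apply: uC => z; rewrite /fC iU mulrDl.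
have vE : {ae P, forall w, IE (B `|` B') w = IE B w + IE B' w}.
  by apply: (prob_integral_unique mN (pE bU)); apply: uE => z; rewrite /fE iU mulrDl.
have vWC : {ae P, forall w, IW (B `|` B') w = IW B w + IW B' w /\
    IC (B `|` B') w = IC B w + IC B' w} by apply: filterS2 vW vC.
apply: filterS2 vWC vE => w [hw1 hw2] hw3; exact: (addr3ACA hw1 hw2 hw3).
Qed.

Let total_modular B : \bar R :=
  (modular mu1 sq (fW B) + modular mu2 mix (fC B) + modular mu2 cut (fE B))%E.

Let noise_bound (r : R) : 0 < r -> exists2 K : R, 0 <= K & forall B, DW B ->
  ((pr P [set w | r <= `|noise B w|])%:E <= K%:E * total_modular B)%E.
Proof.
(* One third of the threshold for each of the three integrals. *)
move=> r0; have r3 : 0 < r / 3 by rewrite divr_gt0.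
have [K1 K10 h1] := prob_integral_bound sq_modulus Dm1 mW domW r3.
have [K2 K20 h2] := prob_integral_bound mix_modulus Dm2 mC domC r3.
have [K3 K30 h3] := prob_integral_bound cut_modulus Dm2 mN domE r3.
exists (K1 + K2 + K3); first by rewrite !addr_ge0.
move=> B bB; have mI (I : {RV P >-> R}) : measurable [set w | r / 3 <= `|I w|].
  by apply: measurable_abs_ge; exact: measurable_funP.
set K := (_ + _ + _)%R.
have g1 := modular_ge0 mu1 sq_modulus (fW B).
have g2 := modular_ge0 mu2 mix_modulus (fC B).
have g3 := modular_ge0 mu2 cut_modulus (fE B).
apply: (@le_trans _ _ ((pr P [set w | (r / 3 <= `|IW B w|)%R])%:E +
    ((pr P [set w | (r / 3 <= `|IC B w|)%R])%:E + (pr P [set w | (r / 3 <= `|IE B w|)%R])%:E))%E).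
  rewrite -!EFinD lee_fin.
  apply: (@le_trans _ _ (pr P [set w | r / 3 <= `|IW B w|] +
     pr P ([set w | r / 3 <= `|IC B w|] `|` [set w | r / 3 <= `|IE B w|]))).
    apply: pr_leU => //.
    - by apply: measurable_abs_ge; exact: measurable_noise.
    - exact: measurableU.
    - move=> w /= rw; case: (lerP (r / 3) `|IW B w|) => hw; first by left.
      right; case: (lerP (r / 3) `|IC B w|) => hc'; first by left.
      right => /=; rewrite leNgt; apply/negP => hE; move: rw; rewrite leNgt => /negP; apply.
      rewrite /noise; apply: (le_lt_trans (ler_normD _ _)).
      by have := ler_normD (IW B w) (IC B w); lra.
  rewrite lerD2l; apply: pr_leU => //; exact: measurableU.
rewrite /total_modular addeA (ge0_muleDr _ (adde_ge0 g1 g2) g3) (ge0_muleDr _ g1 g2).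
apply: leeD; [apply: leeD|].
- apply: (le_trans (h1 _ _ (qW bB) (pW bB))); apply: lee_wpmul2r => //.
  by rewrite lee_fin /K; lra.
- apply: (le_trans (h2 _ _ (qC bB) (pC bB))); apply: lee_wpmul2r => //.
  by rewrite lee_fin /K; lra.
- apply: (le_trans (h3 _ _ (qE bB) (pE bB))); apply: lee_wpmul2r => //.
  by rewrite lee_fin /K; lra.
Qed.

Lemma noise_short_time (r : R) : 0 < r -> exists2 K : R, 0 <= K & forall s t B, s <= t -> DW B ->
  B `<=` `]s, t]%classic `*` setT -> pr P [set w | r <= `|noise B w|] <= K * (t - s).
Proof.
move=> r0; have [K K0 hK] := noise_bound r0.
pose Phi := (modular zeta sq b0 + modular (zeta \x nu)%E mix c0 + modular (zeta \x nu)%E cut e0)%E.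
have g1 := modular_ge0 zeta sq_modulus b0.
have g2 := modular_ge0 (zeta \x nu)%E mix_modulus c0.
have g3 := modular_ge0 (zeta \x nu)%E cut_modulus e0.
have Phi0 : (0 <= Phi)%E by apply: adde_ge0 => //; exact: adde_ge0.
have Phifin : Phi \is a fin_num by rewrite ge0_fin_numE//; apply: lte_add_pinfty => //; exact: lte_add_pinfty.
exists (K * fine Phi); first by rewrite mulr_ge0// fine_ge0.
move=> s t B st bB Bst; rewrite -lee_fin; apply: (le_trans (hK _ bB)).
rewrite EFinM EFinM fineK// -muleA; apply: lee_wpmul2l; first by rewrite lee_fin.
have [h1 h2 h3] := modular_rectangle st bB Bst.
have ts : (0 <= (t - s)%:E)%E by rewrite lee_fin subr_ge0.
rewrite /total_modular /Phi [X in (_ <= X)%E]muleC (ge0_muleDr _ (adde_ge0 g1 g2) g3) (ge0_muleDr _ g1 g2).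
by apply: leeD => //; exact: leeD.
Qed.

Lemma noise_cvg0 (B : nat -> set X1) : (forall n, DW (B n)) -> (forall n, B n `<=` B 0%N) ->
  (forall z, \forall n \near \oo, ~ B n z) -> cvgP P (fun n => noise (B n)) (cst 0).
Proof.
move=> bB BB0 Bz; have [m1 m2 m3] := modular_fin (bB 0%N).
have iz z : \forall n \near \oo, (\1_(B n) z : R) = 0.
  by apply: filterS (Bz z) => n nz; rewrite indicE memNset.
have ile n z : (\1_(B n) z : R) <= \1_(B 0%N) z.
  rewrite !indicE; case: (boolP (z \in B n)); rewrite ?ler0n// inE => /BB0 h.
  by rewrite mem_set.
have cvg (x : nat -> R) : (\forall n \near \oo, x n = 0) -> x n @[n --> \oo] --> (0 : R).
  by move=> x0; apply: cvg_near_cst.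
have iabs n z (x : R) : `|\1_(B n) z * x| <= `|\1_(B 0%N) z * x|.
  rewrite !normrM ler_wpM2r// !ger0_norm//.
have l1 : modular mu1 sq (fW (B n)) @[n --> \oo] --> 0%E.
  apply: (modular_cvg0 sq_modulus _ (mfW (bB 0%N)) m1) => [n|n z|z]; first exact: mfW.
    exact: iabs.
  by apply: cvg; apply: filterS (iz z) => n; rewrite /fW => ->; rewrite mul0r.
have l2 : modular mu2 mix (fC (B n)) @[n --> \oo] --> 0%E.
  apply: (modular_cvg0 mix_modulus _ (mfC (bB 0%N)) m2) => [n|n z|z]; first exact: mfC.
    exact: iabs.
  by apply: cvg; apply: filterS (iz z.1) => n; rewrite /fC => ->; rewrite mul0r.
have l3 : modular mu2 cut (fE (B n)) @[n --> \oo] --> 0%E.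
  apply: (modular_cvg0 cut_modulus _ (mfE (bB 0%N)) m3) => [n|n z|z]; first exact: mfE.
    exact: iabs.
  by apply: cvg; apply: filterS (iz z.1) => n; rewrite /fE => ->; rewrite mul0r.
have lS : total_modular (B n) @[n --> \oo] --> 0%E.
  rewrite -[X in _ --> X]adde0 -[X in _ --> (X + _)%E]adde0.
  by apply: cvgeD => //; apply: cvgeD.
move=> r r0; have [K K0 hK] := noise_bound r0.
have d0 : 0 < r / (K + 1) by rewrite divr_gt0// ltr_wpDl.
have : \forall n \near \oo, (total_modular (B n) <= (r / (K + 1))%:E)%E.
  move/fine_cvgP : lS => [hfin /cvgrPdist_le/(_ _ d0)].
  apply: filterS2 hfin => n /= fn; rewrite sub0r normrN => hn.
  by rewrite -(fineK fn) lee_fin; apply: le_trans hn; exact: ler_norm.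
apply: filterS => n hn; rewrite (_ : [set w | _] = [set w | r <= `|noise (B n) w|]); last first.
  by apply/seteqP; split => w /=; rewrite subr0.
rewrite -lee_fin; apply: (le_trans (hK _ (bB n))).
apply: (@le_trans _ _ (K%:E * (r / (K + 1))%:E)%E); first by apply: lee_wpmul2l.
by rewrite -EFinM lee_fin mulrCA ger_pMr// ler_pdivrMr ?ltr_wpDl// mul1r lerDl.
Qed.

Let V := joint W' N'.
Let D := pure DW DN.

(** It meets both sides, so in general it is not [pure]; it only bounds the sets on which [W] and
    [N] are evaluated. *)
Definition cylinder (B : set X1) : set (X1 + X2) :=
  left_set B `|` right_set (B `*` setT).

Let cross : cross_independent P DW DN W' N'.
Proof.
move=> J A E S S' DA DE mS mS'; have gF := generated_forall DA mS; have gG := generated_forall DE mS'.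
have m1 : measurable [set w | forall j, S j (W' (A j) w)].
  by apply: measurable_forall.
have m2 : measurable [set w | forall j, S' j (N' (E j) w)].
  by apply: measurable_forall.
apply: EFin_inj; rewrite EFinM -!prE//; last exact: measurableI.
exact: hWN.
Qed.

Let mV C : measurable_fun setT (V C). Proof. exact: measurable_joint. Qed.
Let aV : fin_additive P D V. Proof. exact: joint_fin_additive. Qed.
Let iV : fin_independent P D V. Proof. exact: joint_fin_independent. Qed.

(** * Comparison with the noise shifted in time *)

Section shifted.
Variables (h : R) (h0 : 0 <= h).
(** The preimage moves a set forward in time by [h], so [Wh], [Nh] and [Vh] are the noise seen from
    time [h] on; [h >= 0] keeps the sets in the time domain. *)
Let Wh : set X1 -> T -> R := fun A => W' (time_shift h @^-1` A).
Let Nh : set X2 -> T -> R := fun E => N' (mark_shift h @^-1` E).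
Let Vh := joint Wh Nh.

Let mu1_shift A : measurable A -> mu1 (time_shift h @^-1` A) = mu1 A.
Proof.
have mg : measurable_fun setT (fun u : R => u - h) by exact: measurable_funB.
exact: (product_measure_invariant zeta mg (@leb_shift R h)).
Qed.

Let mu2_shift E : measurable E -> mu2 (mark_shift h @^-1` E) = mu2 E.
Proof. exact: (product_measure_invariant nu (measurable_time_shift h) mu1_shift). Qed.

Let DWh A : DW A -> DW (time_shift h @^-1` A).
Proof. exact: Borel_b_time_shift. Qed.

Let DNh E : DN E -> DN (mark_shift h @^-1` E).
Proof. exact: Borel_b_time_mark_shift. Qed.

Let aWh : fin_additive P DW Wh. Proof. exact: fin_additive_preimage. Qed.
Let iWh : fin_independent P DW Wh. Proof. exact: fin_independent_preimage. Qed.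
Let aNh : fin_additive P DN Nh. Proof. exact: fin_additive_preimage. Qed.
Let iNh : fin_independent P DN Nh. Proof. exact: fin_independent_preimage. Qed.

Let mVh C : measurable_fun setT (Vh C).
Proof. by apply: measurable_joint => A; [exact: mW|exact: mN]. Qed.
Let aVh : fin_additive P D Vh. Proof. exact: joint_fin_additive. Qed.
Let iVh : fin_independent P D Vh.
Proof.
apply: joint_fin_independent => //; try by move=> A; (exact: mW || exact: mN).
by move=> J A E S S' DA DE mS mS'; apply: cross => // j; [exact: DWh|exact: DNh].
Qed.

Let preimage_measurable (f : T -> R) (S : set R) : measurable_fun setT f -> measurable S ->
  measurable (f @^-1` S).
Proof. by move=> mf mS; rewrite -[X in measurable X]setTI; exact: mf. Qed.

(** On a pure set only one of the two noises is present, and its law depends on the set only through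
    the intensity, which the shift preserves. *)
Let Vh_law C S : D C -> measurable S -> pr P (V C @^-1` S) = pr P (Vh C @^-1` S).
Proof.
move=> DC mS; case: DC => -[D1 D2].
  have N0 := fin_additive0 D20 aN.
  transitivity (pr P (W' (inl @^-1` C) @^-1` S)).
    apply: (ae_pr_eq _ _ N0); [exact: preimage_measurable|exact: preimage_measurable|].
    by move=> w n0; rewrite /V /joint /= D2 n0 addr0.
  transitivity (pr P (Wh (inl @^-1` C) @^-1` S)); last first.
    apply: (ae_pr_eq _ _ N0); [exact: preimage_measurable|exact: preimage_measurable|].
    by move=> w n0; rewrite /Vh /joint /= D2 /Nh preimage_set0 n0 addr0.
  have [v vE [_ gv]] := lawW D1; have [v' vE' [_ gv']] := lawW (DWh D1).
  have vv : v = v' by apply: EFin_inj; rewrite -vE -vE' mu1_shift//; exact: Dm1.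
  by rewrite /pr /Wh (gv _ mS) (gv' _ mS) vv.
have W0 := fin_additive0 D10 aW.
transitivity (pr P (N' (inr @^-1` C) @^-1` S)).
  apply: (ae_pr_eq _ _ W0); [exact: preimage_measurable|exact: preimage_measurable|].
  by move=> w w0; rewrite /V /joint /= D1 w0 add0r.
transitivity (pr P (Nh (inr @^-1` C) @^-1` S)); last first.
  apply: (ae_pr_eq _ _ W0); [exact: preimage_measurable|exact: preimage_measurable|].
  by move=> w w0; rewrite /Vh /joint /= D1 /Wh preimage_set0 w0 add0r.
have [v vE [_ gv]] := lawN D2; have [v' vE' [_ gv']] := lawN (DNh D2).
have vv : v = v' by apply: EFin_inj; rewrite -vE -vE' mu2_shift//; exact: Dm2.
by rewrite /pr /Nh (gv _ mS) (gv' _ mS) vv.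
Qed.

Let supported_levels {dX} {X : measurableType dX} {X' : Type} (D' : set (set X')) (i : set X -> set X') (B : set X)
    (K : set X') (f : X -> R) n :
  (forall A, A `<=` B -> i A `<=` K) ->
  (forall z, ~ B z -> f z = 0) ->
  (forall p, p \in qlevels f n -> D' (i p.2)) ->
  supported D' K [seq (p.1, i p.2) | p <- qlevels f n].
Proof.
move=> iK fB Df p /mapP[q ql ->] /=; split; first exact: Df.
apply: iK; case/mapP : ql => r; rewrite mem_filter => /andP[r0 _] -> z /= fz.
by apply: contrapT => /fB fz0; case/eqP: r0; rewrite -fz /= fz0; exact: quant0.
Qed.

Let pair_left B f (Y Y2 : T -> R) : (forall n, in_D DW (qlevels f n)) ->
  (forall z, ~ B z -> f z = 0) ->
  prob_integral P W' f Y -> prob_integral P W' (f \o time_shift h) Y2 ->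
  local_pair P D V Vh (cylinder B) Y Y2.
Proof.
move=> Df fB [mY hY] [mY2 hY2]; split => //.
exists (fun=> 0), (fun n => [seq (p.1, left_set p.2) | p <- qlevels f n]); split.
- move=> n; apply: (supported_levels _ fB) => [A AB|p /Df]; last exact: pure_inl.
  by move=> _ [z Az <-]; left; exists z => //; exact: AB.
- apply: cvgP_ext hY => //.
  + by move=> n; exact: measurable_lin.
  + by move=> n; apply: measurable_funD => //; exact: measurable_lin.
  + move=> n; apply: filterS (fin_additive0 D20 aN) => w n0.
    rewrite add0r /lin !big_map; apply: eq_bigr => p _ /=.
    by rewrite /V /joint !preimage_left_set n0 addr0.
  + exact: aeW.
(* The quantization of [f \o time_shift h] has, by computation, the same heights as that of [f] and
   the preimages of its sets. *)
- apply: cvgP_ext hY2 => //.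
  + by move=> n; exact: measurable_lin.
  + by move=> n; apply: measurable_funD => //; exact: measurable_lin.
  + move=> n; apply: filterS (fin_additive0 D20 aN) => w n0.
    rewrite add0r /lin !big_map; apply: eq_bigr => r _ /=.
    by rewrite /Vh /joint !preimage_left_set /Nh preimage_set0 n0 addr0.
  + exact: aeW.
Qed.

(** One statement for both Poisson integrals: [k] is the intensity in the compensated case and 0
    otherwise. Its invariance under the shift makes the constants of the two approximations
    coincide, as [local_pair] demands. *)
Let pair_right (k : set X2 -> R) B f (Y Y2 : T -> R) : (forall n, in_D DN (qlevels f n)) ->
  (forall E, DN E -> k (mark_shift h @^-1` E) = k E) ->
  (forall z, ~ (B `*` setT) z -> f z = 0) ->
  prob_integral P (fun E w => N' E w - k E) f Y ->
  prob_integral P (fun E w => N' E w - k E) (f \o mark_shift h) Y2 ->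
  local_pair P D V Vh (cylinder B) Y Y2.
Proof.
move=> Df kh fB [mY hY] [mY2 hY2]; split => //.
have mk E : measurable_fun setT (fun w => N' E w - k E) by exact: measurable_funB.
exists (fun n => - \sum_(p <- qlevels f n) p.1 * k p.2),
  (fun n => [seq (p.1, right_set p.2) | p <- qlevels f n]); split.
- move=> n; apply: (supported_levels _ fB) => [A AB|p /Df]; last exact: pure_inr.
  by move=> _ [z Az <-]; right; exists z => //; exact: AB.
- apply: cvgP_ext hY => //.
  + by move=> n; exact: measurable_lin.
  + by move=> n; apply: measurable_funD => //; exact: measurable_lin.
  + move=> n; apply: filterS (fin_additive0 D10 aW) => w w0.
    rewrite /lin !big_map addrC -sumrB; apply: eq_bigr => p _ /=.
    by rewrite /V /joint !preimage_right_set w0 add0r mulrBr.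
  + exact: aeW.
- apply: cvgP_ext hY2 => //.
  + by move=> n; exact: measurable_lin.
  + by move=> n; apply: measurable_funD => //; exact: measurable_lin.
  + move=> n; apply: filterS (fin_additive0 D10 aW) => w w0.
    have -> : \sum_(p <- qlevels f n) p.1 * k p.2 =
        \sum_(p <- qlevels f n) p.1 * k (mark_shift h @^-1` p.2).
      by apply: eq_big_seq => p pl; rewrite kh//; exact: Df pl.
    rewrite /lin !big_map addrC -sumrB; apply: eq_bigr => r _ /=.
    by rewrite /Vh /joint !preimage_right_set /Wh preimage_set0 w0 add0r mulrBr.
  + exact: aeW.
Qed.

Let noise_pair B : DW B ->
  local_pair P D V Vh (cylinder B) (noise B) (noise (time_shift h @^-1` B)).
Proof.
move=> bB; have bBh := DWh bB.
have ish z : (\1_(time_shift h @^-1` B) z : R) = \1_B (time_shift h z).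
  by rewrite !indicE; congr (_%:R); apply/idP/idP; rewrite !inE.
apply: local_pairD => //; [apply: local_pairD => //|].
- apply: (pair_left (pi_levels (qW bB)) (mo_support (oW bB)) (pW bB)).
  have <- : fW (time_shift h @^-1` B) = fW B \o time_shift h by apply/funext => z; rewrite /fW ish.
  exact: pW bBh.
- apply: (pair_right (pi_levels (qC bB)) (k := fun E => fine (mu2 E)) _ (mo_support (oC bB)) (pC bB)).
    by move=> E DE; rewrite mu2_shift//; exact: Dm2.
  have <- : fC (time_shift h @^-1` B) = fC B \o mark_shift h by apply/funext => z; rewrite /fC ish.
  exact: pC bBh.
- have N0 : N' = (fun E w => N' E w - 0) by apply/funext => E; apply/funext => w; rewrite subr0.
  apply: (pair_right (pi_levels (qE bB)) (k := fun=> 0) _ (mo_support (oE bB))) => //.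
    by rewrite -N0; exact: pE.
  have <- : fE (time_shift h @^-1` B) = fE B \o mark_shift h by apply/funext => z; rewrite /fE ish.
  by rewrite -N0; exact: pE.
Qed.

Lemma noise_stationary n (B : 'I_n -> set X1) (S : set 'rV[R]_n) : (forall i, DW (B i)) ->
  measurable S -> pr P ((fun w => \row_i noise (B i) w) @^-1` S) =
    pr P ((fun w => \row_i noise (time_shift h @^-1` B i) w) @^-1` S).
Proof.
move=> bB mS.
have pB i : local_pair P D V Vh (\bigcup_i cylinder (B i)) (noise (B i)) (noise (time_shift h @^-1` B i)).
  by apply: local_pair_sub (noise_pair (bB i)) => z Bz; exists i.
have L := local_same_law (pure0 _ D10) (pureI D10 D1I D2I) (pureD D1D D2D) mV mVh aV aVh iV iVh Vh_law.
exact: (L _ _ _ _ pB _ mS).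
Qed.

(** The component of the pair built from [Vh] is forgotten, so any shift will do; it is used with
    [h = 0]. *)
Lemma noise_local B : DW B -> local_rv P D V (cylinder B) (noise B).
Proof.
by move=> /noise_pair[mY _ [a [l [sl cl _]]]]; split => //; exists a, l.
Qed.

End shifted.

Let cylinderI B B' : B `&` B' = set0 -> cylinder B `&` cylinder B' = set0.
Proof.
move=> BB'; have BB z : B z -> B' z -> False.
  by move=> Bz Bz'; have /seteqP[/(_ z) + _] := BB'; apply.
apply/seteqP; split => z //= [].
by move=> [[x Bx <-]|[x [Bx _] <-]] [[y By]|[y [By _]]] // [yx]; apply: BB Bx _; rewrite -yx.
Qed.

Let cylinder_le B B' : B `<=` B' -> cylinder B `<=` cylinder B'.
Proof.
move=> BB' z [[x Bx <-]|[x [Bx _] <-]]; first by left; exists x => //; exact: BB'.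
by right; exists x => //; split => //; exact: BB'.
Qed.

Lemma noise_levy_valued (rho : set 'rV[R]_d -> R) (M : R -> set 'rV[R]_d -> {RV P >-> R}) :
  signed_measure_on (Borel_b O) rho ->
  (forall t A, 0 <= t -> Borel_b O A -> M t A = block noise rho 0 t A :> (T -> R)) ->
  levy_valued_random_measure O M.
Proof.
move=> hrho; apply: (process_levy_valued (pure0 _ D10) (pureI D10 D1I D2I) (pureD D1D D2D)
  mV aV iV cylinderI cylinder_le measurable_noise noiseU (noise_local (lexx 0)) _
  noise_short_time noise_cvg0 hrho) => h n B S h0.
exact: noise_stationary.
Qed.

End integral_process.

Theorem proposition2p5 (R : realType)
  (dT : measure_display) (T : measurableType dT) (P : probability T R)
  (d : nat) (O : set 'rV[R]_d) (mO : measurable O)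
  (zeta : {sigma_finite_measure set 'rV[R]_d -> \bar R})
  (zetaO : zeta (~` O) = 0%E)
  (dU : measure_display) (U : measurableType dU)
  (nu : {sigma_finite_measure set U -> \bar R})
  (rho : set 'rV[R]_d -> R) (hrho : signed_measure_on (Borel_b O) rho)
  (W : set (R * 'rV[R]_d) -> {RV P >-> R})
  (hW : gaussian_random_measure (Borel_b_time O) (intensity_time zeta) W)
  (N : set (R * 'rV[R]_d * U) -> {RV P >-> R})
  (hN : poisson_random_measure
          (Borel_b_time_mark O (intensity_time_mark zeta nu))
          (intensity_time_mark zeta nu) N)
  (hWN : independent_random_measures (Borel_b_time O) W
           (Borel_b_time_mark O (intensity_time_mark zeta nu)) N)
  (b : 'rV[R]_d -> R) (mb : measurable_fun O b)
  (hb : (\int[zeta]_(x in O) ((b x) ^+ 2)%:E < +oo)%E)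
  (c : 'rV[R]_d * U -> R) (mc : measurable_fun (O `*` setT) c)
  (hc : (\int[zeta \x nu]_(z in O `*` setT)
           (Num.min (`|c z| ^+ 2) `|c z|)%:E < +oo)%E)
  (e : 'rV[R]_d * U -> R) (me : measurable_fun (O `*` setT) e)
  (he : (\int[zeta \x nu]_(z in O `*` setT) (Num.min `|e z| 1)%:E < +oo)%E) :
  levy_valued_random_measure O
    (fun (t : R) (A : set 'rV[R]_d) =>
       space_time_measure O zeta nu rho W N b c e (`]0, t] `*` A)).
Proof.
apply: (noise_levy_valued mO hW hN hWN mb hb mc hc me he hrho) => t A t0 bA.
apply/funext => w; rewrite /block subr0 /noise.
(* The drift [t * rho A] of the block is the product measure of the rectangle; the random part is
   the sum of the three integrals by definition. *)
rewrite -(leb_prod_rectangle A t0 hrho.1) !addrA.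
reflexivity.
Qed.
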